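(* Let $d\ge 1$ and let $p,q>0$ with $pq<1$. (i) For every $\delta>0$ there is a constant $C=C(p,q,d,\delta)<\infty$ such that whenever $A\subseteq\mathbf{R}^d$ is $(p,\delta)$-separated and $B\subseteq\mathbf{R}^d$ is $(q,\delta)$-separated, $\operatorname{Coker}\mathcal{F}_{A,B}$ is finite-dimensional of dimension at most $C$, and $\operatorname{Ker}\mathcal{F}_{A,B}$ is infinite-dimensional. (ii) There is $\delta_0=\delta_0(p,q,d)>0$ such that if $\delta\ge\delta_0$, then for all $(p,\delta)$-separated $A\subseteq\mathbf{R}^d$ and all $(q,\delta)$-separated $B\subseteq\mathbf{R}^d$, the map $\mathcal{F}_{A,B}$ is surjective.
   Context: Write $\langle x\rangle=\sqrt{1+|x|^2}$, and let $B_R(x)$ be the open ball of radius $R$ about $x$. For $p\ge0$, $\delta>0$, a set $S\subseteq\mathbf{R}^d$ is $(p,\delta)$-separated if the balls $B_{\delta\langle x\rangle^{-p}}(x)$, $x\in S$, are pairwise disjoint (such a set is automatically closed and discrete). The Fourier transform is $\hat f(\xi)=\int_{\mathbf{R}^d}f(x)e^{-2\pi i x\cdot\xi}\,dx$. For a closed discrete set $A\subseteq\mathbf{R}^d$, $\mathcal{S}(A)$ is the space of rapidly decreasing sequences on $A$, i.e. functions $\alpha:A\to\mathbf{C}$ with $\sup_{a\in A}|\alpha(a)|\langle a\rangle^j<\infty$ for all $j\in\mathbf{N}$. For closed discrete $A,B\subseteq\mathbf{R}^d$, $\mathcal{F}_{A,B}:\mathcal{S}(\mathbf{R}^d)\to\mathcal{S}(A)\oplus\mathcal{S}(B)$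 is the linear map $f\mapsto(f|_A,\hat f|_B)$ on Schwartz functions. $\operatorname{Ker}$ is its kernel and $\operatorname{Coker}$ is the quotient of the target vector space by the image. *)

(* Defs.v *)
From HB Require Import structures.
From mathcomp Require Import all_boot all_order all_algebra.
From mathcomp Require Import all_classical all_reals all_analysis.
From mathcomp Require Import complex.

Set Implicit Arguments.
Unset Strict Implicit.
Unset Printing Implicit Defensive.

Import Order.TTheory GRing.Theory Num.Theory.
Import numFieldNormedType.Exports.

Local Open Scope classical_set_scope.
Local Open Scope ring_scope.
Local Open Scope complex_scope.

(* Lebesgue measure on R^d, as the d-fold product of the one-dimensional
   Lebesgue measure. It lives on tuples because these carry the library's product
   sigma-algebra; [row_of_tuple] below transports it to row vectors. *)
Section lebesgue_tuple.
Variable R : realType.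
Local Notation mR := (measurableTypeR R).

Definition cons_pair (n : nat) (u : mR * n.-tuple mR) : n.+1.-tuple mR :=
  [tuple of u.1 :: u.2].

Lemma measurable_cons_pair n : measurable_fun setT (@cons_pair n).
Proof. exact: measurable_cons. Qed.

Section step.
Variables (n : nat) (mu : {sigma_finite_measure set (n.-tuple mR) -> \bar R}).

Definition lebesgue_step : set (n.+1.-tuple mR) -> \bar R :=
  pushforward (lebesgue_measure \x mu)%E (@cons_pair n).

Let step0 : lebesgue_step set0 = 0%E.
Proof. by rewrite /lebesgue_step /pushforward preimage_set0 measure0. Qed.

Let step_ge0 A : (0 <= lebesgue_step A)%E.
Proof. by rewrite /lebesgue_step /pushforward; apply: measure_ge0. Qed.

Let step_sigma_additive : semi_sigma_additive lebesgue_step.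
Proof.
move=> F mF tF mUF; rewrite /lebesgue_step /pushforward preimage_bigcup.
have mp B : measurable B -> measurable (@cons_pair n @^-1` B).
  by move=> mB; rewrite -[X in measurable X]setTI; apply: measurable_cons_pair.
apply: measure_semi_sigma_additive => //.
- by move=> i; exact: mp.
- apply/trivIsetP => i j _ _ ij.
  by rewrite -preimage_setI; move/trivIsetP : tF => /(_ _ _ _ _ ij) ->//; rewrite preimage_set0.
- by rewrite -preimage_bigcup; exact: mp.
Qed.

HB.instance Definition _ := isMeasure.Build _ _ _ lebesgue_step
  step0 step_ge0 step_sigma_additive.

Let step_sigma_finite : sigma_finite setT lebesgue_step.
Proof.
have /sigma_finiteP[F [TF ndF Foo]] := sigma_finiteT (@lebesgue_measure R).
have /sigma_finiteP[G [TG ndG Goo]] := sigma_finiteT mu.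
pose g (t : n.+1.-tuple mR) : mR * n.-tuple mR := (thead t, [tuple of behead t]).
have mg : measurable_fun setT g.
  by apply/measurable_fun_pairP; split;
    [exact: measurable_tnth|exact: measurable_behead].
have gK : cancel (@cons_pair n) g.
  by case=> x t; rewrite /g theadE; congr pair; apply/val_inj.
exists (fun k => g @^-1` (F k `*` G k)).
  apply/esym/seteqP; split=> // t _.
  have [i _ Fi] : (\bigcup_i F i) (g t).1 by rewrite -TF.
  have [j _ Gj] : (\bigcup_j G j) (g t).2 by rewrite -TG.
  exists (maxn i j) => //; split => /=.
  - by move: Fi; exact/subsetPset/ndF/leq_maxl.
  - by move: Gj; exact/subsetPset/ndG/leq_maxr.
move=> k; have [? ?] := Foo k; have [? ?] := Goo k; split.
  by rewrite -[X in measurable X]setTI; apply: mg => //; exact: measurableX.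
rewrite /lebesgue_step /pushforward -comp_preimage.
rewrite (_ : g \o _ = id); last by apply/funext => u /=; rewrite gK.
rewrite preimage_id product_measure1E//.
by rewrite lte_mul_pinfty// ge0_fin_numE.
Qed.

HB.instance Definition _ := Measure_isSigmaFinite.Build _ _ _ lebesgue_step
  step_sigma_finite.

End step.

Fixpoint lebesgue_tuple (n : nat) :
    {sigma_finite_measure set (n.-tuple mR) -> \bar R} :=
  match n with
  | 0 => dirac [tuple]
  | m.+1 => lebesgue_step (lebesgue_tuple m)
  end.

End lebesgue_tuple.

Section euclidean.
Variables (R : realType) (d : nat).
Implicit Types (x y : 'rV[R]_d) (A : set 'rV[R]_d).

Definition dotp x y : R := \sum_(i < d) x 0 i * y 0 i.

(* The norm `| _ | of the library on 'rV[R]_d is the sup norm. *)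
Definition enorm x : R := Num.sqrt (dotp x x).

Definition eball x (r : R) : set 'rV[R]_d := [set y | enorm (y - x) < r].

Definition jbracket x : R := Num.sqrt (1 + enorm x ^+ 2).

Definition ball_separated (p delta : R) A : Prop :=
  trivIset A (fun x => eball x (delta * jbracket x `^ (- p))).

Definition row_of_tuple (t : d.-tuple R) : 'rV[R]_d := \row_i tnth t i.

Definition integral_Rd (g : 'rV[R]_d -> R) : R :=
  \int[lebesgue_tuple R d]_t g (row_of_tuple t).

Definition integral_RdC (f : 'rV[R]_d -> R[i]) : R[i] :=
  integral_Rd (fun x => complex.Re (f x)) +i* integral_Rd (fun x => complex.Im (f x)).

Definition cis (theta : R) : R[i] := cos theta +i* sin theta.

Definition fourier (f : 'rV[R]_d -> R[i]) (xi : 'rV[R]_d) : R[i] :=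
  integral_RdC (fun x => f x * cis (- (2 * pi * dotp x xi))).

Definition partial (i : 'I_d) (g : 'rV[R]_d -> R) : 'rV[R]_d -> R :=
  fun x => 'D_(delta_mx 0 i) g x.

Definition partials (s : seq 'I_d) (g : 'rV[R]_d -> R) : 'rV[R]_d -> R :=
  foldr partial g s.

Definition smooth (g : 'rV[R]_d -> R) : Prop :=
  forall s x, differentiable (partials s g) x.

Definition schwartzR (g : 'rV[R]_d -> R) : Prop :=
  smooth g /\
  forall (j : nat) (s : seq 'I_d), exists M : R,
    forall x, jbracket x ^+ j * `|partials s g x| <= M.

Definition schwartz : set ('rV[R]_d -> R[i]^o) :=
  [set f | schwartzR (fun x => complex.Re (f x)) /\ schwartzR (fun x => complex.Im (f x))].

Definition rapid A : set (A -> R[i]^o) :=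
  [set alpha | forall j : nat, exists M : R,
     forall a : A, Normc.normc (alpha a) * jbracket (val a) ^+ j <= M].

End euclidean.

Section quotient_dimension.
Variables (K : fieldType) (V : lmodType K).

(* For subspaces W `<=` U of V: the classes modulo W of e_0, ..., e_(n-1) form a
   basis of U / W. *)
Definition quot_basis (U W : set V) (n : nat) (e : 'I_n -> V) : Prop :=
  [/\ forall i, U (e i),
      forall u, U u -> exists c : 'I_n -> K, W (u - \sum_(i < n) c i *: e i) &
      forall c : 'I_n -> K, W (\sum_(i < n) c i *: e i) -> forall i, c i = 0].

Definition quot_dim (U W : set V) (n : nat) : Prop :=
  exists e : 'I_n -> V, quot_basis U W e.

Definition infinite_dim (U : set V) : Prop :=
  ~ exists n, quot_dim U [set 0] n.

End quotient_dimension.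

Section fourier_restriction.
Variables (R : realType) (d : nat) (A B : set 'rV[R]_d).

Local Notation seqs := ((A -> R[i]^o) * (B -> R[i]^o))%type.

Definition rapid_pairs : set seqs := [set u | rapid u.1 /\ rapid u.2].

Definition FAB (f : 'rV[R]_d -> R[i]^o) : seqs :=
  (fun a : A => f (val a), fun b : B => fourier f (val b)).

Definition Ker_FAB : set ('rV[R]_d -> R[i]^o) :=
  [set f | schwartz f /\ FAB f = 0].

Definition Coker_FAB_dim (n : nat) : Prop :=
  quot_dim rapid_pairs (FAB @` @schwartz R d) n.

Definition FAB_surjective : Prop :=
  set_surj (@schwartz R d) rapid_pairs FAB.

End fourier_restriction.

(* Main.v *)
Require Import Defs.
From HB Require Import structures.
From mathcomp Require Import all_boot all_order all_algebra.
From mathcomp Require Import all_classical all_reals all_analysis measurable_realfun.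
From mathcomp Require Import complex.
From mathcomp Require Import ring lra.

Set Implicit Arguments.
Unset Strict Implicit.
Unset Printing Implicit Defensive.

Import Order.TTheory GRing.Theory Num.Theory.
Import numFieldNormedType.Exports.

Local Open Scope classical_set_scope.
Local Open Scope ring_scope.

(** The idea is to look for a function with prescribed values on [A] and a
    prescribed transform on [B] as a superposition of Gaussian waves, one for
    each point. To a point [a] of [A] is attached a bump at [a] of width
    [eta <a>^(- p1)], and to a point [b] of [B] a wave whose transform is a bump
    at [b] of width [eta <b>^(- q1)], where [p1 > p], [q1 > q] and still
    [p1 q1 < 1]. With the value 1 at its own point for each wave, the
    coefficients have to solve a system with the matrix [1 + K].

    The matrix [K] is smoothing. The widths are smaller than the separations by
    a power of the bracket, so that the interaction of two points of the same
    set is negligible to all orders ([same_entry_bound]). The transform of the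
    bump at [a] is spread over the scale [<a>^p1], and the wave of [b] over the
    scale [<b>^q1]. With the weights [<a>^(sqrt p1)] and [<b>^(sqrt q1)] both
    facts read alike: two points interact only if the weight of the point of
    evaluation is at most about the power [sqrt (p1 q1) < 1] of the weight of
    the other point ([cross_entry_bound]). Together with a packing bound for
    separated sets ([separated_sum]), this shows that [K] maps sequences that
    are [O(w^(- J))] to sequences that are [O(w^(- J - 1))] if [J] is large
    ([smoothing_uniform]), with constants that depend on [p], [q], [d] and the
    separation only.

    The extra power of the weight makes [K] a contraction on the rows of large
    weight. There the Neumann series converges, and the smoothing property turns
    its sum into a rapidly decreasing sequence ([neumann_solve]); the
    superposition of the waves with these coefficients is then a Schwartz
    function ([synthesis]). Hence the values can be prescribed at all points
    outside a ball whose radius depends on the separation only ([solve_high]).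

    The three claims follow. The cokernel is spanned by the sequences supported
    at one point of this ball, and packing bounds the number of such points
    ([coker_bounded]). For the kernel, [A] can be enlarged by arbitrarily many
    far points ([separated_extension]); the values at them are free, while only
    the fixed number of conditions in the ball remains to be satisfied
    ([kernel_infinite]). Finally, a large separation leaves at most one point of
    each set in a large ball, and for small [eta] the coupling of two such
    points is small too, so that all rows can be kept ([solve_all]).

    The analysis needed for waves is the transform of a Gaussian
    ([integral_gauss_cos], [fourier_wave]), bounds for the derivatives of waves
    that are polynomial in their parameters ([gterm_bound]), and term by term
    differentiation ([differentiable_series]). *)

(** * The Fourier integral of a Gaussian on the line *)

Section gauss1.
Variable R : realType.
Local Notation mu := (@lebesgue_measure R).

Lemma Rintegral_derive_eq0 (H h : R -> R) :
  (forall x : R, is_derive x 1 H (h x)) -> continuous h ->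
  mu.-integrable setT (EFin \o h) ->
  H x @[x --> +oo] --> (0 : R) -> H x @[x --> -oo] --> (0 : R) ->
  \int[mu]_x h x = 0.
Proof.
move=> dH ch ih Hp Hm.
pose f n := ((EFin \o h) \_ `[- n.+1%:R, n.+1%:R] : R -> \bar R).
have cH : continuous H.
  by move=> x; apply/differentiable_continuous/derivable1_diffP; case: (dH x).
have fE n : (\int[mu]_x f n x = (H n.+1%:R - H (- n.+1%:R))%:E)%E.
  rewrite /f -integral_mkcond.
  rewrite (@continuous_FTC2 _ h H) //.
  - have : 0 < n.+1%:R :> R by []. lra.
  - exact/continuous_subspaceT.
  - split.
    + by move=> x _; case: (dH x).
    + exact/cvg_at_right_filter/cH.
    + exact/cvg_at_left_filter/cH.
  - by move=> x _; rewrite derive1E; case: (dH x).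
have [| | | | |_ _ cvgf] := @dominated_convergence _ _ _ mu setT measurableT f
  (EFin \o h) (abse \o (EFin \o h)).
- move=> n; rewrite /f; apply/(measurable_restrictT _ _).1 => //.
  by apply: measurable_funTS; exact: measurable_int ih.
- exact: measurable_int ih.
- apply: aeW => x _.
  apply: cvg_near_cst; near=> n; rewrite /f patchE mem_set //=.
  rewrite in_itv /= -ler_norml.
  apply: le_trans (_ : n%:R <= _); last by rewrite ler_nat.
  by near: n; exact: nbhs_infty_ger.
- exact: integrable_abse.
- apply: aeW => x n _; rewrite /f patchE; case: ifP => //= _.
  by rewrite normr0 lee_fin.
have c0 : (H n.+1%:R - H (- n.+1%:R))%:E @[n --> \oo] --> (0%:E : \bar R).
  apply/fine_cvgP; split; first exact: nearW.
  rewrite /comp /= -[0]subr0; apply: cvgB.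
    by apply: (cvg_comp (fun n => n.+1%:R : R) H _ Hp);
      rewrite (cvg_shiftS (fun n => n%:R : R)); exact: cvgr_idn.
  apply: (cvg_comp (fun n => - n.+1%:R : R) H _ Hm).
  have := @cvgr_idn R; rewrite -(cvg_shiftS (fun n => n%:R : R)).
  by move/cvgNrNy.
rewrite /Rintegral (cvg_unique _ cvgf (_ : _ --> (0%:E : \bar R))) //.

by under eq_fun do rewrite fE.
Unshelve. all: end_near.
Qed.

Lemma integrable_continuous_dom (f g : R -> R) : continuous f ->
  mu.-integrable setT (EFin \o g) -> (forall x, `|f x| <= g x) ->
  mu.-integrable setT (EFin \o f).
Proof.
move=> cf ig fg; apply: le_integrable ig => //.
  by apply/measurable_EFinP; exact: continuous_measurable_fun.
by move=> x _ /=; rewrite lee_fin (le_trans (fg x)) // ler_norm.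
Qed.

Definition gauss (al c x : R) : R := expR (- (al * (x - c) ^+ 2)).

Lemma is_derive_gauss (al c x : R) :
  is_derive x 1 (gauss al c) (- (2 * al * (x - c)) * gauss al c x).
Proof.
have h : is_derive x 1 (fun x : R => - (al * (x - c) ^+ 2)) (- (2 * al * (x - c))).
  apply: is_derive_eq; rewrite /GRing.scale /=; ring.
have -> : gauss al c = expR \o (fun x : R => - (al * (x - c) ^+ 2)) by [].
by apply: (is_derive_eq (is_derive1_comp (is_derive_expR _) h)); rewrite mulrC.
Qed.

Lemma continuous_is_derive (f g : R -> R) :
  (forall x : R, is_derive x 1 f (g x)) -> continuous f.
Proof.
by move=> df x; apply/differentiable_continuous/derivable1_diffP; case: (df x).
Qed.

Lemma is_derive_cos_affine (a b x : R) :
  is_derive x 1 (fun x : R => cos (a * x + b)) (- a * sin (a * x + b)).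
Proof.
have h : is_derive x 1 (fun x : R => a * x + b) a.
  by apply: is_derive_eq; rewrite /GRing.scale /=; ring.
have -> : (fun x : R => cos (a * x + b)) = cos \o (fun x : R => a * x + b) by [].
by apply: (is_derive_eq (is_derive1_comp (is_derive_cos _) h)); rewrite mulrC mulrN mulNr.
Qed.

Lemma is_derive_sin_affine (a b x : R) :
  is_derive x 1 (fun x : R => sin (a * x + b)) (a * cos (a * x + b)).
Proof.
have h : is_derive x 1 (fun x : R => a * x + b) a.
  by apply: is_derive_eq; rewrite /GRing.scale /=; ring.
have -> : (fun x : R => sin (a * x + b)) = sin \o (fun x : R => a * x + b) by [].
by apply: (is_derive_eq (is_derive1_comp (is_derive_sin _) h)); rewrite mulrC.
Qed.

Lemma continuous_gauss (al c : R) : continuous (gauss al c).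
Proof. exact: (continuous_is_derive (is_derive_gauss al c)). Qed.

Lemma integral_gauss (al c : R) : 0 < al ->
  mu.-integrable setT (EFin \o gauss al c) /\
  \int[mu]_x gauss al c x = Num.sqrt (pi / al).
Proof.
move=> a0; pose s : R := Num.sqrt (1 / (2 * al)).
have s2 : s ^+ 2 = 1 / (2 * al) by rewrite sqr_sqrtr // divr_ge0 // mulr_ge0 // ltW.
have s0 : s != 0 by rewrite gt_eqF // sqrtr_gt0 divr_gt0 // mulr_gt0.
have gE x : gauss al c x = Num.sqrt (pi / al) * normal_pdf c s x.
  rewrite normal_pdfE // /normal_peak /normal_fun s2.
  have -> : 1 / (2 * al) * pi *+ 2 = pi / al by rewrite -mulr_natr; field; rewrite ?gt_eqF //.
  rewrite mulrA mulfV ?mul1r; last by rewrite gt_eqF // sqrtr_gt0 divr_gt0 // pi_gt0.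
  by rewrite /gauss; congr expR; rewrite -mulr_natr; field; rewrite ?gt_eqF //.
have gE' : EFin \o gauss al c =
    (fun x => (Num.sqrt (pi / al))%:E * (normal_pdf c s x)%:E)%E.
  by apply/funext => x /=; rewrite gE.
have inp := integrable_normal_pdf c s.
split; first by rewrite gE'; exact: integrableZl.
rewrite /Rintegral; under eq_integral do rewrite gE EFinM.
by rewrite integralZl // integral_normal_pdf mule1.
Qed.

(** An integrable majorant, independent of the frequency, of the derivative of
    the Fourier integrand with respect to the frequency. *)
Lemma gauss_moment_le (al c x : R) : 0 < al ->
  `|x - c| * gauss al c x <= (1 + 2 / al) * gauss (al / 2) c x.
Proof.
move=> a0; set y := x - c.
have -> : gauss al c x = expR (- (al / 2 * y ^+ 2)) * gauss (al / 2) c x.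
  by rewrite /gauss -/y -expRD; congr expR; field.
rewrite mulrA ler_wpM2r ?expR_ge0 // expRN ler_pdivrMr ?expR_gt0 //.
apply: (@le_trans _ _ ((1 + 2 / al) * (1 + al / 2 * y ^+ 2))); last first.
  rewrite ler_wpM2l // ?expR_ge1Dx //.
  by rewrite addr_ge0 // divr_ge0 // ltW.
have -> : (1 + 2 / al) * (1 + al / 2 * y ^+ 2) =
  1 + y ^+ 2 + (al / 2 * y ^+ 2 + 2 / al) by field; rewrite ?gt_eqF //.
have h1 : 0 <= al / 2 * y ^+ 2 by rewrite mulr_ge0 ?sqr_ge0 // divr_ge0 // ltW.
have h2 : 0 <= 2 / al by rewrite divr_ge0 // ltW.
have h3 : 0 <= (`|y| - 1) ^+ 2 by exact: sqr_ge0.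
have h4 : `|y| ^+ 2 = y ^+ 2 by rewrite real_normK // num_real.
nra.
Qed.

Lemma gauss_small (al c e : R) : 0 < al -> 0 < e ->
  exists M : R, forall x, M < `|x| -> gauss al c x < e.
Proof.
move=> a0 e0; exists (`|c| + 1 + 1 / (al * e)) => x Mx.
have h0 : 0 < 1 / (al * e) by rewrite divr_gt0 // mulr_gt0.
have h1 : 1 + 1 / (al * e) < `|x - c|.
  have := ler_normD (x - c) c; rewrite subrK; lra.
rewrite /gauss expRN invf_plt ?posrE ?expR_gt0 //.
apply: (@lt_le_trans _ _ (1 + al * (x - c) ^+ 2)); last exact: expR_ge1Dx.
have h2 : 1 / (al * e) < (x - c) ^+ 2.
  have <- : `|x - c| ^+ 2 = (x - c) ^+ 2 by rewrite real_normK // num_real.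
  nra.
have : al * (1 / (al * e)) < al * (x - c) ^+ 2 by rewrite ltr_pM2l.
have -> : al * (1 / (al * e)) = e^-1 by field; rewrite ?gt_eqF //.
lra.
Qed.

Lemma gauss_trig_small (al c : R) (u : R -> R) : 0 < al -> (forall x, `|u x| <= 1) ->
  gauss al c x * u x @[x --> +oo] --> (0 : R) /\
  gauss al c x * u x @[x --> -oo] --> (0 : R).
Proof.
move=> a0 u1; have H e : 0 < e -> exists M : R, forall x, M < `|x| ->
    `|gauss al c x * u x| < e.
  move=> e0; have [M HM] := gauss_small c a0 e0; exists M => x /HM.
  apply: le_lt_trans; rewrite normrM ger0_norm ?expR_ge0 //.
  by rewrite ler_piMr ?expR_ge0.
split; apply/cvgr0Pnorm_lt => e /H[M HM]; near=> x; apply: HM.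
  apply: lt_le_trans (ler_norm x); near: x; exists M; split => //; exact: num_real.
rewrite -normrN; apply: lt_le_trans (ler_norm _); rewrite ltrNr.
near: x; exists (- M); split => //; exact: num_real.
Unshelve. all: end_near. Qed.

(** As a function of the frequency [w] the integral solves
    [y' = - w / (2 al) y]: one differentiates under the integral sign and
    integrates by parts. *)
Lemma integral_gauss_cos (al c w th : R) : 0 < al ->
  \int[mu]_x (gauss al c x * cos (w * (x - c) + th)) =
  cos th * Num.sqrt (pi / al) * expR (- (w ^+ 2 / (4 * al))).
Proof.
move=> a0.
pose f (w x : R) : R := gauss al c x * cos (w * (x - c) + th).
pose h (w x : R) : R := - (x - c) * gauss al c x * sin (w * (x - c) + th).
have [ig gT] := integral_gauss c a0.
have a20 : 0 < al / 2 by rewrite divr_gt0.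
have [ig2 _] := integral_gauss c a20.
have affE (v x : R) : v * (x - c) + th = v * x + (th - v * c) by ring.
have dcx (v x : R) : is_derive x 1 (fun x : R => cos (v * (x - c) + th))
    (- v * sin (v * (x - c) + th)).
  have -> : (fun x : R => cos (v * (x - c) + th)) =
    (fun x => cos (v * x + (th - v * c))) by apply/funext => y; rewrite affE.
  rewrite affE; exact: is_derive_cos_affine.
have dsx (v x : R) : is_derive x 1 (fun x : R => sin (v * (x - c) + th))
    (v * cos (v * (x - c) + th)).
  have -> : (fun x : R => sin (v * (x - c) + th)) =
    (fun x => sin (v * x + (th - v * c))) by apply/funext => y; rewrite affE.
  rewrite affE; exact: is_derive_sin_affine.
have cf v : continuous (f v).
  move=> x; apply: cvgM; first exact: continuous_gauss.
  exact: (continuous_is_derive (dcx v)).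
have cid : continuous (fun x : R => - (x - c)).
  by move=> x; apply: cvgN; apply: cvgB; [exact: cvg_id|exact: cvg_cst].
have ch v : continuous (h v).
  move=> x; apply: cvgM.
    by apply: cvgM; [exact: cid|exact: continuous_gauss].
  exact: (continuous_is_derive (dsx v)).
have intf v : mu.-integrable setT (EFin \o f v).
  apply: integrable_continuous_dom ig _ => // x.
  by rewrite normrM ger0_norm ?expR_ge0 // ler_piMr ?expR_ge0 // ler_norml cos_geN1 cos_le1.
pose G (x : R) : R := (1 + 2 / al) * gauss (al / 2) c x.
have iG : mu.-integrable setT (EFin \o G).
  have -> : EFin \o G = (fun x => (1 + 2 / al)%:E * (EFin \o gauss (al / 2) c) x)%E by [].
  exact: integrableZl.
have hG v x : `|h v x| <= G x.
  apply: le_trans (gauss_moment_le c x a0).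
  rewrite !normrM normrN [`|gauss _ _ _|]ger0_norm ?expR_ge0 //.
  rewrite ler_piMr ?mulr_ge0 ?expR_ge0 //.
  by rewrite ler_norml sin_geN1 sin_le1.
have inth v : mu.-integrable setT (EFin \o h v).
  exact: integrable_continuous_dom iG _.
have df (v x : R) : is_derive v 1 (f^~ x) (h v x).
  have := is_derive_cos_affine (x - c) th v.
  have -> : (fun v : R => cos ((x - c) * v + th)) = (fun v => cos (v * (x - c) + th)).
    by apply/funext => y; rewrite mulrC.
  move=> dd; apply: is_derive_eq; rewrite /h /GRing.scale /= [v * _]mulrC; ring.
have p1E (v x : R) : partial1of2 f v x = h v x.
  by rewrite partial1of2E; case: (df v x).
pose Z (v : R) : R := \int[mu]_x f v x.
have dZ (v : R) : is_derive v 1 Z (\int[mu]_x h v x).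
  have vI : `]v - 1, v + 1[%classic v by rewrite /= in_itv /=; apply/andP; split; lra.
  have i1 x : `]v - 1, v + 1[%classic x -> mu.-integrable setT (EFin \o f x) by [].
  have d1 x y : `]v - 1, v + 1[%classic x -> setT y -> derivable (f ^~ y) x 1.
    by move=> _ _; case: (df x y).
  have G0 y : 0 <= G y by apply: le_trans (hG 0 y); exact: normr_ge0.
  have Gu x y : `]v - 1, v + 1[%classic x -> setT y -> `|partial1of2 f x y| <= G y.
    by move=> _ _; rewrite p1E.
  apply: DeriveDef.
    exact: (derivable_under_integral measurableT vI i1 d1 G0 iG Gu).
  rewrite -derive1E (differentiation_under_integral measurableT vI i1 d1 G0 iG Gu).
  by apply: eq_Rintegral => x _; rewrite p1E.
have parts (v : R) : \int[mu]_x h v x = - (v / (2 * al)) * Z v.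
  pose H (x : R) : R := gauss al c x * sin (v * (x - c) + th).
  pose k (x : R) : R := 2 * al * h v x + v * f v x.
  have dH (x : R) : is_derive x 1 H (k x).
    have d1 := is_derive_gauss al c x; have d2 := dsx v x.
    by apply: (is_derive_eq (is_deriveM d1 d2)); rewrite /k /h /f /GRing.scale /=; ring.
  have i1 : mu.-integrable setT (fun x => (2 * al)%:E * (EFin \o h v) x)%E.
    exact: integrableZl.
  have i2 : mu.-integrable setT (fun x => v%:E * (EFin \o f v) x)%E.
    exact: integrableZl.
  have ck : continuous k.
    move=> x; apply: cvgD; apply: cvgM; try exact: cvg_cst.
      exact: ch.
    exact: cf.
  have s1 x : `|sin (v * (x - c) + th)| <= 1 by rewrite ler_norml sin_geN1 sin_le1.
  have [Hp Hm] := gauss_trig_small c a0 s1.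
  have := Rintegral_derive_eq0 dH ck _ Hp Hm.
  have -> : EFin \o k = ((fun x => (2 * al)%:E * (EFin \o h v) x) \+
     (fun x => v%:E * (EFin \o f v) x))%E by [].
  move=> /(_ (integrableD measurableT i1 i2)).
  rewrite /k RintegralD // !RintegralZl // -/(Z v) => e.
  have : 2 * al * (\int[mu]_x h v x) = - v * Z v by lra.
  move=> e'; apply: (@mulfI _ (2 * al)); first by rewrite gt_eqF // mulr_gt0.
  by rewrite e'; field; rewrite ?gt_eqF //.
(* the quotient of [Z] by the expected solution is constant *)
pose W (v : R) : R := Z v * expR (v ^+ 2 / (4 * al)).
have dW (v : R) : is_derive v 1 W 0.
  have h1 : is_derive v 1 (fun v : R => v ^+ 2 / (4 * al)) (v / (2 * al)).
    by apply: is_derive_eq; rewrite /GRing.scale /=; field; rewrite ?gt_eqF //.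
  have h2 := is_derive1_comp (is_derive_expR _) h1.
  have h3 := dZ v; rewrite parts in h3.
  by apply: is_derive_eq; rewrite /GRing.scale /=; ring.
have := is_derive_0_is_cst w 0 dW.
rewrite /W expr0n /= mul0r expR0 mulr1.
have -> : Z 0 = cos th * Num.sqrt (pi / al).
  rewrite -gT -RintegralZl //; apply: eq_Rintegral => x _.
  by rewrite /f mul0r add0r mulrC.
move=> <-; rewrite -mulrA -expRD subrr expR0 mulr1.
by [].
Qed.

End gauss1.

(** * Gaussian integrals over tuples *)

Section tuple_integral.
Variable R : realType.
Local Notation mR := (measurableTypeR R).
Local Notation mu := (@lebesgue_measure R).
Local Notation lam := (lebesgue_tuple R).

Lemma integrable_oneDsqrV : mu.-integrable setT (fun x : R => ((1 + x ^+ 2)^-1)%:E).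
Proof.
have c : continuous (fun x : R => (1 + x ^+ 2)^-1) by exact: continuous_oneDsqrV.
have p (x : R) : 0 <= (1 + x ^+ 2)^-1 by rewrite invr_ge0 addr_ge0 // sqr_ge0.
apply/integrableP; split.
  by apply/measurable_EFinP; exact: continuous_measurable_fun.
under eq_integral do rewrite gee0_abs ?lee_fin //.
rewrite (ge0_symfun_integralT p c); last by move=> x /=; rewrite sqrrN.
rewrite -set_itvcy integral0y_oneDsqr.
by rewrite -EFinM ltry.
Qed.

Lemma measurable_integrable (g : R -> R) :
  mu.-integrable setT (EFin \o g) -> measurable_fun setT g.
Proof. by move=> ig; apply/measurable_EFinP; exact: measurable_int ig. Qed.

Section step.
Variables (n : nat) (f : n.+1.-tuple R -> R).
Hypothesis f_meas : measurable_fun [set: n.+1.-tuple mR] f.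

Lemma integrable_tupleS :
  (mu \x lam n)%E.-integrable setT ((EFin \o f) \o @cons_pair R n) ->
  (lam n.+1).-integrable setT (EFin \o f).
Proof.
move=> h; apply: (@integrable_pushforward _ _ _ _ _ _ (@measurable_cons_pair R n)) => //.
exact/measurable_EFinP.
Qed.

Lemma Rintegral_tupleS :
  (mu \x lam n)%E.-integrable setT ((EFin \o f) \o @cons_pair R n) ->
  (forall t, mu.-integrable setT (fun x => (f (cons_pair (x, t)))%:E)) ->
  \int[lam n.+1]_t f t = \int[lam n]_t \int[mu]_x f (cons_pair (x, t)).
Proof.
move=> h h1; rewrite /Rintegral.
rewrite [X in fine X](@integral_pushforward _ _ _ _ _ _ (@measurable_cons_pair R n)
  (mu \x lam n)%E setT (EFin \o f)) //; last exact/measurable_EFinP.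
rewrite preimage_setT -integral21_prod_meas1 //.
congr fine; apply: eq_integral => t _.
by rewrite /fubini_G /= fineK //; apply: integrable_fin_num.
Qed.

End step.

Lemma prod_cons_pair n (g : 'I_n.+1 -> R -> R) (u : mR * n.-tuple mR) :
  \prod_i g i (tnth (cons_pair u) i) =
  g ord0 u.1 * \prod_(i < n) g (lift ord0 i) (tnth u.2 i).
Proof.
rewrite big_ord_recl; congr (g _ _ * _).
by apply: eq_bigr => i _; rewrite tnthS.
Qed.

Lemma measurable_prod_tuple n (g : 'I_n -> R -> R) :
  (forall i, measurable_fun setT (g i)) ->
  measurable_fun [set: n.-tuple mR] (fun t => \prod_i g i (tnth t i)).
Proof.
move=> mg; apply: measurable_prod => i _.
exact: (measurableT_comp (mg i) (measurable_tnth i)).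
Qed.

Let integrable_prod_step n (g : 'I_n.+1 -> R -> R) :
  (forall i x, 0 <= g i x) -> (forall i, mu.-integrable setT (EFin \o g i)) ->
  (lam n).-integrable setT (fun t => (\prod_i g (lift ord0 i) (tnth t i))%:E) ->
  (mu \x lam n)%E.-integrable setT
    ((EFin \o (fun t => \prod_i g i (tnth t i))) \o @cons_pair R n).
Proof.
move=> g0 ig ih.
have mg i : measurable_fun setT (g i) := measurable_integrable (ig i).
have mp := measurable_prod_tuple mg.
have mp2 : measurable_fun [set: mR * n.-tuple mR]
    (EFin \o (fun t => \prod_i g i (tnth t i)) \o @cons_pair R n).
  by apply: measurableT_comp; [exact/measurable_EFinP|exact: measurable_cons_pair].
apply/integrableP; split => //.
have p0 (u : mR * n.-tuple mR) : 0 <= \prod_i g i (tnth (cons_pair u) i).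
  by apply: prodr_ge0.
under eq_integral do rewrite /= ger0_norm //.
rewrite fubini_tonelli2 //.
have cE : (\int[mu]_x (g ord0 x)%:E = (\int[mu]_x g ord0 x)%:E)%E.
  by rewrite /Rintegral fineK //; apply: integrable_fin_num (ig ord0).
under eq_integral => t _.
  rewrite /fubini_G.
  under eq_integral do rewrite prod_cons_pair /= EFinM.
  rewrite integralZr //; last exact: ig.
  rewrite cE; over.
rewrite /= integralZl //.
rewrite lte_mul_pinfty ?lee_fin //.
- by apply: Rintegral_ge0.
- exact: integrable_lty.
Qed.

Lemma integrable_prod_tuple n (g : 'I_n -> R -> R) :
  (forall i x, 0 <= g i x) -> (forall i, mu.-integrable setT (EFin \o g i)) ->
  (lam n).-integrable setT (fun t => (\prod_i g i (tnth t i))%:E).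
Proof.
elim: n g => [|n ih] g g0 ig.
  rewrite (_ : (fun _ => _) = cst 1%E); last by apply/funext => t; rewrite big_ord0.
  apply/integrableP; split => //.
  by rewrite integral_cst //= diracT mule1 normr1 ltry.
apply: (@integrable_tupleS n (fun t => \prod_i g i (tnth t i))).
  apply: measurable_prod_tuple => i.
  exact: measurable_integrable (ig i).
apply: integrable_prod_step => //.
exact: (ih (fun i => g (lift ord0 i)) (fun i => g0 _) (fun i => ig _)).
Qed.

Lemma integrable_prod_cons_pair n (g : 'I_n.+1 -> R -> R) :
  (forall i x, 0 <= g i x) -> (forall i, mu.-integrable setT (EFin \o g i)) ->
  (mu \x lam n)%E.-integrable setT
    ((EFin \o (fun t => \prod_i g i (tnth t i))) \o @cons_pair R n).
Proof.
move=> g0 ig; apply: integrable_prod_step => //.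
exact: (@integrable_prod_tuple n (fun i => g (lift ord0 i)) (fun i => g0 _) (fun i => ig _)).
Qed.

(** Only the phase of the first coordinate is integrated at each step; the
    other coordinates act as a constant phase. *)
Lemma Rintegral_gauss_tuple n (al th : R) (c w : 'I_n -> R) : 0 < al ->
  \int[lam n]_t ((\prod_i gauss al (c i) (tnth t i)) *
     cos (\sum_i w i * (tnth t i - c i) + th)) =
  cos th * Num.sqrt (pi / al) ^+ n * expR (- ((\sum_i w i ^+ 2) / (4 * al))).
Proof.
move=> al0; elim: n th c w => [|n ih] th c w.
  under eq_Rintegral do rewrite big_ord0 big_ord0 add0r mul1r.
  rewrite Rintegral_cst // [X in fine X](_ : _ = 1%E); last exact: diracT.
  rewrite mulr1 big_ord0 mul0r oppr0 expR0.
  by rewrite !mulr1.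
have ig i : mu.-integrable setT (EFin \o gauss al (c i)) by have [] := integral_gauss (c i) al0.
have mphase : measurable_fun [set: n.+1.-tuple mR]
    (fun t => \sum_i w i * (tnth t i - c i) + th).
  apply: measurable_funD => //; apply: measurable_sum => i.
  have mi : measurable_fun [set: n.+1.-tuple mR] (fun t => tnth t i : mR).
    exact: measurable_tnth.
  by apply: measurable_funM => //; exact: measurable_funB.
have mprod : measurable_fun [set: n.+1.-tuple mR]
    (fun t => \prod_i gauss al (c i) (tnth t i)).
  apply: (measurable_prod_tuple (g := fun i => gauss al (c i))) => i.
  exact: measurable_integrable (ig i).
have mcos : measurable_fun setT (@cos R).
  by apply: continuous_measurable_fun; exact: continuous_cos.
have mf : measurable_fun [set: n.+1.-tuple mR]
    (fun t => (\prod_i gauss al (c i) (tnth t i)) *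
      cos (\sum_i w i * (tnth t i - c i) + th)).
  by apply: measurable_funM => //; exact: measurableT_comp.
have g0 i x : 0 <= gauss al (c i) x by exact: expR_ge0.
rewrite Rintegral_tupleS //; first last.
- move=> t.
  have i1 : mu.-integrable setT (fun x : R =>
      ((\prod_(i < n) gauss al (c (lift ord0 i)) (tnth t i))%:E *
       (EFin \o gauss al (c ord0)) x)%E) by exact: integrableZl.
  apply: (le_integrable measurableT _ _ i1).
  + apply/measurable_EFinP; apply: (measurableT_comp mf).
    exact: (@measurable_cons _ _ mR mR id n (fun=> t)).
  + move=> x _ /=; rewrite lee_fin (prod_cons_pair (fun i => gauss al (c i))) !normrM mulrAC [leRHS]mulrC mulrAC.
    rewrite ler_piMr ?mulr_ge0 ?normr_ge0 //.
    by rewrite ler_norml cos_geN1 cos_le1.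
- apply: le_integrable (integrable_prod_cons_pair g0 ig) => //.
    apply: measurableT_comp; last exact: measurable_cons_pair.
    exact/measurable_EFinP.
  move=> u _ /=; rewrite lee_fin normrM ler_piMr ?normr_ge0 //.
  by rewrite ler_norml cos_geN1 cos_le1.
pose P (t : n.-tuple mR) := \prod_(i < n) gauss al (c (lift ord0 i)) (tnth t i).
pose S (t : n.-tuple mR) := \sum_(i < n) w (lift ord0 i) * (tnth t i - c (lift ord0 i)) + th.
pose K := Num.sqrt (pi / al) * expR (- (w ord0 ^+ 2 / (4 * al))).
have fE x t : (\prod_i gauss al (c i) (tnth (cons_pair (x, t)) i)) *
      cos (\sum_i w i * (tnth (cons_pair (x, t)) i - c i) + th) =
    P t * (gauss al (c ord0) x * cos (w ord0 * (x - c ord0) + S t)).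
  rewrite (prod_cons_pair (fun i => gauss al (c i))) /= big_ord_recl -addrA.
  rewrite (_ : \sum_i _ + th = S t); first by rewrite mulrAC mulrC.
  by congr (_ + _); apply: eq_bigr => i _; rewrite tnthS.
have icos (a : R) : mu.-integrable setT
    (EFin \o (fun x : R => gauss al (c ord0) x * cos (w ord0 * (x - c ord0) + a))).
  apply: integrable_continuous_dom (ig ord0) _ => x.
    apply: cvgM; first exact: continuous_gauss.
    apply: continuous_comp; last exact: continuous_cos.
    apply: cvgD; last exact: cvg_cst.
    apply: cvgM; first exact: cvg_cst.
    by apply: cvgB; [exact: cvg_id|exact: cvg_cst].
  rewrite normrM ger0_norm ?expR_ge0 // ler_piMr ?expR_ge0 //.
  by rewrite ler_norml cos_geN1 cos_le1.
transitivity (\int[lam n]_t (K * (P t * cos (S t)))).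
  apply: eq_Rintegral => t _.
  under eq_Rintegral do rewrite fE.
  rewrite RintegralZl // integral_gauss_cos // /K; ring.
rewrite RintegralZl //; last first.
  apply: (le_integrable measurableT _ _
    (@integrable_prod_tuple n (fun i => gauss al (c (lift ord0 i))) (fun i => g0 _) (fun i => ig _))).
    apply/measurable_EFinP; apply: measurable_funM.
      apply: (measurable_prod_tuple (g := fun i => gauss al (c (lift ord0 i)))) => i.
      exact: measurable_integrable (ig _).
    apply: measurableT_comp => //.
    apply: measurable_funD => //; apply: measurable_sum => i.
    have mi : measurable_fun [set: n.-tuple mR] (fun t => tnth t i : mR).
      exact: measurable_tnth.
    by apply: measurable_funM => //; exact: measurable_funB.
  move=> t _ /=; rewrite lee_fin normrM ler_piMr ?normr_ge0 //.
  by rewrite ler_norml cos_geN1 cos_le1.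
rewrite ih /K big_ord_recl [_ ^+ n.+1]exprS (mulrDl (w ord0 ^+ 2)) opprD expRD; ring.
Qed.

End tuple_integral.

(** * The Fourier transform of rapidly decreasing functions *)

Section euclidean_measurability.
Variables (R : realType) (d : nat).
Local Notation mR := (measurableTypeR R).

Lemma rational_box (O : set 'rV[R]_d) (x : 'rV[R]_d) : nbhs x O ->
  exists b : {ffun 'I_d -> rat * rat},
    (forall i, ratr (b i).1 < x 0 i < ratr (b i).2) /\
    forall y : 'rV[R]_d, (forall i, ratr (b i).1 < y 0 i < ratr (b i).2) -> O y.
Proof.
case/nbhs_ballP => e /= e0 xeO.
have /choice[l Hl] (i : 'I_d) : exists q : rat, x 0 i - e < ratr q < x 0 i.
  have [|q] := @rat_in_itvoo _ (x 0 i - e) (x 0 i); first lra.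
  by rewrite in_itv /=; exists q.
have /choice[r Hr] (i : 'I_d) : exists q : rat, x 0 i < ratr q < x 0 i + e.
  have [|q] := @rat_in_itvoo _ (x 0 i) (x 0 i + e); first lra.
  by rewrite in_itv /=; exists q.
exists [ffun i => (l i, r i)]; split=> [i|y yb].
  by rewrite ffunE /=; have /andP[_ ->] := Hl i; have /andP[-> _] := Hr i.
apply: xeO; split=> // i j; rewrite ord1 /ball /= ltr_norml.
have := yb j; rewrite ffunE /= => /andP[y1 y2].
have /andP[? ?] := Hl j; have /andP[? ?] := Hr j.
by apply/andP; split; lra.
Qed.

(** Continuity refers to the topology of row vectors and measurability to the
    product sigma-algebra of tuples; the two are compatible because an open set
    is a countable union of boxes with rational corners. *)
Lemma measurable_open_row (O : set 'rV[R]_d) : open O ->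
  measurable ((fun t : d.-tuple mR => row_of_tuple t) @^-1` O).
Proof.
move=> oO.
pose box (b : {ffun 'I_d -> rat * rat}) : set (d.-tuple mR) :=
  \bigcap_(i in [set: 'I_d]) ((fun t : d.-tuple mR => tnth t i : mR) @^-1`
    `](ratr (b i).1 : R), ratr (b i).2[).
pose F b := [set t | box b t /\
  forall y : 'rV[R]_d, (forall i, ratr (b i).1 < y 0 i < ratr (b i).2) -> O y].
rewrite (_ : _ @^-1` O = \bigcup_b F b).
  apply: countable_bigcupT_measurable; first exact: countableP.
  move=> b; rewrite /F.
  have [h|h] := pselect (forall y : 'rV[R]_d,
      (forall i, ratr (b i).1 < y 0 i < ratr (b i).2) -> O y); last first.
    by rewrite (_ : [set t | _] = set0) //; apply/seteqP; split=> t // [].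
  rewrite (_ : [set t | _] = box b); last first.
    apply/seteqP; split=> t /=; first by case.
    by move=> bt; split.
  apply: fin_bigcap_measurable => [|i _]; first exact: finite_finset.
  rewrite -[X in measurable X]setTI; apply: measurable_tnth => //.
apply/seteqP; split=> [t /= Ot|t [b _ [bt]]].
  have [b [xb bO]] := rational_box (open_nbhs_nbhs (conj oO Ot)).
  exists b => //; split=> // i _ /=.
  by have := xb i; rewrite mxE in_itv.
by apply=> i; rewrite mxE; have := bt i Logic.I; rewrite /= in_itv.
Qed.

Lemma measurable_continuous_row (f : 'rV[R]_d -> R) : continuous f ->
  measurable_fun [set: d.-tuple mR] (fun t => f (row_of_tuple t)).
Proof.
move=> /continuousP cf.
apply: (measurability (RGenOInfty.G (R:=R))); first exact: RGenOInfty.measurableE.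
move=> _ [_ [x ->] <-]; rewrite setTI.
apply: (@measurable_open_row (f @^-1` `]x, +oo[)).
by apply: cf; exact: interval_open.
Qed.

End euclidean_measurability.

Section integration.
Variables (R : realType) (d : nat).
Local Notation mR := (measurableTypeR R).
Local Notation lam := (lebesgue_tuple R d).
Implicit Types (f g : 'rV[R]_d -> R) (M : R).

(** A product of one-variable weights, hence integrable by iteration; being
    larger than a negative power of the bracket, it dominates every Schwartz
    function. *)
Definition decay_weight (x : 'rV[R]_d) : R := \prod_i (1 + x 0 i ^+ 2)^-1.

Lemma decay_weight_ge0 x : 0 <= decay_weight x.
Proof. by apply: prodr_ge0 => i _; rewrite invr_ge0 addr_ge0 // sqr_ge0. Qed.

Lemma integrable_decay_weight :
  lam.-integrable setT (EFin \o (fun t => decay_weight (row_of_tuple t))).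
Proof.
have := @integrable_prod_tuple R d (fun _ x => (1 + x ^+ 2)^-1).
rewrite (_ : EFin \o _ = fun t : d.-tuple mR =>
    (\prod_i (1 + tnth t i ^+ 2)^-1)%:E); last first.
  by apply/funext => t /=; congr EFin; apply: eq_bigr => i _; rewrite mxE.
apply=> [_ x|_]; first by rewrite invr_ge0 addr_ge0 // sqr_ge0.
exact: integrable_oneDsqrV.
Qed.

Definition decay_mass : R := integral_Rd decay_weight.

Definition decaying f := continuous f /\ exists M, forall x, `|f x| <= M * decay_weight x.

Lemma integrable_decaying f : decaying f ->
  lam.-integrable setT (EFin \o (fun t => f (row_of_tuple t))).
Proof.
move=> [cf [M fM]].
apply: (le_integrable measurableT _ _ (integrableZl measurableT M integrable_decay_weight)).
  by apply/measurable_EFinP; exact: measurable_continuous_row.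
by move=> t _ /=; rewrite lee_fin (le_trans (fM _)) // ler_norm.
Qed.

Lemma integral_RdD f g : decaying f -> decaying g ->
  integral_Rd (fun x => f x + g x) = integral_Rd f + integral_Rd g.
Proof. by move=> df dg; rewrite /integral_Rd RintegralD //; exact: integrable_decaying. Qed.

Lemma integral_RdZ f c : decaying f ->
  integral_Rd (fun x => c * f x) = c * integral_Rd f.
Proof. by move=> df; rewrite /integral_Rd RintegralZl //; exact: integrable_decaying. Qed.

Lemma norm_integral_Rd_le f M : continuous f ->
  (forall x, `|f x| <= M * decay_weight x) -> `|integral_Rd f| <= M * decay_mass.
Proof.
move=> cf fM; have df : decaying f by split=> //; exists M.
rewrite (le_trans (le_normr_Rintegral _ (integrable_decaying df))) //.
rewrite /decay_mass /integral_Rd -RintegralZl //; last exact: integrable_decay_weight.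
apply: le_Rintegral => //.
- exact: integrable_abse (integrable_decaying df).
- exact: integrableZl integrable_decay_weight.
Qed.

Lemma decayingD f g : decaying f -> decaying g -> decaying (fun x => f x + g x).
Proof.
move=> [cf [M fM]] [cg [N gN]]; split.
  by move=> x; exact: (cvgD (cf x) (cg x)).
exists (M + N) => x; rewrite mulrDl.
exact: le_trans (ler_normD _ _) (lerD _ _).
Qed.

Lemma decayingM f (u : 'rV[R]_d -> R) M : decaying f -> continuous u -> (forall x, `|u x| <= M) ->
  decaying (fun x => u x * f x).
Proof.
move=> [cf [N fN]] cu uM; split.
  by move=> x; exact: (cvgM (cu x) (cf x)).
by exists (M * N) => x; rewrite normrM -mulrA ler_pM.
Qed.

Lemma decayingZ f c : decaying f -> decaying (fun x => c * f x).
Proof.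
move=> df; apply: (decayingM (u := fun=> c) (M := `|c|) df); last by [].
exact: cst_continuous.
Qed.

Lemma continuous_coord i : continuous (fun x : 'rV[R]_d => x 0 i).
Proof. exact: coord_continuous. Qed.

Lemma continuous_sumr (T : topologicalType) (I : Type) (r : seq I) (F : I -> T -> R) :
  (forall i, continuous (F i)) -> continuous (fun x => \sum_(i <- r) F i x).
Proof.
move=> cF; elim: r => [|i r ih].
  rewrite (_ : (fun _ => _) = cst 0); last by apply/funext => x; rewrite big_nil.
  exact: cst_continuous.
rewrite (_ : (fun _ => _) = fun x => F i x + \sum_(j <- r) F j x); last first.
  by apply/funext => x; rewrite big_cons.
by move=> x; exact: (cvgD (cF i x) (ih x)).
Qed.

Lemma continuous_dotp (xi : 'rV[R]_d) : continuous (fun x => dotp x xi).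
Proof.
apply: continuous_sumr => i x.
exact: (cvgM (@continuous_coord i x) (cvg_cst (xi 0 i))).
Qed.

End integration.

Section fourier_transform.
Variables (R : realType) (d : nat).
Local Open Scope complex_scope.
Implicit Types (f g : 'rV[R]_d -> R[i]) (h : 'rV[R]_d -> R) (M : R).

Lemma normc_le_ReIm (z : R[i]) :
  Normc.normc z <= `|complex.Re z| + `|complex.Im z|.
Proof.
case: z => a b /=; rewrite -(@ler_pXn2r _ 2) ?nnegrE ?sqrtr_ge0 ?addr_ge0 //.
rewrite sqr_sqrtr ?addr_ge0 ?sqr_ge0 // sqrrD !real_normK ?num_real //.
by rewrite lerD2r lerDl mulrn_wge0 // mulr_ge0.
Qed.

Lemma normc_ge0 (z : R[i]) : 0 <= Normc.normc z.
Proof. by case: z => a b; exact: sqrtr_ge0. Qed.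

Lemma Re_le_normc (z : R[i]) : `|complex.Re z| <= Normc.normc z.
Proof.
by case: z => a b /=; rewrite -sqrtr_sqr ler_sqrt ?lerDl ?addr_ge0 ?sqr_ge0.
Qed.

Lemma Im_le_normc (z : R[i]) : `|complex.Im z| <= Normc.normc z.
Proof.
by case: z => a b /=; rewrite -sqrtr_sqr ler_sqrt ?lerDr ?addr_ge0 ?sqr_ge0.
Qed.

Lemma normc_cis (t : R) : Normc.normc (cis t) = 1.
Proof. by rewrite /= cos2Dsin2 sqrtr1. Qed.

Definition phase (xi x : 'rV[R]_d) : R := - (2 * pi * dotp x xi).

Lemma continuous_phase (xi : 'rV[R]_d) : continuous (phase xi).
Proof.
exact: (fun x => cvgN (cvgM (cvg_cst (2 * pi)) (@continuous_dotp R d xi x))).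
Qed.

Definition cosint h xi : R := integral_Rd (fun x => cos (phase xi x) * h x).
Definition sinint h xi : R := integral_Rd (fun x => sin (phase xi x) * h x).

Definition decayingC f :=
  decaying (fun x => complex.Re (f x)) /\ decaying (fun x => complex.Im (f x)).

Lemma decaying_cos h xi : decaying h -> decaying (fun x => cos (phase xi x) * h x).
Proof.
move=> dh; apply: (decayingM (u := fun x => cos (phase xi x)) (M := 1) dh).
  by move=> x; apply: continuous_comp; [exact: continuous_phase|exact: continuous_cos].
by move=> x; rewrite ler_norml cos_geN1 cos_le1.
Qed.

Lemma decaying_sin h xi : decaying h -> decaying (fun x => sin (phase xi x) * h x).
Proof.
move=> dh; apply: (decayingM (u := fun x => sin (phase xi x)) (M := 1) dh).
  by move=> x; apply: continuous_comp; [exact: continuous_phase|exact: continuous_sin].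
by move=> x; rewrite ler_norml sin_geN1 sin_le1.
Qed.

Lemma fourierE f xi : decayingC f -> fourier f xi =
  (cosint (fun x => complex.Re (f x)) xi - sinint (fun x => complex.Im (f x)) xi) +i*
  (sinint (fun x => complex.Re (f x)) xi + cosint (fun x => complex.Im (f x)) xi).
Proof.
move=> [dr di]; rewrite /fourier /integral_RdC /cosint /sinint.
congr (_ +i* _).
  have -> : - integral_Rd (fun x => sin (phase xi x) * complex.Im (f x)) =
      integral_Rd (fun x => -1 * (sin (phase xi x) * complex.Im (f x))).
    by rewrite integral_RdZ ?mulN1r //; exact: decaying_sin.
  rewrite -integral_RdD; [|exact: decaying_cos|exact/decayingZ/decaying_sin].
  congr integral_Rd; apply/funext => x; rewrite /cis -/(phase xi x).
  by case: (f x) => a b /=; ring.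
rewrite -integral_RdD; [|exact: decaying_sin|exact: decaying_cos].
congr integral_Rd; apply/funext => x; rewrite /cis -/(phase xi x).
by case: (f x) => a b /=; ring.
Qed.

Lemma cosintD h1 h2 xi : decaying h1 -> decaying h2 ->
  cosint (fun x => h1 x + h2 x) xi = cosint h1 xi + cosint h2 xi.
Proof.
move=> d1 d2; rewrite /cosint -integral_RdD; [|exact: decaying_cos..].
by congr integral_Rd; apply/funext => x; rewrite mulrDr.
Qed.

Lemma sinintD h1 h2 xi : decaying h1 -> decaying h2 ->
  sinint (fun x => h1 x + h2 x) xi = sinint h1 xi + sinint h2 xi.
Proof.
move=> d1 d2; rewrite /sinint -integral_RdD; [|exact: decaying_sin..].
by congr integral_Rd; apply/funext => x; rewrite mulrDr.
Qed.

Lemma cosintZ h c xi : decaying h -> cosint (fun x => c * h x) xi = c * cosint h xi.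
Proof.
move=> dh; rewrite /cosint -integral_RdZ; last exact: decaying_cos.
by congr integral_Rd; apply/funext => x; rewrite mulrCA.
Qed.

Lemma sinintZ h c xi : decaying h -> sinint (fun x => c * h x) xi = c * sinint h xi.
Proof.
move=> dh; rewrite /sinint -integral_RdZ; last exact: decaying_sin.
by congr integral_Rd; apply/funext => x; rewrite mulrCA.
Qed.

Lemma decayingCD f g : decayingC f -> decayingC g -> decayingC (fun x => f x + g x).
Proof.
move=> [fr fi] [gr gi]; split.
  have := decayingD fr gr; congr decaying; apply/funext => x.
  by case: (f x) (g x) => a b [a' b'].
have := decayingD fi gi; congr decaying; apply/funext => x.
by case: (f x) (g x) => a b [a' b'].
Qed.

Lemma ReZ f c : (fun x => complex.Re (c * f x)) =
  (fun x => complex.Re c * complex.Re (f x) + (- complex.Im c) * complex.Im (f x)).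
Proof. by apply/funext => x; case: c (f x) => a b [a' b'] /=; rewrite mulNr. Qed.

Lemma ImZ f c : (fun x => complex.Im (c * f x)) =
  (fun x => complex.Re c * complex.Im (f x) + complex.Im c * complex.Re (f x)).
Proof. by apply/funext => x; case: c (f x) => a b [a' b'] /=. Qed.

Lemma decayingCZ f c : decayingC f -> decayingC (fun x => c * f x).
Proof.
by move=> [fr fi]; split; rewrite ?ReZ ?ImZ; apply: decayingD; exact: decayingZ.
Qed.

Lemma fourierD f g xi : decayingC f -> decayingC g ->
  fourier (fun x => f x + g x) xi = fourier f xi + fourier g xi.
Proof.
move=> df dg; rewrite !fourierE //; last exact: decayingCD.
case: df dg => [fr fi] [gr gi].
rewrite (_ : (fun x => complex.Re (f x + g x)) =
  fun x => complex.Re (f x) + complex.Re (g x)); last first.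
  by apply/funext => x; case: (f x) (g x) => a b [a' b'].
rewrite (_ : (fun x => complex.Im (f x + g x)) =
  fun x => complex.Im (f x) + complex.Im (g x)); last first.
  by apply/funext => x; case: (f x) (g x) => a b [a' b'].
by rewrite !cosintD // !sinintD //; simpc; congr (_ +i* _); ring.
Qed.

Lemma fourierZ f c xi : decayingC f ->
  fourier (fun x => c * f x) xi = c * fourier f xi.
Proof.
move=> df; rewrite !fourierE //; last exact: decayingCZ.
case: df => [fr fi]; rewrite ReZ ImZ.
rewrite !cosintD ?sinintD ?cosintZ ?sinintZ //; try exact: decayingZ.
by case: c => a b /=; simpc; congr (_ +i* _); ring.
Qed.

(** The transform is continuous for the weighted sup norm, which is what allows
    it to be exchanged with infinite sums. *)
Lemma normc_fourier_le f M xi : decayingC f ->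
  (forall x, Normc.normc (f x) <= M * decay_weight x) ->
  Normc.normc (fourier f xi) <= 4 * (M * decay_mass R d).
Proof.
move=> df fM; rewrite fourierE //; apply: le_trans (normc_le_ReIm _) _ => /=.
case: df => [[cr _] [ci _]].
have rM x : `|complex.Re (f x)| <= M * decay_weight x.
  exact: le_trans (Re_le_normc _) (fM x).
have iM x : `|complex.Im (f x)| <= M * decay_weight x.
  exact: le_trans (Im_le_normc _) (fM x).
have cE h : continuous h -> (forall x, `|h x| <= M * decay_weight x) ->
    `|cosint h xi| <= M * decay_mass R d.
  move=> ch hM; apply: norm_integral_Rd_le => x.
    apply: (cvgM _ (ch x)); apply: continuous_comp; last exact: continuous_cos.
    exact: continuous_phase.
  rewrite normrM; apply: le_trans (hM x).
  by rewrite ler_piMl // ler_norml cos_geN1 cos_le1.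
have sE h : continuous h -> (forall x, `|h x| <= M * decay_weight x) ->
    `|sinint h xi| <= M * decay_mass R d.
  move=> ch hM; apply: norm_integral_Rd_le => x.
    apply: (cvgM _ (ch x)); apply: continuous_comp; last exact: continuous_sin.
    exact: continuous_phase.
  rewrite normrM; apply: le_trans (hM x).
  by rewrite ler_piMl // ler_norml sin_geN1 sin_le1.
have := cE _ cr rM; have := cE _ ci iM; have := sE _ cr rM; have := sE _ ci iM.
move=> h1 h2 h3 h4.
have := ler_normB (cosint (fun x => complex.Re (f x)) xi) (sinint (fun x => complex.Im (f x)) xi).
have := ler_normD (sinint (fun x => complex.Re (f x)) xi) (cosint (fun x => complex.Im (f x)) xi).
lra.
Qed.

(** A Gaussian centred at [c], modulated by the frequency [om]. *)
Definition wave (al : R) (c om : 'rV[R]_d) (x : 'rV[R]_d) : R[i] :=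
  (\prod_i gauss al (c 0 i) (x 0 i))%:C * cis (2 * pi * dotp x om).

(** The imaginary part is the real part with the phase shifted by a quarter
    turn, so that the cosine integral with an arbitrary phase gives both. *)
Lemma fourier_wave al c om xi : 0 < al ->
  fourier (wave al c om) xi =
  (Num.sqrt (pi / al) ^+ d * expR (- (pi ^+ 2 * dotp (om - xi) (om - xi) / al)))%:C *
  cis (2 * pi * dotp c (om - xi)).
Proof.
move=> al0; pose w i := 2 * pi * (om - xi) 0 i.
have wE (x : 'rV[R]_d) : 2 * pi * dotp x om - 2 * pi * dotp x xi =
    \sum_i w i * (x 0 i - c 0 i) + 2 * pi * dotp c (om - xi).
  rewrite -mulrBr /dotp -sumrB mulr_sumr [in RHS]mulr_sumr -big_split /=.
  by apply: eq_bigr => i _; rewrite /w !mxE; ring.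
have w2 : (\sum_i w i ^+ 2) / (4 * al) = pi ^+ 2 * dotp (om - xi) (om - xi) / al.
  rewrite /dotp mulr_sumr !mulr_suml; apply: eq_bigr => i _.
  by rewrite /w; field; rewrite gt_eqF.
have E th : integral_Rd (fun x : 'rV[R]_d => \prod_i gauss al (c 0 i) (x 0 i) *
      cos (\sum_i w i * (x 0 i - c 0 i) + th)) =
    cos th * (Num.sqrt (pi / al) ^+ d * expR (- (pi ^+ 2 * dotp (om - xi) (om - xi) / al))).
  rewrite mulrA -w2 -(Rintegral_gauss_tuple _ (fun i => c 0 i)) // /integral_Rd.
  apply: eq_Rintegral => t _; congr (_ * cos (_ + _)).
    by apply: eq_bigr => i _; rewrite mxE.
  by apply: eq_bigr => i _; rewrite mxE.
rewrite /fourier /integral_RdC [RHS]mulrC /cis; simpc.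
congr (_ +i* _).
  rewrite -E; congr integral_Rd; apply/funext => x.
  by rewrite /wave /cis; simpc => /=; rewrite -wE cosD; ring.
have sc (t : R) : sin t = cos (t - pi / 2) by rewrite -cosBpihalf.
rewrite sc -E; congr integral_Rd; apply/funext => x.
by rewrite /wave /cis; simpc => /=; rewrite addrA -wE -sc sinD; ring.
Qed.

End fourier_transform.

(** * Term by term differentiation of series *)

Section termwise.
Variable R : realType.

Lemma normr_lim_le (u : nat -> R) (l B : R) :
  u n @[n --> \oo] --> l -> (forall n, `|u n| <= B) -> `|l| <= B.
Proof.
move=> ul uB; have nl : `|u n| @[n --> \oo] --> `|l| by exact: cvg_norm.
rewrite -(cvg_lim _ nl) //; apply: limr_le; first by apply/cvg_ex; exists `|l|.
exact: nearW.
Qed.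

Lemma cvg_series_dom (u b : nat -> R) (B : R) :
  (forall n, `|u n| <= b n) -> (forall N, series b N <= B) ->
  series u N @[N --> \oo] --> limn (series u).
Proof.
move=> ub bB; suff : cvgn (series u) by [].
apply: (@normed_cvg R R^o); apply: (@series_le_cvg R _ b) => //.
- by move=> n; exact: normr_ge0.
- by move=> n; exact: le_trans (normr_ge0 _) (ub n).
apply: nondecreasing_is_cvgn.
  by apply: nondecreasing_series => n _ _; exact: le_trans (normr_ge0 _) (ub n).
by exists B => _ [N _ <-].
Qed.

Lemma cvg_sumr (I : Type) (r : seq I) (u : I -> nat -> R) (l : I -> R) :
  (forall i, u i n @[n --> \oo] --> l i) ->
  \sum_(i <- r) u i n @[n --> \oo] --> \sum_(i <- r) l i.
Proof.
move=> ul; elim: r => [|i r ih].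
  rewrite big_nil (_ : (fun _ => _) = cst 0); first exact: cvg_cst.
  by apply/funext => n; rewrite big_nil.
rewrite big_cons (_ : (fun _ => _) = fun n => u i n + \sum_(j <- r) u j n).
  exact: cvgD (ul i) ih.
by apply/funext => n; rewrite big_cons.
Qed.

Variable d : nat.
Local Notation V := 'rV[R]_d.
Implicit Types (f g : V -> R) (x v : V).

Local Notation e_ i := (delta_mx 0 i : V).

Lemma row_coord_le v i : `|v 0 i| <= `|v|.
Proof.
rewrite [leRHS]mx_normrE /=; apply: (le_trans _ (le_bigmax_cond _ _ (j := (0, i)) _)) => //.
Qed.

Lemma derive_row f x v : differentiable f x ->
  'D_v f x = \sum_i v 0 i * 'D_(e_ i) f x.
Proof.
move=> df; rewrite deriveE // {1}[v]row_sum_delta linear_sum.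
by apply: eq_bigr => i _; rewrite linearZ deriveE.
Qed.

Lemma is_derive_line f x v (t : R) : (forall y, differentiable f y) ->
  is_derive t 1 (fun t : R => f (x + t *: v))
    (\sum_i v 0 i * 'D_(e_ i) f (x + t *: v)).
Proof.
move=> df.
have dl : is_diff t (fun t : R => x + t *: v) ( *:%R^~ v).
  by apply: is_diff_eq; rewrite add0r.
have dfl : differentiable (f \o (fun t : R => x + t *: v)) t.
  apply: differentiable_comp => //.
split.
  exact/derivable1_diffP.
rewrite deriveE // diff_comp //= diff_val /= scale1r -deriveE //.
exact: derive_row.
Qed.

Lemma line_increment_le f x v (M : R) : (forall y, differentiable f y) ->
  (forall i y, `|'D_(e_ i) f y| <= M) ->
  `|f (x + v) - f x| <= d%:R * M * `|v|.
Proof.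
move=> df fM.
have [||t _] := @MVT_segment R (fun t : R => f (x + t *: v))
  (fun t => \sum_i v 0 i * 'D_(e_ i) f (x + t *: v)) 0 1 ler01.
- by move=> t _; exact: is_derive_line.
- apply: continuous_subspaceT => t.
  by apply/differentiable_continuous/derivable1_diffP; case: (is_derive_line x v t df).
rewrite scale1r scale0r addr0 subr0 mulr1 => ->.
apply: le_trans (ler_norm_sum _ _ _) _.
apply: (@le_trans _ _ (\sum_(i < d) (M * `|v|))).
  apply: ler_sum => i _; rewrite normrM mulrC ler_pM ?row_coord_le //.
by rewrite sumr_const card_ord -mulrA mulr_natl.
Qed.

Lemma taylor2 f x v (M : R) : (forall y, differentiable f y) ->
  (forall i y, differentiable (partial i f) y) ->
  (forall i j y, `|partial j (partial i f) y| <= M) ->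
  `|f (x + v) - f x - \sum_i v 0 i * partial i f x| <= d%:R ^+ 2 * M * `|v| ^+ 2.
Proof.
move=> df ddf fM.
have [||t t01] := @MVT_segment R (fun t : R => f (x + t *: v))
  (fun t => \sum_i v 0 i * 'D_(e_ i) f (x + t *: v)) 0 1 ler01.
- by move=> t _; exact: is_derive_line.
- apply: continuous_subspaceT => t.
  by apply/differentiable_continuous/derivable1_diffP; case: (is_derive_line x v t df).
rewrite scale1r scale0r addr0 subr0 mulr1 => ->.
rewrite -sumrB; apply: le_trans (ler_norm_sum _ _ _) _.
apply: (@le_trans _ _ (\sum_(i < d) (d%:R * M * `|v| ^+ 2))); last first.
  by rewrite sumr_const card_ord -[leLHS]mulr_natl !mulrA -expr2.
have M0 (i : 'I_d) : 0 <= M by apply: le_trans (fM i i 0).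
apply: ler_sum => i _; rewrite -mulrBr normrM.
have -> : d%:R * M * `|v| ^+ 2 = `|v| * (d%:R * M * `|v|) by ring.
apply: ler_pM => //; first exact: row_coord_le.
apply: le_trans (line_increment_le x (t *: v) (ddf i) (fM i)) _.
rewrite ler_wpM2l ?mulr_ge0 ?(M0 i) // normrZ ler_piMl //.
by move: t01; rewrite in_itv /= ler_norml => /andP[t0 ->]; rewrite (le_trans _ t0) // lerN10.
Qed.

Section row_form.
Variable c : 'I_d -> R.
Definition row_form v : R := \sum_i v 0 i * c i.
Lemma row_form_is_linear : linear row_form.
Proof.
move=> k u v; rewrite /row_form scaler_sumr -big_split /=.
by apply: eq_bigr => i _; rewrite !mxE mulrDl -scalerAl.
Qed.
HB.instance Definition _ := GRing.isLinear.Build _ _ _ _ row_form row_form_is_linear.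
End row_form.

Lemma continuous_row_form c : continuous (row_form c).
Proof.
apply: continuous_sumr => i x.
exact: (cvgM (@continuous_coord R d i x) (cvg_cst (c i))).
Qed.

Lemma differentiable_of_taylor f x (c : 'I_d -> R) (C : R) :
  (forall v, `|f (x + v) - f x - \sum_i v 0 i * c i| <= C * `|v| ^+ 2) ->
  differentiable f x /\ forall i, 'D_(e_ i) f x = c i.
Proof.
move=> fC.
have fo : (f \o shift x : V -> R^o) = (cst (f x) : V -> R^o) + (row_form c : V -> R^o) +o_ (0 : V) id.
  apply/eqaddoP => _/posnumP[e]; near=> v.
  have := fC v; rewrite [x + v]addrC -[X in `|X|]addrA -opprD => fCv.
  apply: le_trans fCv _.
  rewrite expr2 mulrA ler_wpM2r //.
  apply: (@le_trans _ _ ((`|C| + 1) * `|v|)).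
    by rewrite ler_wpM2r // (le_trans (ler_norm _)) // lerDl.
  by rewrite mulrC -ler_pdivlMr ?ltr_pwDr //.
have dE := diff_unique (@continuous_row_form c) fo.
have df : differentiable f x.
  by apply/diff_locallyP; rewrite dE; split; [exact: continuous_row_form|exact: fo].
split=> // i; rewrite deriveE // dE /= /row_form (bigD1 i) //= mxE !eqxx mul1r.
rewrite big1 ?addr0 // => j ji; by rewrite mxE eqxx /= (negbTE ji) mul0r.
Unshelve. all: end_near. Qed.

(** Uniform bounds on two derivatives make the second-order Taylor remainders
    summable, and this gives the Frechet derivative of the sum at once. *)
Lemma differentiable_series (h : nat -> V -> R) (b : nat -> R) (B : R) :
  (forall n y, differentiable (h n) y) ->
  (forall n i y, differentiable (partial i (h n)) y) ->
  (forall n y, `|h n y| <= b n) ->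
  (forall n i y, `|partial i (h n) y| <= b n) ->
  (forall n i j y, `|partial j (partial i (h n)) y| <= b n) ->
  (forall N, series b N <= B) ->
  forall x, differentiable (fun y => limn (series (fun n => h n y))) x /\
    forall i, partial i (fun y => limn (series (fun n => h n y))) x =
      limn (series (fun n => partial i (h n) x)).
Proof.
move=> dh ddh hb dhb ddhb bB x.
apply: (@differentiable_of_taylor _ _ _ (d%:R ^+ 2 * B)) => v.
pose T N := series (fun n => h n (x + v)) N - series (fun n => h n x) N -
  \sum_i v 0 i * series (fun n => partial i (h n) x) N.
have cT : T N @[N --> \oo] --> limn (series (fun n => h n (x + v))) -
    limn (series (fun n => h n x)) -
    \sum_i v 0 i * limn (series (fun n => partial i (h n) x)).
  apply: cvgB.
    by apply: cvgB; apply: (@cvg_series_dom _ b B).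
  apply: cvg_sumr => i; apply: cvgM; first exact: cvg_cst.
  by apply: (@cvg_series_dom _ b B).
apply: (normr_lim_le cT) => N.
have -> : T N = \sum_(0 <= n < N)
    (h n (x + v) - h n x - \sum_i v 0 i * partial i (h n) x).
  rewrite /T /series /= !sumrB; congr (_ - _).
  rewrite exchange_big /=; apply: eq_bigr => i _.
  by rewrite mulr_sumr.
apply: le_trans (ler_norm_sum _ _ _) _.
apply: (@le_trans _ _ (\sum_(0 <= n < N) (d%:R ^+ 2 * b n * `|v| ^+ 2))).
  by apply: ler_sum => n _; exact: taylor2.
rewrite -mulr_suml -mulr_sumr ler_wpM2r // ?exprn_ge0 //.
by rewrite ler_wpM2l ?exprn_ge0 //; exact: bB.
Qed.

Definition dominated (h : nat -> V -> R) : Prop := exists b : nat -> R,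
  (forall n y, `|h n y| <= b n) /\ exists B, forall N, series b N <= B.

(** [differentiable_series] needs a single majorant for a function and its first
    and second derivatives. *)
Lemma dominated_fin (I : finType) (h : I -> nat -> V -> R) :
  (forall i, dominated (h i)) -> exists b : nat -> R,
  (forall i n y, `|h i n y| <= b n) /\ exists B, forall N, series b N <= B.
Proof.
move=> /choice[b hb]; have b0 i n : 0 <= b i n.
  by have [h1 _] := hb i; exact: le_trans (normr_ge0 _) (h1 n 0).
have /choice[B hB] : forall i, exists B, forall N, series (b i) N <= B.
  by move=> i; have [] := hb i.
exists (fun n => \sum_i b i n); split.
  move=> i n y; rewrite (bigD1 i) //=; have [h1 _] := hb i.
  by apply: le_trans (h1 n y) _; rewrite lerDl sumr_ge0.
exists (\sum_i B i) => N; rewrite /series /= exchange_big /=.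
by apply: ler_sum => i _; exact: hB.
Qed.

Section schwartz_series.
Variable h : nat -> V -> R.
Hypothesis h_smooth : forall n, smooth (h n).
Hypothesis h_dom : forall (k : nat) s,
  dominated (fun n x => jbracket x ^+ k * partials s (h n) x).

Let dom0 s : dominated (fun n => partials s (h n)).
Proof.
have [b [hb B]] := h_dom 0 s; exists b; split => // n y.
by have := hb n y; rewrite expr0 mul1r.
Qed.

Let partials_series s x :
  partials s (fun x => limn (series (fun n => h n x))) x =
    limn (series (fun n => partials s (h n) x)) /\
  differentiable (partials s (fun x => limn (series (fun n => h n x)))) x.
Proof.
have D s' := @dominated_fin (option ('I_d * option 'I_d)) (fun o => match o with
  | None => fun n => partials s' (h n)
  | Some (i, None) => fun n => partials (i :: s') (h n)
  | Some (i, Some j) => fun n => partials [:: j, i & s'] (h n) end).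
have E s' y : differentiable (fun y => limn (series (fun n => partials s' (h n) y))) y /\
    forall i, partial i (fun y => limn (series (fun n => partials s' (h n) y))) y =
      limn (series (fun n => partials (i :: s') (h n) y)).
  have [|b [hb [B bB]]] := D s'; first by move=> [[i [j|]]|]; exact: dom0.
  apply: (differentiable_series (b := b) (B := B)) => //.
  - by move=> n z; exact: h_smooth.
  - by move=> n i z; exact: (h_smooth n (i :: s')).
  - by move=> n z; exact: (hb None).
  - by move=> n i z; exact: (hb (Some (i, None))).
  - by move=> n i j z; exact: (hb (Some (i, Some j))).
have P s' : partials s' (fun x => limn (series (fun n => h n x))) =
    fun x => limn (series (fun n => partials s' (h n) x)).
  elim: s' => [//|i s' ih]; apply/funext => y.
  rewrite [partials (i :: s') _]/(partial i (partials s' _)) ih.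
  by have [_ /(_ i)] := E s' y.
by rewrite P; split => //; have [] := E s x.
Qed.

Lemma schwartzR_series : schwartzR (fun x => limn (series (fun n => h n x))).
Proof.
split=> [s x|j s]; first by have [] := partials_series s x.
have [b [hb [B bB]]] := h_dom j s.
exists B => x; have [-> _] := partials_series s x.
have j0 : 0 <= jbracket x ^+ j by rewrite exprn_ge0 // sqrtr_ge0.
rewrite -[X in X * _]ger0_norm // -normrM.
have [b0 [hb0 [B0 bB0]]] := dom0 s.
have c1 := cvg_series_dom (hb0 ^~ x) bB0.
have c2 : jbracket x ^+ j * series (fun n => partials s (h n) x) N @[N --> \oo] -->
    jbracket x ^+ j * limn (series (fun n => partials s (h n) x)).
  exact: (cvgM (cvg_cst _) c1).
apply: (normr_lim_le c2) => N; rewrite /series /= mulr_sumr.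
apply: le_trans (ler_norm_sum _ _ _) (le_trans _ (bB N)).
by apply: ler_sum => n _; exact: hb.
Qed.

End schwartz_series.

End termwise.

(** * Derivatives of modulated Gaussians *)

Section gaussian_terms.
Variables (R : realType) (d : nat).
Local Notation V := 'rV[R]_d.
Implicit Types (x v : V).
Local Notation e_ i := (delta_mx 0 i : V).

Definition has_grad f (f' : 'I_d -> V -> R) := forall x,
  differentiable f x /\ forall i, 'D_(e_ i) f x = f' i x.

Lemma has_grad_eq f f' g' : has_grad f f' -> (forall i x, f' i x = g' i x) ->
  has_grad f g'.
Proof. by move=> h e x; have [h1 h2] := h x; split=> // i; rewrite h2 e. Qed.

Lemma has_grad_cst (r : R) : has_grad (fun=> r) (fun _ _ => 0).
Proof. by move=> x; split=> [|i]; [exact: differentiable_cst|exact: derive_cst]. Qed.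

Lemma has_gradD f g f' g' : has_grad f f' -> has_grad g g' ->
  has_grad (fun x => f x + g x) (fun i x => f' i x + g' i x).
Proof.
move=> hf hg x; have [df Df] := hf x; have [dg Dg] := hg x.
split=> [|i]; first exact: differentiableD.
by rewrite -Df -Dg; apply: deriveD; exact: diff_derivable.
Qed.

Lemma has_gradM f g f' g' : has_grad f f' -> has_grad g g' ->
  has_grad (fun x => f x * g x) (fun i x => f' i x * g x + f x * g' i x).
Proof.
move=> hf hg x; have [df Df] := hf x; have [dg Dg] := hg x.
split=> [|i]; first exact: differentiableM.
rewrite -Df -Dg -[RHS]addrC [_ * g x]mulrC.
by apply: deriveM; exact: diff_derivable.
Qed.

Lemma has_grad_coord i : has_grad (fun x => x 0 i) (fun j _ => (i == j)%:R).
Proof.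
move=> x; split=> [|j]; first exact: differentiable_coord.
rewrite deriveE; last exact: differentiable_coord.
have @L : {linear V -> R}.
  by exists (fun N : V => N 0 i); do 2![eexists]; do ?[constructor];
     rewrite ?mxE// => ? *; rewrite ?mxE//; move=> ?; rewrite !mxE.
have -> : 'd (fun x : V => x 0 i) x = L :> (V -> R).
  have -> : (fun x : V => x 0 i) = L by [].
  by rewrite diff_lin //; exact: coord_continuous.
by rewrite /L /= mxE eqxx.
Qed.

Lemma has_grad_comp (u u' : R -> R) f f' : (forall t : R, is_derive t 1 u (u' t)) ->
  has_grad f f' -> has_grad (fun x => u (f x)) (fun i x => f' i x * u' (f x)).
Proof.
move=> hu hf x; have [df Df] := hf x; have [du Du] := hu (f x).
have du' : differentiable u (f x) by exact/derivable1_diffP.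
split=> [|i]; first exact: (differentiable_comp df du').
rewrite -[fun _ => _]/(u \o f) deriveE; last exact: (differentiable_comp df du').
rewrite diff_comp //= -(deriveE _ df) Df.
by rewrite (deriv1E du) derive1E Du.
Qed.

Lemma has_grad_sum (I : Type) (r : seq I) (F : I -> V -> R) F' :
  (forall i, has_grad (F i) (F' i)) ->
  has_grad (fun x => \sum_(i <- r) F i x) (fun j x => \sum_(i <- r) F' i j x).
Proof.
move=> hF; elim: r => [|i r ih].
  rewrite (_ : (fun _ => _) = fun=> 0); last by apply/funext => x; rewrite big_nil.
  by apply: has_grad_eq (has_grad_cst 0) _ => j x; rewrite big_nil.
rewrite (_ : (fun _ => _) = fun x => F i x + \sum_(j <- r) F j x); last first.
  by apply/funext => x; rewrite big_cons.
by apply: has_grad_eq (has_gradD (hF i) ih) _ => j x; rewrite big_cons.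
Qed.

Lemma has_grad_partial f f' i : has_grad f f' -> partial i f = f' i.
Proof. by move=> h; apply/funext => x; have [_ hx] := h x; exact: hx. Qed.

(** Formal polynomials in the coordinates, the parameters and the two
    trigonometric factors of a modulated Gaussian. The products of such a
    polynomial with the Gaussian are stable under differentiation, and a
    derivative of given order has the same formal expression for all values of
    the parameters: this is what makes the bounds below uniform. *)
Inductive gexpr : Type :=
  | GX of 'I_d | GW of 'I_d | GAl | GCst of R | GCos | GSin
  | GAdd of gexpr & gexpr | GMul of gexpr & gexpr.

Fixpoint gderiv (j : 'I_d) (e : gexpr) : gexpr :=
  match e with
  | GX i => GCst (i == j)%:R
  | GW _ | GAl | GCst _ => GCst 0
  | GCos => GMul (GCst (-1)) (GMul (GW j) GSin)
  | GSin => GMul (GW j) GCos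
  | GAdd a b => GAdd (gderiv j a) (gderiv j b)
  | GMul a b => GAdd (GMul (gderiv j a) b) (GMul a (gderiv j b))
  end.

(** The derivative of the product of [e] with the Gaussian, divided by the
    Gaussian. *)
Definition gstep (j : 'I_d) (e : gexpr) : gexpr :=
  GAdd (gderiv j e) (GMul (GMul (GCst (-2)) (GMul GAl (GX j))) e).

Section eval.
Variables (al : R) (c om : V).

Fixpoint geval (e : gexpr) x : R :=
  match e with
  | GX i => x 0 i - c 0 i
  | GW i => 2 * pi * om 0 i
  | GAl => al
  | GCst r => r
  | GCos => cos (2 * pi * dotp x om)
  | GSin => sin (2 * pi * dotp x om)
  | GAdd a b => geval a x + geval b x
  | GMul a b => geval a x * geval b x
  end.

Definition gterm e x : R := geval e x * expR (- (al * dotp (x - c) (x - c))).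

Lemma has_grad_phase : has_grad (fun x => 2 * pi * dotp x om)
  (fun j _ => 2 * pi * om 0 j).
Proof.
have h (i : 'I_d) := has_gradM (has_grad_coord i) (has_grad_cst (om 0 i)).
apply: has_grad_eq (has_gradM (has_grad_cst (2 * pi)) (has_grad_sum (index_enum 'I_d) h)) _.
move=> j x /=; rewrite mul0r add0r; congr (_ * _).
rewrite (bigD1 j) //= eqxx mul1r mulr0 addr0 big1 ?addr0 // => i /negbTE ->.
by rewrite mul0r mulr0 addr0.
Qed.

Lemma has_grad_shift i : has_grad (fun x => x 0 i - c 0 i) (fun j _ => (i == j)%:R).
Proof.
apply: has_grad_eq (has_gradD (has_grad_coord i) (has_grad_cst (- c 0 i))) _.
by move=> j x /=; rewrite addr0.
Qed.

Lemma has_grad_geval e : has_grad (geval e) (fun j => geval (gderiv j e)).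
Proof.
elim: e => [i|i||r|||a iha b ihb|a iha b ihb] /=.
- exact: has_grad_shift.
- exact: has_grad_cst.
- exact: has_grad_cst.
- exact: has_grad_cst.
- apply: has_grad_eq (has_grad_comp (@is_derive_cos R) has_grad_phase) _.
  by move=> j x /=; rewrite mulN1r mulrN.
- exact: (has_grad_comp (@is_derive_sin R) has_grad_phase).
- exact: has_gradD.
- exact: has_gradM.
Qed.

Lemma has_grad_gterm e : has_grad (gterm e) (fun j => gterm (gstep j e)).
Proof.
have h2 (i : 'I_d) := has_gradM (has_grad_shift i) (has_grad_shift i).
have hs := has_grad_sum (index_enum 'I_d) h2.
have hq := has_gradM (has_grad_cst (- al)) hs.
have hE := has_grad_comp (@is_derive_expR R) hq.
have -> : gterm e = fun x => geval e x *
    expR (- al * \sum_(i < d) (x 0 i - c 0 i) * (x 0 i - c 0 i)).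
  apply/funext => x; rewrite /gterm /dotp mulNr; congr (_ * expR (- (_ * _))).
  by apply: eq_bigr => i _; rewrite !mxE.
apply: has_grad_eq (has_gradM (has_grad_geval e) hE) _ => j x /=.
have -> : \sum_(i < d) ((i == j)%:R * (x 0 i - c 0 i) + (x 0 i - c 0 i) * (i == j)%:R) =
    2 * (x 0 j - c 0 j).
  rewrite (bigD1 j) //= eqxx mul1r mulr1 big1 => [|i /negbTE ->]; first by ring.
  by rewrite mul0r mulr0 addr0.
rewrite /gterm /= (_ : al * dotp (x - c) (x - c) =
  al * \sum_(i < d) (x 0 i - c 0 i) * (x 0 i - c 0 i)); last first.
  by congr (_ * _); apply: eq_bigr => i _; rewrite !mxE.
by rewrite -mulNr; ring.
Qed.

Lemma partials_gterm s e : partials s (gterm e) = gterm (foldr gstep e s).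
Proof.
by elim: s => //= i s ->; rewrite (has_grad_partial i (has_grad_gterm _)).
Qed.

Lemma smooth_gterm e : smooth (gterm e).
Proof. by move=> s x; rewrite partials_gterm; have [] := has_grad_gterm (foldr gstep e s) x. Qed.

End eval.

Lemma jbracket_ge1 x : 1 <= jbracket x.
Proof. by rewrite -sqrtr1 ler_sqrt ?lerDl ?addr_ge0 ?sqr_ge0 // . Qed.

Lemma dotp_ge0 x : 0 <= dotp x x.
Proof. by apply: sumr_ge0 => i _; rewrite -expr2 sqr_ge0. Qed.

Lemma jbracket2 x : jbracket x ^+ 2 = 1 + dotp x x.
Proof.
rewrite /jbracket sqr_sqrtr ?addr_ge0 ?sqr_ge0 // /enorm.
by rewrite sqr_sqrtr ?dotp_ge0.
Qed.

Lemma coord_sqr_le x i : x 0 i ^+ 2 <= dotp x x.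
Proof.
rewrite /dotp (bigD1 i) //= -expr2 lerDl sumr_ge0 // => j _.
by rewrite -expr2 sqr_ge0.
Qed.

Lemma jbracket_shift x c : jbracket x ^+ 2 <= 2 * jbracket c ^+ 2 * (1 + dotp (x - c) (x - c)).
Proof.
rewrite !jbracket2.
have h : dotp x x <= 2 * dotp c c + 2 * dotp (x - c) (x - c).
  rewrite /dotp !mulr_sumr -big_split /=; apply: ler_sum => i _; rewrite !mxE.
  by have := sqr_ge0 (x 0 i - 2 * c 0 i); rewrite !expr2; nra.
have := dotp_ge0 c; have := dotp_ge0 (x - c); nra.
Qed.

(** A single number that measures all the parameters of a wave, so that every
    later bound is a power of it. *)
Definition wave_size (al : R) (c om : V) (Q : R) : Prop :=
  [/\ 1 <= Q, 0 < al, al <= Q & al^-1 <= Q] /\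
  jbracket c ^+ 2 <= Q /\ forall i, `|2 * pi * om 0 i| <= Q.

Lemma geval_bound e : exists (C : R) (N : nat), 0 <= C /\
  forall al c om Q x, wave_size al c om Q ->
  `|geval al c om e x| <= C * (Q * (1 + dotp (x - c) (x - c))) ^+ N.
Proof.
have Z1 (c : V) Q x : 1 <= Q -> 1 <= Q * (1 + dotp (x - c) (x - c)).
  by move=> Q1; have := dotp_ge0 (x - c); nra.
elim: e => [i|i||r|||a [C1 [N1 [C10 h1]]] b [C2 [N2 [C20 h2]]]
    |a [C1 [N1 [C10 h1]]] b [C2 [N2 [C20 h2]]]].
- exists 1, 1%N; split=> // al c om Q x [[Q1 _ _ _] _] /=; rewrite mul1r expr1.
  have h := coord_sqr_le (x - c) i; rewrite !mxE in h.
  have h0 := dotp_ge0 (x - c).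
  apply: (@le_trans _ _ (1 + dotp (x - c) (x - c))); last first.
    by rewrite ler_peMl // addr_ge0.
  have : `|x 0 i - c 0 i| ^+ 2 <= dotp (x - c) (x - c) by rewrite real_normK ?num_real.
  have := normr_ge0 (x 0 i - c 0 i); nra.
- exists 1, 1%N; split=> // al c om Q x [[Q1 _ _ _] [_ omQ]] /=; rewrite mul1r expr1.
  by apply: le_trans (omQ i) _; rewrite ler_peMr ?lerDl ?dotp_ge0 // (le_trans ler01).
- exists 1, 1%N; split=> // al c om Q x [[Q1 al0 alQ _] _] /=; rewrite mul1r expr1.
  rewrite gtr0_norm //; apply: le_trans alQ _.
  by rewrite ler_peMr ?lerDl ?dotp_ge0 // (le_trans ler01).
- by exists `|r|, 0; split=> // al c om Q x _ /=; rewrite expr0 mulr1.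
- by exists 1, 0; split=> // al c om Q x _ /=; rewrite expr0 mulr1 ler_norml cos_geN1 cos_le1.
- by exists 1, 0; split=> // al c om Q x _ /=; rewrite expr0 mulr1 ler_norml sin_geN1 sin_le1.
- exists (C1 + C2), (N1 + N2)%N; split; first exact: addr_ge0.
  move=> al c om Q x sz /=; have [[Q1 _ _ _] _] := sz.
  apply: le_trans (ler_normD _ _) _; rewrite mulrDl; apply: lerD.
    apply: le_trans (h1 _ _ _ _ x sz) _; rewrite ler_wpM2l // ler_weXn2l ?Z1 //.
    exact: leq_addr.
  apply: le_trans (h2 _ _ _ _ x sz) _; rewrite ler_wpM2l // ler_weXn2l ?Z1 //.
  exact: leq_addl.
- exists (C1 * C2), (N1 + N2)%N; split; first exact: mulr_ge0.
  move=> al c om Q x sz /=; rewrite normrM exprD mulrACA.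
  by apply: ler_pM => //; [exact: h1|exact: h2].
Qed.

Lemma exprD1_expRN_le (t : R) n : 0 <= t -> (1 + t) ^+ n * expR (- t) <= n`!%:R * expR 1.
Proof.
move=> t0; rewrite expRN ler_pdivrMr ?expR_gt0 // -mulrA -expRD.
have h : 0 <= 1 + t by rewrite addr_ge0.
case: n => [|n]; first by rewrite expr0 fact0 mul1r (le_trans _ (expR_ge1Dx _)) // lerDl.
rewrite [leRHS]mulrC -ler_pdivrMr ?ltr0n ?fact_gt0 //.
by apply: le_trans (expR_ge1Dxn n h); rewrite lerDr.
Qed.

(** The Gaussian absorbs every power of the distance to the centre; what is lost
    in passing from this distance to the bracket, and from [al] to 1, is a power
    of the size of the parameters. *)
Lemma gterm_bound (k : nat) e : exists (C : R) (N : nat), 0 <= C /\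
  forall al c om Q x, wave_size al c om Q ->
  jbracket x ^+ k * `|gterm al c om e x| <= C * Q ^+ N.
Proof.
have [C [N [C0 h]]] := geval_bound e.
exists (2 ^+ k * C * ((k + N)`!%:R * expR 1)), (k + N + (k + N))%N; split.
  by rewrite !mulr_ge0 // ?exprn_ge0 // expR_ge0.
move=> al c om Q x sz; have [[Q1 al0 alQ alVQ] [cQ omQ]] := sz.
set y := dotp (x - c) (x - c); have y0 : 0 <= y by exact: dotp_ge0.
have Q0 : 0 <= Q by exact: le_trans Q1.
have j1 := jbracket_ge1 x.
have h1 : jbracket x ^+ k <= 2 ^+ k * (Q * (1 + y)) ^+ k.
  apply: (@le_trans _ _ ((jbracket x ^+ 2) ^+ k)).
    by rewrite -exprM ler_weXn2l // mul2n -addnn leq_addr.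
  rewrite -exprMn lerXn2r ?nnegrE ?exprn_ge0 ?mulr_ge0 ?addr_ge0 //; first by rewrite (le_trans ler01).
  apply: le_trans (jbracket_shift x c) _; rewrite -mulrA ler_wpM2l //.
  by rewrite ler_wpM2r // addr_ge0.
have h2 : 1 + y <= Q * (1 + al * y).
  have : 1 <= Q * al by rewrite -ler_pdivrMr // div1r.
  nra.
have hk : (1 + y) ^+ (k + N) * expR (- (al * y)) <= Q ^+ (k + N) * ((k + N)`!%:R * expR 1).
  apply: (@le_trans _ _ ((Q * (1 + al * y)) ^+ (k + N) * expR (- (al * y)))).
    rewrite ler_wpM2r ?expR_ge0 // lerXn2r ?nnegrE ?addr_ge0 //.
    by rewrite mulr_ge0 // addr_ge0 // mulr_ge0 // ltW.
  rewrite exprMn -mulrA ler_wpM2l ?exprn_ge0 //.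
  by apply: exprD1_expRN_le; rewrite mulr_ge0 // ltW.
rewrite /gterm -/y normrM [`|expR _|]ger0_norm ?expR_ge0 //.
apply: (@le_trans _ _ (2 ^+ k * (Q * (1 + y)) ^+ k *
    (C * (Q * (1 + y)) ^+ N * expR (- (al * y))))).
  apply: ler_pM; [|by rewrite mulr_ge0 // expR_ge0|exact: h1|].
    by rewrite exprn_ge0 // (le_trans ler01).
  by rewrite ler_wpM2r ?expR_ge0 // h.
have -> : 2 ^+ k * (Q * (1 + y)) ^+ k * (C * (Q * (1 + y)) ^+ N * expR (- (al * y))) =
    2 ^+ k * C * Q ^+ (k + N) * ((1 + y) ^+ (k + N) * expR (- (al * y))).
  by rewrite !exprMn !exprD; ring.
rewrite [leRHS](_ : _ = 2 ^+ k * C * Q ^+ (k + N) * (Q ^+ (k + N) * ((k + N)`!%:R * expR 1))).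
  by apply: ler_wpM2l hk; rewrite !mulr_ge0 // exprn_ge0.
by rewrite !exprD; ring.
Qed.

End gaussian_terms.

(** * Absolutely convergent complex series *)

Section complex_sums.
Variable R : realType.
Local Open Scope complex_scope.
Local Notation normc := Normc.normc.
Implicit Types (u : nat -> R[i]) (b : nat -> R).

Lemma normcD (x y : R[i]) : normc (x + y) <= normc x + normc y.
Proof. exact: (@le_normcD R x y). Qed.

Lemma normcB_sym (x y : R[i]) : normc (x - y) = normc (y - x).
Proof. by rewrite -opprB; exact: (@normcN R (y - x)). Qed.

Lemma normc_sum (I : Type) (r : seq I) (F : I -> R[i]) :
  normc (\sum_(i <- r) F i) <= \sum_(i <- r) normc (F i).
Proof.
elim: r => [|i r ih]; first by rewrite !big_nil Normc.normc0.
by rewrite !big_cons; apply: le_trans (normcD _ _) (lerD _ ih).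
Qed.

(** Real and imaginary parts are summed separately, so that only real limits
    occur. *)
Definition csum u : R[i] :=
  limn (series (fun n => complex.Re (u n))) +i* limn (series (fun n => complex.Im (u n))).

Definition has_sum u (z : R[i]) : Prop :=
  normc (z - \sum_(0 <= n < N) u n) @[N --> \oo] --> (0 : R).

Lemma Re_sum (r : seq nat) u :
  complex.Re (\sum_(n <- r) u n) = \sum_(n <- r) complex.Re (u n).
Proof.
elim: r => [|n r ih]; first by rewrite !big_nil.
by rewrite !big_cons -ih; case: (u n) (\sum_(j <- r) u j) => a c [a' c'].
Qed.

Lemma Im_sum (r : seq nat) u :
  complex.Im (\sum_(n <- r) u n) = \sum_(n <- r) complex.Im (u n).
Proof.
elim: r => [|n r ih]; first by rewrite !big_nil.
by rewrite !big_cons -ih; case: (u n) (\sum_(j <- r) u j) => a c [a' c'].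
Qed.

Lemma series_tail_le (r b : nat -> R) (B : R) N : (forall n, `|r n| <= b n) ->
  (forall N, series b N <= B) ->
  `|limn (series r) - series r N| <= limn (series b) - series b N.
Proof.
move=> rb bB; have b0 n : 0 <= b n by exact: le_trans (normr_ge0 _) (rb n).
have cr := cvg_series_dom rb bB.
have cb : series b M @[M --> \oo] --> limn (series b).
  by apply: (cvg_series_dom (b := b) _ bB) => n; rewrite ger0_norm.
have c : series r (M + N)%N - series r N @[M --> \oo] --> limn (series r) - series r N.
  apply: cvgB; last exact: cvg_cst.
  by rewrite (cvg_shiftn N (series r)).
apply: (normr_lim_le c) => M.
have -> : series r (M + N)%N - series r N = \sum_(N <= n < M + N) r n.
  by rewrite sub_series_geq // leq_addl.
apply: le_trans (ler_norm_sum _ _ _) _.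
apply: (@le_trans _ _ (series b (M + N)%N - series b N)).
  rewrite sub_series_geq ?leq_addl //; apply: ler_sum => n _; exact: rb.
rewrite lerB //; apply: nondecreasing_cvgn_le; last by apply/cvg_ex; eexists; exact: cb.
by apply: nondecreasing_series => n _ _.
Qed.

Lemma csum_tail u b (B : R) N : (forall n, normc (u n) <= b n) ->
  (forall N, series b N <= B) ->
  normc (csum u - \sum_(0 <= n < N) u n) <= 2 * (limn (series b) - series b N).
Proof.
move=> ub bB; apply: le_trans (normc_le_ReIm _) _.
have hR : complex.Re (csum u - \sum_(0 <= n < N) u n) =
    limn (series (fun n => complex.Re (u n))) - series (fun n => complex.Re (u n)) N.
  by rewrite /series /= -Re_sum; case: (\sum_(0 <= n < N) u n).
have hI : complex.Im (csum u - \sum_(0 <= n < N) u n) =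
    limn (series (fun n => complex.Im (u n))) - series (fun n => complex.Im (u n)) N.
  by rewrite /series /= -Im_sum; case: (\sum_(0 <= n < N) u n).
rewrite hR hI mulr_natl mulr2n; apply: lerD; apply: (series_tail_le _ _ bB) => n.
  exact: le_trans (Re_le_normc _) (ub n).
exact: le_trans (Im_le_normc _) (ub n).
Qed.

Lemma tail_cvg0 b (B : R) : (forall n, 0 <= b n) -> (forall N, series b N <= B) ->
  limn (series b) - series b N @[N --> \oo] --> (0 : R).
Proof.
move=> b0 bB; rewrite -[X in _ --> X](subrr (limn (series b))).
apply: cvgB; first exact: cvg_cst.
by apply: (cvg_series_dom (b := b) _ bB) => n; rewrite ger0_norm.
Qed.

Lemma squeeze0 (u v : nat -> R) : (forall n, 0 <= u n <= v n) ->
  v n @[n --> \oo] --> (0 : R) -> u n @[n --> \oo] --> (0 : R).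
Proof.
move=> uv v0; apply: (@squeeze_cvgr _ _ _ _ (fun=> 0) v) => //; last exact: cvg_cst.
exact: nearW.
Qed.

Lemma has_sum_csum u b (B : R) : (forall n, normc (u n) <= b n) ->
  (forall N, series b N <= B) -> has_sum u (csum u).
Proof.
move=> ub bB; have b0 n : 0 <= b n by exact: le_trans (normc_ge0 _) (ub n).
apply: squeeze0 (fun N => introT andP (conj (normc_ge0 _) (csum_tail N ub bB))) _.
by rewrite -[X in _ --> X](mulr0 2); apply: cvgM; [exact: cvg_cst|exact: tail_cvg0 bB].
Qed.

Lemma has_sum_unique u z1 z2 : has_sum u z1 -> has_sum u z2 -> z1 = z2.
Proof.
move=> h1 h2; apply/eqP; rewrite -subr_eq0; apply/eqP/Normc.eq0_normc.
have h : normc (z1 - z2) @[N --> \oo] --> (0 : R).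
  apply: (squeeze0 (v := fun N => normc (z1 - \sum_(0 <= n < N) u n) +
     normc (z2 - \sum_(0 <= n < N) u n))) => [N|].
    rewrite normc_ge0 /= [X in _ <= _ + X]normcB_sym.
    by apply: le_trans (normcD _ _); rewrite addrA subrK.
  by rewrite -[X in _ --> X]addr0; exact: cvgD h1 h2.
by apply: (cvg_unique _ (cvg_cst _) h).
Qed.

Lemma normc_has_sum_le u z (B : R) : has_sum u z ->
  (forall N, \sum_(0 <= n < N) normc (u n) <= B) -> normc z <= B.
Proof.
move=> h uB.
have c : normc (z - \sum_(0 <= n < N) u n) + B @[N --> \oo] --> (0 : R) + B.
  by apply: cvgD => //; exact: cvg_cst.
rewrite add0r in c; rewrite -(cvg_lim _ c) //; apply: limr_ge.
  by apply/cvg_ex; exists B.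
apply: nearW => N; rewrite -[X in normc X](subrK (\sum_(0 <= n < N) u n)).
apply: le_trans (normcD _ _) _; rewrite lerD2l.
exact: le_trans (normc_sum _ _) (uB N).
Qed.

Lemma has_sumD u v z w : has_sum u z -> has_sum v w ->
  has_sum (fun n => u n + v n) (z + w).
Proof.
move=> h1 h2; apply: (squeeze0 (v := fun N => normc (z - \sum_(0 <= n < N) u n) +
     normc (w - \sum_(0 <= n < N) v n))) => [N|].
  rewrite normc_ge0 /= big_split /= opprD addrACA; exact: normcD.
by rewrite -[X in _ --> X]addr0; exact: cvgD h1 h2.
Qed.

Lemma has_sum_single u m : (forall n, n != m -> u n = 0) -> has_sum u (u m).
Proof.
move=> u0; apply: cvg_near_cst; near=> N.
rewrite (_ : \sum_(0 <= n < N) u n = u m) ?subrr ?Normc.normc0 //.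
have mN : (m < N)%N by near: N; exact: nbhs_infty_gt.
rewrite (bigD1_seq m) ?mem_index_iota ?iota_uniq //= big1 ?addr0 // => n /u0 //.
Unshelve. all: end_near. Qed.

End complex_sums.

(** * Schwartz functions and series of waves *)

Section schwartz_space.
Variables (R : realType) (d : nat).
Local Open Scope complex_scope.
Local Notation normc := Normc.normc.
Local Notation V := 'rV[R]_d.
Implicit Types (g : V -> R) (f : V -> R[i]^o).

Lemma partials_lin g1 g2 (a b : R) s : smooth g1 -> smooth g2 ->
  partials s (fun x => a * g1 x + b * g2 x) =
    (fun x => a * partials s g1 x + b * partials s g2 x) /\
  forall x, differentiable (partials s (fun x => a * g1 x + b * g2 x)) x.
Proof.
move=> sg1 sg2.
have G g s' : smooth g -> has_grad (partials s' g) (fun i => partials (i :: s') g).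
  by move=> sg x; split=> //; exact: sg.
have L s' := has_gradD (has_gradM (has_grad_cst a) (G _ s' sg1))
  (has_gradM (has_grad_cst b) (G _ s' sg2)).
have E s' : partials s' (fun x => a * g1 x + b * g2 x) =
    (fun x => a * partials s' g1 x + b * partials s' g2 x).
  elim: s' => [//|i s' ih].
  rewrite [partials (i :: s') _]/(partial i (partials s' _)) ih.
  apply: etrans (has_grad_partial i (L s')) _.
  by apply/funext => x; rewrite !mul0r !add0r.
by split=> // x; rewrite E; have [] := L s x.
Qed.

Lemma schwartzR_lin g1 g2 (a b : R) : schwartzR g1 -> schwartzR g2 ->
  schwartzR (fun x => a * g1 x + b * g2 x).
Proof.
move=> [s1 h1] [s2 h2]; split=> [s x|j s].
  by have [_] := partials_lin a b s s1 s2; apply.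
have [-> _] := partials_lin a b s s1 s2.
have [M1 H1] := h1 j s; have [M2 H2] := h2 j s.
exists (`|a| * M1 + `|b| * M2) => x.
have j0 : 0 <= jbracket x ^+ j by rewrite exprn_ge0 // sqrtr_ge0.
apply: (@le_trans _ _ (`|a| * (jbracket x ^+ j * `|partials s g1 x|) +
    `|b| * (jbracket x ^+ j * `|partials s g2 x|))).
  rewrite [`|a| * _]mulrCA [`|b| * _]mulrCA -mulrDr ler_wpM2l // -!normrM.
  exact: ler_normD.
by rewrite lerD // ler_wpM2l.
Qed.

Lemma schwartzD f1 f2 : schwartz f1 -> schwartz f2 -> schwartz (f1 + f2).
Proof.
move=> [r1 i1] [r2 i2]; split.
  have := schwartzR_lin 1 1 r1 r2; congr schwartzR; apply/funext => x.
  by rewrite !mul1r /GRing.add /=; case: (f1 x) (f2 x) => ? ? [].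
have := schwartzR_lin 1 1 i1 i2; congr schwartzR; apply/funext => x.
by rewrite !mul1r /GRing.add /=; case: (f1 x) (f2 x) => ? ? [].
Qed.

Lemma schwartzZ f (c : R[i]) : schwartz f -> schwartz (c *: f).
Proof.
move=> [fr fi]; split.
  have := schwartzR_lin (complex.Re c) (- complex.Im c) fr fi.
  by congr schwartzR; rewrite -ReZ.
have := schwartzR_lin (complex.Re c) (complex.Im c) fi fr.
by congr schwartzR; rewrite -ImZ.
Qed.

Lemma decay_weight_jbracket (x : V) : 1 <= jbracket x ^+ (2 * d) * decay_weight x.
Proof.
rewrite exprM jbracket2 -[X in _ ^+ X]card_ord -prodr_const -big_split /=.
have h i : 1 <= (1 + dotp x x) * (1 + x 0 i ^+ 2)^-1.
  rewrite ler_pdivlMr ?mul1r ?lerD2l ?coord_sqr_le //.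
  by rewrite ltr_pwDl // sqr_ge0.
elim/big_ind : _ => // a b a1 b1; rewrite -[1]mulr1 ler_pM //.
Qed.

Lemma schwartzR_decaying g : schwartzR g -> decaying g.
Proof.
move=> [sg hg]; split; first by move=> x; exact/differentiable_continuous/(sg [::]).
have [M HM] := hg (2 * d)%N [::]; exists M => x.
apply: le_trans (_ : jbracket x ^+ (2 * d) * `|g x| * decay_weight x <= _); last first.
  by rewrite ler_wpM2r ?decay_weight_ge0 //; exact: HM.
by rewrite mulrAC ler_peMl // decay_weight_jbracket.
Qed.

Lemma schwartz_decayingC f : schwartz f -> decayingC f.
Proof. by move=> [fr fi]; split; exact: schwartzR_decaying. Qed.

Lemma decayingC0 : decayingC (fun=> 0 : R[i]) (d := d).
Proof.
have h : decaying (fun=> 0 : R) (d := d).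
  split; first exact: cst_continuous.
  by exists 0 => x; rewrite normr0 mul0r.
by [].
Qed.

Lemma fourier_sum (g : nat -> V -> R[i]) N xi : (forall n, decayingC (g n)) ->
  decayingC (fun x => \sum_(0 <= n < N) g n x) /\
  fourier (fun x => \sum_(0 <= n < N) g n x) xi = \sum_(0 <= n < N) fourier (g n) xi.
Proof.
move=> dg; elim: N => [|N [ih1 ih2]].
  rewrite big_geq // (_ : (fun _ => _) = fun=> 0); last by apply/funext => x; rewrite big_geq.
  split; first exact: decayingC0.
  rewrite (_ : (fun=> 0 : R[i]) = fun x : V => 0 * 0); last by apply/funext => x; rewrite mul0r.
  by rewrite fourierZ ?mul0r //; exact: decayingC0.
rewrite (_ : (fun _ => _) = fun x => \sum_(0 <= n < N) g n x + g N x); last first.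
  by apply/funext => x; rewrite big_nat_recr.
by split; [exact: decayingCD|rewrite fourierD // ih2 big_nat_recr].
Qed.

Lemma waveE a c0 om0 x : wave a c0 om0 x =
  gterm a c0 om0 (GCos R d) x +i* gterm a c0 om0 (GSin R d) x.
Proof.
rewrite /wave /gterm /cis.
have -> : \prod_i gauss a (c0 0 i) (x 0 i) = expR (- (a * dotp (x - c0) (x - c0))).
  rewrite /dotp mulr_sumr -sumrN expR_sum; apply: eq_bigr => i _.
  by rewrite /gauss !mxE expr2.
by simpc; congr (_ +i* _); rewrite mulrC.
Qed.

Lemma exists_wave_size al (c om : V) : 0 < al -> exists Q, wave_size al c om Q.
Proof.
move=> al0; exists (1 + al + al^-1 + jbracket c ^+ 2 + \sum_i `|2 * pi * om 0 i|).
have a1 : 0 < al^-1 by rewrite invr_gt0.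
have a2 : 0 <= jbracket c ^+ 2 by rewrite sqr_ge0.
have a3 : 0 <= \sum_i `|2 * pi * om 0 i| by exact: sumr_ge0.
split; first by split; lra.
split=> [|i]; first lra.
have : `|2 * pi * om 0 i| <= \sum_i `|2 * pi * om 0 i|.
  by rewrite (bigD1 i) //= lerDl sumr_ge0.
lra.
Qed.

Lemma schwartzR_gterm al (c om : V) e : 0 < al -> schwartzR (gterm al c om e).
Proof.
move=> /(exists_wave_size c om)[Q Qs]; split; first exact: smooth_gterm.
move=> j s; rewrite partials_gterm.
have [C [N [_ H]]] := gterm_bound j (foldr (@gstep R d) e s).
by exists (C * Q ^+ N) => x; exact: H.
Qed.

Lemma schwartz_wave al (c om : V) : 0 < al -> schwartz (wave al c om : V -> R[i]^o).
Proof.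
move=> al0; split.
  rewrite (_ : (fun _ => _) = gterm al c om (GCos R d)); first exact: schwartzR_gterm.
  by apply/funext => x; rewrite waveE.
rewrite (_ : (fun _ => _) = gterm al c om (GSin R d)); first exact: schwartzR_gterm.
by apply/funext => x; rewrite waveE.
Qed.

Section wave_series.
Variables (ka : nat -> R[i]) (al : nat -> R) (c om : nat -> V) (Q : nat -> R).
Hypothesis Q_size : forall n, wave_size (al n) (c n) (om n) (Q n).
Hypothesis ka_rapid : forall k : nat, exists B : R,
  forall N, series (fun n => normc (ka n) * Q n ^+ k) N <= B.

Let term n x := ka n * wave (al n) (c n) (om n) x.

Let h (a b : nat -> R) n x := a n * gterm (al n) (c n) (om n) (GCos R d) x +
  b n * gterm (al n) (c n) (om n) (GSin R d) x.

Let schwartz_h (a b : nat -> R) : (forall n, `|a n| <= normc (ka n)) ->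
  (forall n, `|b n| <= normc (ka n)) ->
  schwartzR (fun x => limn (series (fun n => h a b n x))).
Proof.
move=> ha hb; apply: schwartzR_series.
  move=> n s x; have [_] := partials_lin (a n) (b n) s
    (smooth_gterm (al n) (c n) (om n) (GCos R d)) (smooth_gterm (al n) (c n) (om n) (GSin R d)).
  exact.
move=> k s.
have [C1 [N1 [C10 H1]]] := gterm_bound k (foldr (@gstep R d) (GCos R d) s).
have [C2 [N2 [C20 H2]]] := gterm_bound k (foldr (@gstep R d) (GSin R d) s).
have [B1 HB1] := ka_rapid N1; have [B2 HB2] := ka_rapid N2.
exists (fun n => C1 * (normc (ka n) * Q n ^+ N1) + C2 * (normc (ka n) * Q n ^+ N2)); split.
  move=> n x; have [-> _] := partials_lin (a n) (b n) s
    (smooth_gterm (al n) (c n) (om n) (GCos R d)) (smooth_gterm (al n) (c n) (om n) (GSin R d)).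
  rewrite !partials_gterm.
  have j0 : 0 <= jbracket x ^+ k by rewrite exprn_ge0 // sqrtr_ge0.
  rewrite normrM [`|_ ^+ k|]ger0_norm //.
  apply: (@le_trans _ _ (jbracket x ^+ k * (`|a n| *
      `|gterm (al n) (c n) (om n) (foldr (gstep (d:=d)) (GCos R d) s) x| + `|b n| *
      `|gterm (al n) (c n) (om n) (foldr (gstep (d:=d)) (GSin R d) s) x|))).
    by rewrite ler_wpM2l // -!normrM ler_normD.
  rewrite mulrDr !(mulrCA (jbracket x ^+ k)) !(mulrCA _ (normc (ka n))).
  by apply: lerD; apply: ler_pM => //; rewrite ?mulr_ge0 ?H1 ?H2.
exists (C1 * B1 + C2 * B2) => N; rewrite /series /= big_split /= -!mulr_sumr.
by apply: lerD; rewrite ler_wpM2l //; [exact: HB1|exact: HB2].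
Qed.

Let term_bound : exists b : nat -> R, (forall n x,
  jbracket x ^+ (2 * d) * normc (term n x) <= b n) /\ exists B, forall N, series b N <= B.
Proof.
have [C1 [N1 [C10 H1]]] := gterm_bound (2 * d) (GCos R d).
have [C2 [N2 [C20 H2]]] := gterm_bound (2 * d) (GSin R d).
have [B1 HB1] := ka_rapid N1; have [B2 HB2] := ka_rapid N2.
exists (fun n => C1 * (normc (ka n) * Q n ^+ N1) + C2 * (normc (ka n) * Q n ^+ N2)); split.
  move=> n x; rewrite /term Normc.normcM waveE.
  have j0 : 0 <= jbracket x ^+ (2 * d) by rewrite exprn_ge0 // sqrtr_ge0.
  apply: le_trans (_ : jbracket x ^+ (2 * d) * (normc (ka n) *
     (`|gterm (al n) (c n) (om n) (GCos R d) x| +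
      `|gterm (al n) (c n) (om n) (GSin R d) x|)) <= _).
    by rewrite ler_wpM2l // ler_wpM2l ?normc_ge0 //; exact: normc_le_ReIm.
  rewrite mulrCA !(mulrCA _ (normc (ka n))) -mulrDr ler_wpM2l ?normc_ge0 //.
  by rewrite mulrDr lerD ?H1 ?H2.
exists (C1 * B1 + C2 * B2) => N; rewrite /series /= big_split /= -!mulr_sumr.
by apply: lerD; rewrite ler_wpM2l //; [exact: HB1|exact: HB2].
Qed.

Definition wave_series x : R[i] := csum (fun n => term n x).

Lemma schwartz_wave_series : schwartz (wave_series : V -> R[i]^o).
Proof.
split.
  have := schwartz_h (a := fun n => complex.Re (ka n)) (b := fun n => - complex.Im (ka n)).
  move=> /(_ (fun n => Re_le_normc _)).
  have H n : `|- complex.Im (ka n)| <= normc (ka n) by rewrite normrN Im_le_normc.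
  move=> /(_ H); congr schwartzR; apply/funext => x /=; congr (limn (series _)).
  apply/funext => n; rewrite /term waveE /h.
  by case: (ka n) => a b /=; rewrite mulNr.
have := schwartz_h (a := fun n => complex.Im (ka n)) (b := fun n => complex.Re (ka n)).
move=> /(_ (fun n => Im_le_normc _) (fun n => Re_le_normc _)).
congr schwartzR; apply/funext => x /=; congr (limn (series _)).
apply/funext => n; rewrite /term waveE /h.
by case: (ka n) => a b /=; rewrite addrC.
Qed.

Let term_bound1 b n x : jbracket x ^+ (2 * d) * normc (term n x) <= b n ->
  normc (term n x) <= b n.
Proof.
apply: le_trans; rewrite ler_peMl ?normc_ge0 //.
by rewrite exprn_ege1 // jbracket_ge1.
Qed.

Lemma has_sum_wave_series x : has_sum (fun n => term n x) (wave_series x).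
Proof.
have [b [hb [B bB]]] := term_bound.
by apply: (has_sum_csum (b := b) _ bB) => n; exact: term_bound1 (hb n x).
Qed.

Lemma decayingC_term n : decayingC (term n).
Proof.
apply/decayingCZ/schwartz_decayingC/schwartz_wave.
by have [[_ al0 _ _] _] := Q_size n.
Qed.

(** The remainders of the series tend to 0 in the norm weighted by
    [decay_weight], and [normc_fourier_le] carries this over to the
    transforms. *)
Lemma has_sum_fourier_wave_series xi :
  has_sum (fun n => fourier (term n) xi) (fourier wave_series xi).
Proof.
have [b [hb [B bB]]] := term_bound.
have b0 n : 0 <= b n.
  apply: le_trans (hb n 0); rewrite mulr_ge0 ?normc_ge0 // exprn_ge0 //.
  exact: sqrtr_ge0.
pose tau N := 2 * (limn (series b) - series b N).
have tau0 : tau N @[N --> \oo] --> (0 : R).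
  by rewrite -[X in _ --> X](mulr0 2); apply: cvgM; [exact: cvg_cst|exact: tail_cvg0 bB].
apply: (squeeze0 (v := fun N => 4 * (tau N * decay_mass R d))); last first.
  rewrite -[X in _ --> X](mulr0 4); apply: cvgM; first exact: cvg_cst.
  by rewrite -[X in _ --> X](mul0r (decay_mass R d)); apply: cvgM => //; exact: cvg_cst.
move=> N; rewrite normc_ge0 /=.
have [dN <-] := fourier_sum N xi decayingC_term.
have dw := schwartz_decayingC schwartz_wave_series.
have -> : fourier wave_series xi - fourier (fun x => \sum_(0 <= n < N) term n x) xi =
    fourier (fun x => wave_series x + -1 * \sum_(0 <= n < N) term n x) xi.
  by rewrite fourierD ?fourierZ ?mulN1r //; exact: decayingCZ.
apply: normc_fourier_le.
  by apply: decayingCD => //; exact: decayingCZ.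
move=> x; rewrite mulN1r.
set w := decay_weight x; have w0 : 0 <= w by exact: decay_weight_ge0.
set j := jbracket x ^+ (2 * d); have jw : 1 <= j * w by exact: decay_weight_jbracket.
have j0 : 0 < j by rewrite exprn_gt0 // (lt_le_trans ltr01) // jbracket_ge1.
have wj : j^-1 <= w by rewrite -div1r ler_pdivrMr // mulrC.
have hb' n : normc (term n x) <= j^-1 * b n.
  by rewrite mulrC ler_pdivlMr // mulrC hb.
have bB' M : series (fun n => j^-1 * b n) M <= j^-1 * B.
  by rewrite /series /= -mulr_sumr ler_wpM2l ?invr_ge0 ?(ltW j0) //; exact: bB.
apply: le_trans (csum_tail N hb' bB') _.
have cb : series b M @[M --> \oo] --> limn (series b).
  by apply: (cvg_series_dom (b := b) _ bB) => n; rewrite ger0_norm.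
have -> : limn (series (fun n => j^-1 * b n)) - series (fun n => j^-1 * b n) N =
    j^-1 * (limn (series b) - series b N).
  rewrite mulrBr; congr (_ - _); last by rewrite /series /= mulr_sumr.
  apply: cvg_lim => //; rewrite (_ : series _ = fun M => j^-1 * series b M).
    by apply: cvgM => //; exact: cvg_cst.
  by apply/funext => M; rewrite /series /= mulr_sumr.
have t0 : 0 <= limn (series b) - series b N.
  have nb n : `|b n| <= b n by rewrite ger0_norm.
  exact: le_trans (normr_ge0 _) (series_tail_le N nb bB).
rewrite mulrCA mulrC ler_wpM2l // mulr_ge0 //.
Qed.

End wave_series.
End schwartz_space.

(** * Solving a smoothing perturbation of the identity *)

Section neumann.
Variable R : realType.
Local Open Scope complex_scope.
Local Notation normc := Normc.normc.

Definition rapid_seq (w : nat -> R) (x : nat -> R[i]) : Prop :=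
  forall j : nat, exists M : R, forall n, normc (x n) * w n ^+ j <= M.

Lemma normc_csum_le (u : nat -> R[i]) (b : nat -> R) (B : R) :
  (forall n, normc (u n) <= b n) -> (forall N, series b N <= B) ->
  has_sum u (csum u) /\ normc (csum u) <= B.
Proof.
move=> ub bB; have h := has_sum_csum ub bB; split=> //.
apply: (normc_has_sum_le h) => N; apply: le_trans (bB N).
by apply: ler_sum => n _.
Qed.

Lemma series_half (c : R) N : series (fun k => c * (1 / 2) ^+ k) N = 2 * c - 2 * c * (1 / 2) ^+ N.
Proof.
elim: N => [|N ih]; first by rewrite /series /= big_geq // expr0 mulr1 subrr.
by rewrite /series /= big_nat_recr //= [X in X + _]ih exprS; field.
Qed.

Lemma half_pow_cvg0 (c : R) : c * (1 / 2) ^+ N @[N --> \oo] --> (0 : R).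
Proof.
rewrite -[X in _ --> X](mulr0 c); apply: cvgM; first exact: cvg_cst.
by apply: cvg_expr; rewrite ger0_norm; lra.
Qed.

Lemma csum_half_tail (u : nat -> R[i]) (c : R) N : 0 <= c ->
  (forall k, normc (u k) <= c * (1 / 2) ^+ k) ->
  normc (csum u - \sum_(0 <= k < N) u k) <= 4 * c * (1 / 2) ^+ N.
Proof.
move=> c0 uc; have sB M : series (fun k => c * (1 / 2) ^+ k) M <= 2 * c.
  rewrite series_half gerBl !mulr_ge0 // exprn_ge0 // divr_ge0 //.
apply: le_trans (csum_tail N uc sB) _.
have -> : limn (series (fun k => c * (1 / 2) ^+ k)) = 2 * c.
  apply: cvg_lim => //; rewrite -[X in _ --> X]subr0.
  rewrite (_ : series _ = fun N => 2 * c - 2 * c * (1 / 2) ^+ N); last first.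
    by apply/funext => M; exact: series_half.
  by apply: cvgB; [exact: cvg_cst|exact: half_pow_cvg0].
by rewrite series_half le_eqVlt; apply/orP; left; apply/eqP; ring.
Qed.

Variables (K : nat -> nat -> R[i]) (w v : nat -> R) (S R1 : R) (s0 J0 : nat).
Variable H : pred nat.
Hypothesis w1 : forall n, 1 <= w n.
Hypothesis w_sum : forall N, series (fun n => (w n ^+ s0)^-1) N <= S.
Hypothesis wv : forall n, w n <= v n <= R1 * w n.
Hypothesis K_smoothing : forall J, (J0 <= J)%N -> exists C : R,
  forall n m, normc (K n m) * w n ^+ J.+1 * w m ^+ s0 <= C * w m ^+ J.
Hypothesis K_small : forall n N, H n ->
  series (fun m => normc (K n m) / v m ^+ J0) N <= 1 / 2 / v n ^+ J0.

Let w0 n : 0 < w n. Proof. exact: lt_le_trans ltr01 (w1 n). Qed.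
Let v0 n : 0 < v n. Proof. by have /andP[h _] := wv n; exact: lt_le_trans (w0 n) h. Qed.

Let apply_bound (x : nat -> R[i]) (M : R) n : 0 <= M -> H n ->
  (forall m, normc (x m) <= M / v m ^+ J0) ->
  has_sum (fun m => K n m * x m) (csum (fun m => K n m * x m)) /\
  normc (csum (fun m => K n m * x m)) <= M * (1 / 2) / v n ^+ J0.
Proof.
move=> M0 Hn xM; apply: (normc_csum_le (b := fun m => M * (normc (K n m) / v m ^+ J0))).
  move=> m; rewrite Normc.normcM mulrCA ler_wpM2l ?normc_ge0 //.
move=> N; rewrite /series /= -mulr_sumr -mulrA -mulrA ler_wpM2l //.
by have := K_small N Hn; rewrite -mulrA.
Qed.

(** The hypothesis [K_small] makes [K] a contraction on the rows of [H] in one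
    weighted sup norm, so that the Neumann series solves the system there. The
    solution is a priori no better than this norm allows, but [x = u - K x] and
    the smoothing property of [K] gain one power of the weight at a time. The
    weight [v] of the contraction is comparable with [w], and may be larger than
    [w] at indices where the row sums are not small in terms of [w]. *)
Lemma neumann_solve (u : nat -> R[i]) : rapid_seq w u ->
  exists x : nat -> R[i], [/\ rapid_seq w x, forall n, ~~ H n -> x n = 0 &
    forall n, H n -> exists2 y, has_sum (fun m => K n m * x m) y & x n + y = u n].
Proof.
move=> u_rapid.
have [Mu hMu] := u_rapid J0.
pose M := `|Mu| * R1 ^+ J0.
have R10 : 0 <= R1.
  have /andP[_ h] := wv 0; have := le_trans (ltW (v0 0)) h.
  by rewrite pmulr_lge0.
have M0 : 0 <= M by rewrite mulr_ge0 // exprn_ge0.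
have uM n : normc (u n) <= M / v n ^+ J0.
  rewrite ler_pdivlMr ?exprn_gt0 // /M.
  apply: (@le_trans _ _ (normc (u n) * (R1 * w n) ^+ J0)).
    rewrite ler_wpM2l ?normc_ge0 // lerXn2r ?nnegrE ?(ltW (v0 n)) ?mulr_ge0 ?(ltW (w0 n)) //.
    by have /andP[] := wv n.
  rewrite exprMn mulrCA mulrC ler_wpM2r ?exprn_ge0 //.
  by apply: le_trans (hMu n) _; exact: ler_norm.
(* [d k] is the term [(- K) ^ k u], the rows outside [H] being discarded *)
pose d := fix d k n := match k with
  | 0 => if H n then u n else 0
  | k'.+1 => if H n then - csum (fun m => K n m * d k' m) else 0 end.
have dM k n : normc (d k n) <= M * (1 / 2) ^+ k / v n ^+ J0.
  elim: k n => [|k ih] n /=.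
    rewrite expr0 mulr1; case: ifP => _; first exact: uM.
    by rewrite Normc.normc0 divr_ge0 ?exprn_ge0 // ltW.
  case: ifP => [Hn|_].
    have Mk0 : 0 <= M * (1 / 2) ^+ k by rewrite mulr_ge0 // exprn_ge0 // divr_ge0.
    have [_ hb] := apply_bound (x := d k) Mk0 Hn ih.
    by rewrite (@normcN R) exprSr [M * _]mulrA.
  rewrite Normc.normc0 mulr_ge0 ?invr_ge0 ?exprn_ge0 ?(ltW (v0 n)) //.
  by rewrite mulr_ge0 // exprn_ge0 // divr_ge0.
pose x n := csum (fun k => d k n).
pose P N n := \sum_(0 <= k < N) d k n.
have eM N n : normc (x n - P N n) <= 4 * M * (1 / 2) ^+ N / v n ^+ J0.
  have c0 : 0 <= M / v n ^+ J0 by rewrite divr_ge0 // exprn_ge0 // ltW.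
  have := @csum_half_tail (fun k => d k n) _ N c0.
  rewrite (_ : 4 * (M / v n ^+ J0) * (1 / 2) ^+ N = 4 * M * (1 / 2) ^+ N / v n ^+ J0); last by ring.
  by apply=> k; rewrite mulrAC; exact: dM.
have xM n : normc (x n) <= 4 * M / v n ^+ J0.
  by have := eM 0 n; rewrite /P big_geq // subr0 expr0 mulr1.
have xH n : ~~ H n -> x n = 0.
  move=> /negbTE Hn; apply: (has_sum_unique (u := fun k => d k n)).
    have b0 k : normc (d k n) <= 0 by case: k => [|k] /=; rewrite Hn Normc.normc0.
    apply: (has_sum_csum (b := fun=> 0) b0 (B := 0)) => N.
    by rewrite /series /= big1.
  apply: cvg_near_cst; apply: nearW => N; rewrite big1 ?subrr ?Normc.normc0 //.
  by move=> [|k] _ /=; rewrite Hn.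
have xE n : H n -> exists2 y, has_sum (fun m => K n m * x m) y & x n + y = u n.
  move=> Hn; have M40 : 0 <= 4 * M by rewrite mulr_ge0.
  have [hs _] := apply_bound M40 Hn xM.
  exists (csum (fun m => K n m * x m)) => //; set y := csum _ in hs *.
  have hP N : has_sum (fun m => K n m * P N m) (u n - P N.+1 n).
    elim: N => [|N ih].
      rewrite /P big_nat1 /= Hn subrr.
      have := @has_sum_single R (fun=> 0) 0 (fun _ _ => erefl).
      congr has_sum; apply/funext => m; by rewrite big_geq // mulr0.
    have [hd _] := apply_bound (x := d N) (M := M * (1 / 2) ^+ N)
      ltac:(by rewrite mulr_ge0 // exprn_ge0 // divr_ge0) Hn (dM N).
    have := has_sumD ih hd.
    rewrite (_ : (fun m => _) = (fun m => K n m * P N.+1 m)); last first.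
      by apply/funext => m; rewrite -mulrDr /P big_nat_recr.
    congr has_sum; rewrite /P [in RHS]big_nat_recr //= Hn.
    by rewrite opprD opprK addrA.
  apply/eqP; rewrite -subr_eq0; apply/eqP/Normc.eq0_normc.
  pose c := 8 * M / v n ^+ J0.
  have small N : normc (x n + y - u n) <= c * (1 / 2) ^+ N.
    have MN0 : 0 <= 4 * M * (1 / 2) ^+ N by rewrite mulr_ge0 // exprn_ge0 // divr_ge0.
    have [he heM] := apply_bound MN0 Hn (eM N).
    have yE : y = u n - P N.+1 n + csum (fun m => K n m * (x m - P N m)).
      apply: (has_sum_unique hs); have := has_sumD (hP N) he.
      by congr has_sum; apply/funext => m; rewrite -mulrDr addrC subrK.
    rewrite (_ : x n + y - u n = (x n - P N.+1 n) + csum (fun m => K n m * (x m - P N m))); last first.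
      by rewrite yE; ring.
    apply: le_trans (normcD _ _) _.
    have := eM N.+1 n; rewrite exprSr => h1.
    have -> : c * (1 / 2) ^+ N = 4 * M * ((1 / 2) ^+ N * (1 / 2)) / v n ^+ J0 +
        4 * M * (1 / 2) ^+ N * (1 / 2) / v n ^+ J0 + 4 * M * (1 / 2) ^+ N / v n ^+ J0.
      by rewrite /c; field; rewrite expf_neq0 // gt_eqF.
    rewrite -[leLHS]addr0; apply: lerD; first exact: lerD.
    by rewrite divr_ge0 // exprn_ge0 // ltW.
  have h : normc (x n + y - u n) @[N --> \oo] --> (0 : R).
    by apply: squeeze0 (half_pow_cvg0 c) => N; rewrite normc_ge0 small.
  by apply: (cvg_unique _ (cvg_cst _) h).
exists x; split=> //.
(* each step of this induction uses the equation once *)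
have boot i : exists Mi : R, 0 <= Mi /\ forall n, normc (x n) * w n ^+ (J0 + i) <= Mi.
  elim: i => [|i [Mi [Mi0 hi]]].
    exists (4 * M); split; first by rewrite mulr_ge0.
    move=> n; rewrite addn0 -ler_pdivlMr ?exprn_gt0 //; apply: le_trans (xM n) _.
    apply: ler_wpM2l; first by rewrite mulr_ge0.
    rewrite lef_pV2 ?posrE ?exprn_gt0 //.
    by rewrite lerXn2r ?nnegrE ?(ltW (w0 n)) ?(ltW (v0 n)) //; have /andP[] := wv n.
  have [C hC] := K_smoothing (leq_addr i J0).
  have [Mu' hu'] := u_rapid (J0 + i.+1)%N.
  have S0 : 0 <= S.
    by apply: le_trans (w_sum 0); rewrite /series /= big_geq.
  exists (`|Mu'| + `|C| * Mi * S); split.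
    by rewrite addr_ge0 // !mulr_ge0.
  move=> n; have [Hn|Hn] := boolP (H n); last first.
    by rewrite xH // Normc.normc0 mul0r addr_ge0 // !mulr_ge0.
  have [y hy xy] := xE n Hn.
  have -> : x n = u n + (- y) by rewrite -xy addrK.
  apply: (@le_trans _ _ (normc (u n) * w n ^+ (J0 + i.+1) + normc y * w n ^+ (J0 + i.+1))).
    rewrite -mulrDl ler_wpM2r ?exprn_ge0 ?(ltW (w0 n)) //.
    by rewrite -[normc y](@normcN R); exact: normcD.
  apply: lerD; first by apply: le_trans (hu' n) _; exact: ler_norm.
  rewrite -ler_pdivlMr ?exprn_gt0 //; apply: (normc_has_sum_le hy) => N.
  rewrite ler_pdivlMr ?exprn_gt0 // mulr_suml.
  apply: (@le_trans _ _ (\sum_(0 <= m < N) `|C| * Mi * (w m ^+ s0)^-1)); last first.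
    by rewrite -mulr_sumr ler_wpM2l ?mulr_ge0 //; exact: w_sum.
  apply: ler_sum => m _; rewrite Normc.normcM ler_pdivlMr ?exprn_gt0 //.
  have -> : normc (K n m) * normc (x m) * w n ^+ (J0 + i.+1) * w m ^+ s0 =
     normc (K n m) * w n ^+ (J0 + i).+1 * w m ^+ s0 * normc (x m).
    by rewrite addnS; ring.
  apply: (@le_trans _ _ (C * w m ^+ (J0 + i) * normc (x m))).
    by rewrite ler_wpM2r ?normc_ge0.
  rewrite -mulrA [w m ^+ _ * _]mulrC; apply: (@le_trans _ _ (`|C| * (normc (x m) * w m ^+ (J0 + i)))).
    by rewrite ler_wpM2r ?ler_norm // mulr_ge0 ?normc_ge0 ?exprn_ge0 ?ltW.
  by rewrite ler_wpM2l.
move=> j; have [Mj [_ hj]] := boot j; exists Mj => n; apply: le_trans (hj n).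
by rewrite ler_wpM2l ?normc_ge0 // ler_weXn2l // leq_addl.
Qed.

End neumann.

(** * Packing bounds for separated sets *)

Section packing.
Variables (R : realType) (d : nat).
Local Notation V := 'rV[R]_d.
Implicit Types (x y a : V) (A : set V) (p de : R).

(** Disjointness of the balls is only used through this lower bound on the
    distances, which is easier to check when points are added. *)
Definition separated p de A : Prop := forall a a' : V, A a -> A a' -> a != a' ->
  de * jbracket a `^ (- p) <= enorm (a' - a).

Lemma enorm0 : enorm (0 : V) = 0.
Proof. by rewrite /enorm /dotp big1 ?sqrtr0 // => i _; rewrite mxE mul0r. Qed.

Lemma jbracket_gt0 x : 0 < jbracket x.
Proof. exact: lt_le_trans ltr01 (jbracket_ge1 x). Qed.

Lemma ball_separatedP p de A : 0 < de -> ball_separated p de A -> separated p de A.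
Proof.
move=> de0 sA a a' Aa Aa' /eqP aa'; rewrite leNgt; apply/negP => lt.
apply: aa'; apply: sA => //; exists a'; split=> //.
by rewrite /eball /= subrr enorm0 mulr_gt0 // powR_gt0 // jbracket_gt0.
Qed.

Lemma separated_le p de de' A : de' <= de -> separated p de A -> separated p de' A.
Proof.
move=> dd sA a a' Aa Aa' aa'; apply: le_trans (sA a a' Aa Aa' aa').
by rewrite ler_wpM2r // powR_ge0.
Qed.

Lemma coord_le_jbracket x i : `|x 0 i| <= jbracket x.
Proof.
rewrite -(@ler_pXn2r _ 2) ?nnegrE ?(ltW (jbracket_gt0 x)) //.
by rewrite real_normK ?num_real // jbracket2 (le_trans (coord_sqr_le x i)) // lerDr.
Qed.

Lemma enorm_le_coord x (h : R) : 0 <= h -> (forall i, `|x 0 i| <= h) -> enorm x <= d%:R * h.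
Proof.
move=> h0 xh; have dh0 : 0 <= d%:R * h by rewrite mulr_ge0.
rewrite -[leRHS](ger0_norm dh0) -sqrtr_sqr ler_sqrt ?sqr_ge0 // exprMn.
apply: (@le_trans _ _ (\sum_(i < d) h ^+ 2)).
  by apply: ler_sum => i _; rewrite -expr2 -real_normK ?num_real // lerXn2r // nnegrE.
rewrite sumr_const card_ord -[leLHS]mulr_natl ler_wpM2r ?sqr_ge0 //.
rewrite expr2 -natrM ler_nat; case: (d) => // n; exact: leq_pmulr.
Qed.

Section cells.
Variables (p de : R) (P m : nat).
Hypotheses (de0 : 0 < de) (pP : p <= P%:R) (m_gt : d%:R / de < m%:R).

Let m0 : 0 < m%:R :> R.
Proof. by apply: le_lt_trans m_gt; rewrite divr_ge0 // ltW. Qed.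

Definition shell (a : V) : nat := (Num.truncn (jbracket a)).+1.

Lemma shell_bounds a : jbracket a < (shell a)%:R <= 2 * jbracket a.
Proof.
have h := truncn_itv (ltW (jbracket_gt0 a)); case/andP: h => h1 h2.
rewrite h2 /= /shell -natr1 mulr_natl mulr2n; apply: lerD => //.
exact: jbracket_ge1.
Qed.

(** The position of [a] in a mesh of width [1 / (m N ^ P)], where [N] is its
    shell; the coordinates are shifted by [N] to be nonnegative before
    truncation. *)
Definition cell (a : V) (i : 'I_d) : nat :=
  Num.truncn ((a 0 i + (shell a)%:R) * (m * shell a ^ P)%:R).

Let mesh_gt0 a : 0 < (m * shell a ^ P)%:R :> R.
Proof. by rewrite natrM mulr_gt0 // ltr0n expn_gt0. Qed.

Let shifted_ge0 a i : 0 <= (a 0 i + (shell a)%:R) * (m * shell a ^ P)%:R.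
Proof.
rewrite mulr_ge0 ?(ltW (mesh_gt0 a)) //.
have := coord_le_jbracket a i; rewrite ler_norml => /andP[h _].
have /andP[h2 _] := shell_bounds a; lra.
Qed.

Lemma cell_lt a i : (cell a i < (2 * (m * shell a ^ P.+1)).+1)%N.
Proof.
rewrite /cell truncn_lt_nat ?shifted_ge0 //.
apply: (@le_lt_trans _ _ (2 * (shell a)%:R * (m * shell a ^ P)%:R)).
  rewrite ler_wpM2r ?(ltW (mesh_gt0 a)) //.
  have := coord_le_jbracket a i; rewrite ler_norml => /andP[_ h].
  have /andP[h2 _] := shell_bounds a; lra.
by rewrite -!natrM ltr_nat ltnS expnS -mulnA [(shell a * _)%N]mulnCA.
Qed.

(** The mesh on the shell [N] is finer than the separation, which is at least
    [de N ^ -p] there. *)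
Lemma cell_inj A a a' : separated p de A -> A a -> A a' ->
  shell a = shell a' -> cell a =1 cell a' -> a = a'.
Proof.
move=> sA Aa Aa' ss cc; apply/eqP; apply: contraT => aa'.
have := sA a a' Aa Aa' aa'; rewrite leNgt => /negP[].
pose h : R := ((m * shell a ^ P)%:R)^-1.
have h0 : 0 < h by rewrite invr_gt0 mesh_gt0.
apply: (@le_lt_trans _ _ (d%:R * h)).
  apply: enorm_le_coord (ltW h0) _ => i; rewrite !mxE.
  have h1 := truncn_itv (shifted_ge0 a i); have h2 := truncn_itv (shifted_ge0 a' i).
  have := cc i; rewrite /cell => e.
  rewrite -/(cell a i) in h1; rewrite -ss in h2 e; rewrite /cell -e in h2 h1.
  set T := (Num.truncn _) in h1 h2.
  have e3 : (a' 0 i - a 0 i) * (m * shell a ^ P)%:R =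
     (a' 0 i + (shell a)%:R) * (m * shell a ^ P)%:R -
     (a 0 i + (shell a)%:R) * (m * shell a ^ P)%:R by ring.
  rewrite -[leRHS]div1r ler_pdivlMr ?mesh_gt0 // -[X in _ * X](gtr0_norm (mesh_gt0 a)) -normrM e3.
  case/andP: h1 => l1 u1; case/andP: h2 => l2 u2; rewrite -natr1 in u1 u2.
  by rewrite ler_norml; apply/andP; split; lra.
have /andP[sl su] := shell_bounds a.
have s0 : 0 < (shell a)%:R :> R by rewrite ltr0n.
apply: (@lt_le_trans _ _ (de * ((shell a)%:R ^+ P)^-1)).
  rewrite /h natrM natrX invfM mulrA.
  rewrite ltr_pM2r ?invr_gt0 ?exprn_gt0 //.
  by rewrite ltr_pdivrMr // mulrC -ltr_pdivrMr.
rewrite ler_wpM2l ?(ltW de0) // powRN lef_pV2 ?posrE ?powR_gt0 ?jbracket_gt0 ?exprn_gt0 //.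
apply: (@le_trans _ _ (jbracket a `^ P%:R)); first by rewrite ler_powR ?jbracket_ge1.
rewrite powR_mulrn ?(ltW (jbracket_gt0 a)) // lerXn2r ?nnegrE ?(ltW sl) //.
  exact: ltW (jbracket_gt0 a).
Qed.

Definition cell_code (a : V) : nat := pickle (shell a, [ffun i => cell a i]).

Lemma cell_code_inj A a a' : separated p de A -> A a -> A a' ->
  cell_code a = cell_code a' -> a = a'.
Proof.
move=> sA Aa Aa' /(pcan_inj pickleK)[ss /ffunP cc].
have e : cell a =1 cell a' by move=> i; have := cc i; rewrite !ffunE.
exact: (cell_inj sA Aa Aa' (congr1 succn ss) e).
Qed.

Lemma shell_count A (l : seq V) N : separated p de A -> uniq l ->
  (forall a, a \in l -> A a) ->
  (count (fun a => shell a == N) l <= (2 * (m * N ^ P.+1)).+1 ^ d)%N.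
Proof.
move=> sA ul lA; pose B := (2 * (m * N ^ P.+1)).+1.
pose f (a : V) : {ffun 'I_d -> 'I_B} := [ffun i => inord (cell a i)].
rewrite -size_filter -(size_map f).
have -> : (B ^ d = #|{: {ffun 'I_d -> 'I_B}}|)%N by rewrite card_ffun !card_ord.
have uf : uniq (map f [seq a <- l | shell a == N]).
  rewrite map_inj_in_uniq ?filter_uniq // => a a'.
  rewrite !mem_filter => /andP[/eqP sa la] /andP[/eqP sa' la'] /ffunP ff.
  apply: (cell_inj sA (lA _ la) (lA _ la') _) => [|i]; first by rewrite sa sa'.
  have := congr1 val (ff i); rewrite !ffunE /= !inordK //.
    by rewrite /B -sa'; exact: cell_lt.
  by rewrite /B -sa; exact: cell_lt.
by rewrite -(card_uniqP uf) max_card.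
Qed.

End cells.

Lemma sum_inv_sqr_le M : \sum_(0 <= N < M) (N%:R ^+ 2)^-1 <= 2 :> R.
Proof.
have h n : \sum_(0 <= N < n.+2) (N%:R ^+ 2)^-1 <= 2 - (n.+1)%:R^-1 :> R.
  elim: n => [|n ih].
    by rewrite !big_nat_recr ?big_geq //= expr0n /= invr0 expr1n invr1; lra.
  rewrite big_nat_recr //=; apply: le_trans (lerD ih (lexx _)) _.
  rewrite -[(n.+2)%:R]natr1; set t := (n.+1)%:R : R; have t1 : 1 <= t by rewrite ler1n.
  rewrite -addrA lerD2l -subr_ge0.
  have -> : - (t + 1)^-1 - (- t^-1 + ((t + 1) ^+ 2)^-1) = 1 / (t * (t + 1) ^+ 2).
    by field; apply/andP; split; lra.
  by rewrite divr_ge0 // mulr_ge0 ?exprn_ge0 //; lra.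
apply: le_trans (_ : \sum_(0 <= N < M.+2) (N%:R ^+ 2)^-1 <= _); last first.
  by apply: le_trans (h M) _; rewrite gerBl invr_ge0.
by rewrite !big_nat_recr //= -addrA lerDl addr_ge0 // invr_ge0 exprn_ge0.
Qed.

(** The number of points on the shell [N] is at most polynomial in [N], with a
    bound that depends on [p], [de] and the dimension only; a high negative power
    of the bracket compensates for it. *)
Lemma separated_sum p de : 0 < de -> exists (s : nat) (S : R),
  forall A (l : seq V), separated p de A -> uniq l -> (forall a, a \in l -> A a) ->
  \sum_(a <- l) (jbracket a ^+ s)^-1 <= S.
Proof.
move=> de0; pose P := (Num.truncn p).+1; pose m := (Num.truncn (d%:R / de)).+1.
have pP : p <= P%:R by apply: ltW; exact: truncnS_gt.
have m_gt : d%:R / de < m%:R by exact: truncnS_gt.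
pose D := (P.+1 * d)%N.
(* the shell [N] has O(N ^ D) cells; two more powers make the sum converge *)
exists (D + 2)%N, (2 ^+ (D + 2) * (3 * m)%:R ^+ d * 2) => A l sA ul lA.
pose M := (\max_(a <- l) shell a).+1.
pose F (N : nat) : R := (2 / N%:R) ^+ (D + 2).
apply: (@le_trans _ _ (\sum_(a <- l) F (shell a))).
  apply: ler_sum => a _; rewrite /F -exprVn.
  have /andP[_ h] := shell_bounds a; have j0 := jbracket_gt0 a.
  rewrite lerXn2r ?nnegrE ?invr_ge0 ?(ltW j0) ?divr_ge0 //.
  rewrite ler_pdivlMr ?ltr0n // mulrC ler_pdivrMr //.
apply: (@le_trans _ _ (\sum_(0 <= N < M) \sum_(a <- l) if shell a == N then F N else 0)).
  rewrite exchange_big /= big_seq [leRHS]big_seq; apply: ler_sum => a la.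
  rewrite (bigD1_seq (shell a)) ?iota_uniq //= ?eqxx ?lerDl ?sumr_ge0 //.
    by move=> N _; case: ifP => // _; rewrite exprn_ge0 // divr_ge0.
  rewrite mem_index_iota /= /M ltnS; exact: leq_bigmax_seq.
have cnt N : \sum_(a <- l) (if shell a == N then F N else 0) =
    F N *+ count (fun a => shell a == N) l.
  by rewrite -big_mkcond /= big_const_seq iter_addr_0.
apply: (@le_trans _ _ (\sum_(0 <= N < M) 2 ^+ (D + 2) * (3 * m)%:R ^+ d * (N%:R ^+ 2)^-1)); last first.
  by rewrite -mulr_sumr ler_wpM2l ?sum_inv_sqr_le // mulr_ge0 // exprn_ge0.
apply: ler_sum => N _; rewrite cnt; case: N => [|N].
  by rewrite /F invr0 mulr0 expr0n addn2 /= mul0rn expr0n /= invr0 mulr0.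
have := shell_count de0 pP m_gt N.+1 sA ul lA.
set cN := count _ _ => hc; set n := N.+1 in cN hc *.
have n0 : 0 < n%:R :> R by rewrite ltr0n.
apply: (@le_trans _ _ (F n * ((3 * m)%:R ^+ d * n%:R ^+ D))).
  rewrite -[leLHS]mulr_natr; apply: ler_wpM2l; first by rewrite exprn_ge0 // divr_ge0.
  rewrite /D exprM -exprMn -natrX -natrM -natrX ler_nat.
  apply: leq_trans hc _; case: (d) => [//|d']; rewrite leq_exp2r //.
  have hm : (0 < m * n ^ P.+1)%N by rewrite muln_gt0 expn_gt0.
  rewrite -[(3 * m * _)%N]mulnA [(3 * _)%N]mulSn addnC -addn1 leq_add2l //.
have e : (n%:R ^+ (D + 2))^-1 * n%:R ^+ D = (n%:R ^+ 2)^-1 :> R.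
  by rewrite exprD invfM mulrAC mulVf ?mul1r // expf_neq0 // gt_eqF.
by rewrite -e /F exprMn exprVn mulrACA.
Qed.

End packing.

(** * Decay of the interaction of two waves *)

Section entry_bounds.
Variables (R : realType) (d : nat).
Local Notation V := 'rV[R]_d.
Implicit Types (x y : V).

Lemma jbracket_powR_le x (r s : R) : r <= s -> jbracket x `^ r <= jbracket x `^ s.
Proof. by move=> rs; rewrite ler_powR // jbracket_ge1. Qed.

Lemma jbracket_powR_ge1 x (r : R) : 0 <= r -> 1 <= jbracket x `^ r.
Proof. by move=> r0; rewrite -(powRr0 (jbracket x)) jbracket_powR_le. Qed.

Lemma powR_exprn (a r : R) n : (a `^ r) ^+ n = a `^ (r * n%:R).
Proof. by rewrite powRrM powR_mulrn // powR_ge0. Qed.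

Lemma jbracket_powRD x (r s : R) : jbracket x `^ (r + s) = jbracket x `^ r * jbracket x `^ s.
Proof. by rewrite powRD // (gt_eqF (jbracket_gt0 x)) implybT. Qed.

Lemma pi_ge1 : 1 <= pi :> R.
Proof. by have := pi_ge2 R; lra. Qed.

(** The transform of a bump of width [r] around [x] is negligible beyond [1 / r],
    that is, at points [y] whose bracket is much larger than [jbracket x `^ e].
    In terms of the weights [jbracket x `^ sqrt e] and [jbracket y `^ sqrt t],
    this means that the second one is much larger than the power [sqrt (e * t)]
    of the first one. This exponent is less than 1, and the condition on [J]
    then leaves one power of the weight to gain. *)
Lemma cross_entry_bound (eta e t : R) (s0 J : nat) : 0 < eta <= 1 -> 0 < e -> 0 < t ->
  Num.sqrt (e * t) * J.+1%:R + s0%:R <= J%:R ->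
  exists C : R, forall x y (r : R), r = eta * jbracket x `^ (- e) ->
    expR (- (pi * r ^+ 2 * dotp y y)) *
      (jbracket y `^ Num.sqrt t) ^+ J.+1 * (jbracket x `^ Num.sqrt e) ^+ s0 <=
    C * (jbracket x `^ Num.sqrt e) ^+ J.
Proof.
move=> /andP[eta0 eta1] e0 t0 hJ.
pose A := Num.sqrt t * J.+1%:R; have A0 : 0 <= A by rewrite mulr_ge0 ?sqrtr_ge0.
pose k := (Num.truncn A).+1; have Ak : A <= k%:R by apply: ltW; exact: truncnS_gt.
exists (k`!%:R * expR 1 * eta `^ (- A)) => x y r rE.
have r0 : 0 < r by rewrite rE mulr_gt0 // powR_gt0 // jbracket_gt0.
have jx := jbracket_gt0 x; have jy := jbracket_gt0 y.
have r1 : r <= 1.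
  rewrite rE -[1]mulr1 ler_pM ?(ltW eta0) ?powR_ge0 //.
  by rewrite -(powRr0 (jbracket x)) jbracket_powR_le // oppr_le0 ltW.
set z := r ^+ 2 * dotp y y; have z0 : 0 <= z by rewrite mulr_ge0 ?sqr_ge0 ?dotp_ge0.
have ry : r * jbracket y <= 1 + z.
  have h : (r * jbracket y) ^+ 2 <= 1 + z.
    rewrite exprMn jbracket2 mulrDr mulr1 lerD2r.
    by rewrite expr_le1 // ltW.
  have := sqr_ge0 (r * jbracket y - 1); rewrite !expr2 in h *; nra.
have main : expR (- (pi * r ^+ 2 * dotp y y)) * (r * jbracket y) `^ A <= k`!%:R * expR 1.
  apply: le_trans (exprD1_expRN_le k z0).
  rewrite mulrC; apply: ler_pM; rewrite ?powR_ge0 ?expR_ge0 //.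
    apply: (@le_trans _ _ ((1 + z) `^ A)).
      by rewrite ge0_ler_powR // nnegrE ?addr_ge0 // mulr_ge0 // ltW.
    by rewrite -powR_mulrn ?addr_ge0 // ler_powR // lerDl.
  by rewrite ler_expR lerN2 -mulrA -/z ler_peMl // pi_ge1.
have yA : jbracket y `^ A = (r * jbracket y) `^ A * (eta `^ (- A) * jbracket x `^ (e * A)).
  rewrite rE !powRM ?mulr_ge0 ?powR_ge0 ?(ltW jy) ?(ltW eta0) //.
  rewrite -!powRrM mulNr !powRN.
  have h1 : eta `^ A != 0 by rewrite gt_eqF // powR_gt0.
  have h2 : jbracket x `^ (e * A) != 0 by rewrite gt_eqF // powR_gt0.
  by field; apply/andP.
rewrite !powR_exprn -/A yA.
rewrite [leLHS](_ : _ = expR (- (pi * r ^+ 2 * dotp y y)) * (r * jbracket y) `^ A * eta `^ (- A) *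
   (jbracket x `^ (e * A) * jbracket x `^ (Num.sqrt e * s0%:R))); last by ring.
rewrite -jbracket_powRD; apply: ler_pM; rewrite ?mulr_ge0 ?powR_ge0 ?expR_ge0 //.
  by rewrite ler_wpM2r ?powR_ge0.
apply: jbracket_powR_le.
have -> : e * A + Num.sqrt e * s0%:R =
    Num.sqrt e * (Num.sqrt (e * t) * J.+1%:R + s0%:R).
  rewrite sqrtrM ?(ltW e0) // /A mulrDr; congr (_ + _).
  by rewrite -{1}(sqr_sqrtr (ltW e0)); ring.
by rewrite ler_wpM2l ?sqrtr_ge0.
Qed.

(** The width [r] of the bump at [x] is smaller than the separation by a factor
    [jbracket x `^ (e - e')], so that the bump is negligible to all orders at the
    other points of the same set. *)
Lemma same_entry_bound (e e' : R) (s0 J : nat) : 0 < e' < e ->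
  exists C : R, forall (eta de : R) x y (r : R), 0 < eta <= 1 -> eta <= de ->
    r = eta * jbracket x `^ (- e) ->
    de * jbracket x `^ (- e') <= enorm (y - x) ->
    expR (- (pi * dotp (y - x) (y - x) / r ^+ 2)) *
      (jbracket y `^ Num.sqrt e) ^+ J.+1 * (jbracket x `^ Num.sqrt e) ^+ s0 <=
    C * (jbracket x `^ Num.sqrt e) ^+ J.
Proof.
move=> /andP[e'0 ee'].
have e0 : 0 < e by exact: lt_trans e'0 ee'.
pose s := Num.sqrt e; have s_ge0 : 0 <= s by exact: sqrtr_ge0.
pose a := (Num.truncn (s * J.+1%:R)).+1; pose b := (Num.truncn (s * s0%:R)).+1.
have sa : s * J.+1%:R <= a%:R by apply: ltW; exact: truncnS_gt.
have sb : s * s0%:R <= b%:R by apply: ltW; exact: truncnS_gt.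
pose ep := 2 * (e - e'); have ep0 : 0 < ep by rewrite mulr_gt0 // subr_gt0.
(* as [jbracket x `^ ep <= z] below, [k] powers of [1 + z] absorb those of the
   bracket of [x] *)
pose k := (Num.truncn ((2 * a + b)%:R / ep)).+1.
have kP : (2 * a + b)%:R <= ep * k%:R.
  by rewrite mulrC -ler_pdivrMr //; apply: ltW; exact: truncnS_gt.
exists (2 ^+ a * ((a + k)`!%:R * expR 1)) => eta de x y r /andP[eta0 eta1] etade rE sep.
have jx := jbracket_gt0 x; have jy := jbracket_gt0 y.
have jx1 := jbracket_ge1 x; have jy1 := jbracket_ge1 y.
have r0 : 0 < r by rewrite rE mulr_gt0 // powR_gt0.
have r1 : r <= 1.
  rewrite rE -[1]mulr1 ler_pM ?(ltW eta0) ?powR_ge0 //.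
  by rewrite -(powRr0 (jbracket x)) jbracket_powR_le // oppr_le0 ltW.
set D := dotp (y - x) (y - x); have D0 : 0 <= D by exact: dotp_ge0.
set z := D / r ^+ 2; have z0 : 0 <= z by rewrite divr_ge0 // sqr_ge0.
have Dz : D <= z.
  by rewrite ler_pdivlMr ?exprn_gt0 // ler_piMr // expr_le1 // ltW.
have zx : jbracket x `^ ep <= z.
  rewrite ler_pdivlMr ?exprn_gt0 //.
  have -> : jbracket x `^ ep * r ^+ 2 = eta ^+ 2 * (jbracket x `^ (- e')) ^+ 2.
    rewrite rE exprMn !powR_exprn mulrCA -jbracket_powRD /ep.
    by congr (_ * _ `^ _); ring.
  have -> : D = enorm (y - x) ^+ 2 by rewrite /enorm sqr_sqrtr.
  rewrite -exprMn lerXn2r ?nnegrE ?sqrtr_ge0 ?mulr_ge0 ?powR_ge0 ?(ltW eta0) //.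
  by apply: le_trans sep; rewrite ler_wpM2r ?powR_ge0.
have hy : jbracket y <= 2 * jbracket x ^+ 2 * (1 + z).
  apply: (@le_trans _ _ (jbracket y ^+ 2)); first by rewrite expr2 ler_peMl // ltW.
  apply: le_trans (jbracket_shift y x) _.
  apply: ler_wpM2l; first by rewrite mulr_ge0 // sqr_ge0.
  by rewrite lerD2l.
have hya : jbracket y `^ (s * J.+1%:R) <= (2 * jbracket x ^+ 2 * (1 + z)) ^+ a.
  apply: le_trans (jbracket_powR_le y sa) _; rewrite powR_mulrn ?(ltW jy) //.
  rewrite lerXn2r ?nnegrE ?(ltW jy) //.
  by rewrite mulr_ge0 ?addr_ge0 // mulr_ge0 ?sqr_ge0.
have hxb : jbracket x `^ (s * s0%:R) <= jbracket x ^+ b.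
  by apply: le_trans (jbracket_powR_le x sb) _; rewrite powR_mulrn ?(ltW jx).
have hx : jbracket x ^+ (2 * a + b) <= (1 + z) ^+ k.
  rewrite -powR_mulrn ?(ltW jx) //; apply: le_trans (jbracket_powR_le x kP) _.
  rewrite -powR_exprn lerXn2r ?nnegrE ?powR_ge0 ?addr_ge0 //.
  by apply: le_trans zx _; rewrite lerDr.
rewrite !powR_exprn -/s.
have J1 : 1 <= jbracket x `^ (s * J%:R) by rewrite jbracket_powR_ge1 // mulr_ge0.
apply: (@le_trans _ _ (2 ^+ a * ((a + k)`!%:R * expR 1))); last first.
  by rewrite ler_peMr // mulr_ge0 ?exprn_ge0 // mulr_ge0 // expR_ge0.
apply: (@le_trans _ _ (expR (- z) * (2 * jbracket x ^+ 2 * (1 + z)) ^+ a * jbracket x ^+ b)).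
  apply: ler_pM; rewrite ?mulr_ge0 ?powR_ge0 ?expR_ge0 //.
  apply: ler_pM; rewrite ?powR_ge0 ?expR_ge0 //.
  by rewrite ler_expR lerN2 -mulrA -/z ler_peMl // pi_ge1.
rewrite [leLHS](_ : _ = 2 ^+ a * (jbracket x ^+ (2 * a + b) * (1 + z) ^+ a * expR (- z))); last first.
  rewrite !exprMn exprD mul2n -addnn exprD.
  set u1 := jbracket x ^+ a; set u2 := (1 + z) ^+ a; set u3 := jbracket x ^+ b.
  by set u4 := 2 ^+ a; ring.
rewrite ler_wpM2l ?exprn_ge0 //; apply: le_trans (exprD1_expRN_le (a + k) z0).
apply: ler_wpM2r; first exact: expR_ge0.
rewrite [leRHS]exprD [leRHS]mulrC; apply: ler_wpM2r hx.
by rewrite exprn_ge0 // addr_ge0.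
Qed.

End entry_bounds.

(** * The linear system of the wave coefficients *)

Section system.
Variables (R : realType) (d : nat).
Local Open Scope complex_scope.
Local Notation normc := Normc.normc.
Local Notation V := 'rV[R]_d.
Variables (p1 q1 eta : R) (A B : set V) (codeA codeB : V -> nat).
Hypotheses (p1_gt0 : 0 < p1) (q1_gt0 : 0 < q1) (eta01 : 0 < eta <= 1).
Hypothesis codeA_inj : forall a a', A a -> A a' -> codeA a = codeA a' -> a = a'.
Hypothesis codeB_inj : forall b b', B b -> B b' -> codeB b = codeB b' -> b = b'.

(** The boolean tells in which of the two sets the point is taken, hence whether
    a function or its transform is evaluated there: [true] stands for [A] and
    [false] for [B]. *)
Definition point : Type := (bool * V)%type.
Implicit Types (i j : point).

Definition in_sets i : Prop := if i.1 then A i.2 else B i.2.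
Definition point_code i : nat := pickle (i.1, if i.1 then codeA i.2 else codeB i.2).

Lemma point_code_inj i j : in_sets i -> in_sets j -> point_code i = point_code j -> i = j.
Proof.
case: i j => [[] x] [[] y] xI yI /(pcan_inj pickleK) //= -[] // e; congr pair.
  exact: codeA_inj.
exact: codeB_inj.
Qed.

(** The unknowns are numbered by codes of the points, as the series run over the
    natural numbers. A number that is no code gives a trivial equation. *)
Definition item (n : nat) : option point :=
  match pselect (exists i, in_sets i /\ point_code i = n) with
  | left h => Some (projT1 (cid h))
  | right _ => None
  end.

Lemma item_code i : in_sets i -> item (point_code i) = Some i.
Proof.
move=> iI; rewrite /item; case: pselect => [h|[]]; last by exists i.
by case: (cid h) => j /= [jI e]; congr Some; exact: point_code_inj.
Qed.

Lemma itemP n i : item n = Some i -> in_sets i /\ point_code i = n.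
Proof. by rewrite /item; case: pselect => // h [<-]; exact: (projT2 (cid h)). Qed.

Definition expo (b : bool) : R := if b then p1 else q1.
Definition width i : R := eta * jbracket i.2 `^ (- expo i.1).
(** With these exponents an interaction between the two sets compares the weights
    of its two points in the same way in both directions. *)
Definition weight i : R := jbracket i.2 `^ Num.sqrt (expo i.1).

Lemma expo_gt0 b : 0 < expo b. Proof. by case: b. Qed.
Lemma eta_gt0 : 0 < eta. Proof. by have /andP[] := eta01. Qed.
Lemma width_gt0 i : 0 < width i.
Proof. by rewrite mulr_gt0 ?eta_gt0 // powR_gt0 // jbracket_gt0. Qed.

Lemma width_le_eta i : width i <= eta.
Proof.
rewrite -[leRHS]mulr1 ler_wpM2l ?(ltW eta_gt0) //.
by rewrite -(powRr0 (jbracket i.2)) jbracket_powR_le // oppr_le0 ltW // expo_gt0.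
Qed.

Lemma width_le1 i : width i <= 1.
Proof. by apply: le_trans (width_le_eta i) _; have /andP[] := eta01. Qed.

Lemma weight_ge1 i : 1 <= weight i.
Proof. by rewrite jbracket_powR_ge1 // sqrtr_ge0. Qed.

(** The wave attached to a point is a narrow bump at this point if it is in [A],
    and has a narrow bump at this point as its transform if it is in [B]; in both
    cases the value that belongs to the point is 1. *)
Definition amplitude i : R := if i.1 then 1 else width i ^+ d.
Definition rate i : R := if i.1 then pi / width i ^+ 2 else pi * width i ^+ 2.
Definition centre i : V := if i.1 then i.2 else 0.
Definition frequency i : V := if i.1 then 0 else i.2.
Definition atom i (x : V) : R[i] :=
  (amplitude i)%:C * wave (rate i) (centre i) (frequency i) x.

Definition eval_at i (f : V -> R[i]) : R[i] := if i.1 then f i.2 else fourier f i.2.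

Lemma rate_gt0 i : 0 < rate i.
Proof.
rewrite /rate; case: i.1; first by rewrite divr_gt0 ?pi_gt0 // exprn_gt0 // width_gt0.
by rewrite mulr_gt0 ?pi_gt0 // exprn_gt0 // width_gt0.
Qed.

Lemma amplitude_bounds i : 0 <= amplitude i <= 1.
Proof.
rewrite /amplitude; case: i.1; first by rewrite ler01 lexx.
have w0 := ltW (width_gt0 i).
by rewrite exprn_ge0 // exprn_ile1 // width_le1.
Qed.

Lemma wave_polar al (c om x : V) : wave al c om x =
  (expR (- (al * dotp (x - c) (x - c))))%:C * cis (2 * pi * dotp x om).
Proof.
rewrite /wave; congr (_%:C * _).
rewrite /dotp mulr_sumr -sumrN expR_sum; apply: eq_bigr => i _.
by rewrite /gauss !mxE expr2.
Qed.

Lemma normc_real_cis (r t : R) : 0 <= r -> normc (r%:C * cis t) = r.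
Proof.
move=> r0; rewrite Normc.normcM normc_cis mulr1 /=.
by rewrite expr0n /= addr0 sqrtr_sqr ger0_norm.
Qed.

Lemma dotp0l (x : V) : dotp 0 x = 0.
Proof. by rewrite /dotp big1 // => k _; rewrite mxE mul0r. Qed.
Lemma dotp0r (x : V) : dotp x 0 = 0.
Proof. by rewrite /dotp big1 // => k _; rewrite mxE mulr0. Qed.
Lemma dotpNN (x : V) : dotp (- x) (- x) = dotp x x.
Proof. by rewrite /dotp; apply: eq_bigr => k _; rewrite !mxE mulrNN. Qed.

Lemma cis0 : cis 0 = 1 :> R[i].
Proof. by rewrite /cis cos0 sin0. Qed.

Lemma fourier_atom j xi : fourier (atom j) xi =
  (amplitude j)%:C * fourier (wave (rate j) (centre j) (frequency j)) xi.
Proof.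
rewrite /atom fourierZ //.
exact/schwartz_decayingC/schwartz_wave/rate_gt0.
Qed.

Let width_field (a r D : R) : (a == 0) = false -> (r == 0) = false ->
  [/\ a / (a * r ^+ 2) = r^-1 ^+ 2, a ^+ 2 * D / (a * r ^+ 2) = a * D / r ^+ 2,
      a / (a / r ^+ 2) = r ^+ 2 & a ^+ 2 * D / (a / r ^+ 2) = a * r ^+ 2 * D].
Proof. by move=> a0 r0; split; field; rewrite a0 r0. Qed.

Lemma eval_atom_same b x y : eval_at (b, x) (atom (b, y)) =
  (expR (- (pi * dotp (x - y) (x - y) / width (b, y) ^+ 2)))%:C.
Proof.
have r0 := width_gt0 (b, y); set r := width _ in r0 *.
rewrite /eval_at /=; case: b @r r0 => r r0 /=.
  rewrite /atom /amplitude /rate /centre /frequency /= mul1r wave_polar dotp0r mulr0 cis0 mulr1.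
  by congr (expR (- _))%:C; rewrite -/r; ring.
rewrite fourier_atom /amplitude /rate /centre /frequency /= -/r.
rewrite fourier_wave; last by rewrite mulr_gt0 ?pi_gt0 // exprn_gt0.
rewrite dotp0l mulr0 cis0 mulr1 -rmorphM; congr _%:C.
have [-> _ _ _] := width_field 0 (gt_eqF (pi_gt0 R)) (gt_eqF r0).
rewrite sqrtr_sqr ger0_norm ?invr_ge0 ?(ltW r0) //.
rewrite mulrA -exprMn mulfV ?(gt_eqF r0) //.
rewrite expr1n mul1r -[y - x]opprB dotpNN.
by have [_ -> _ _] := width_field (dotp (x - y) (x - y)) (gt_eqF (pi_gt0 R)) (gt_eqF r0).
Qed.

Lemma normc_eval_atom_cross b x y : normc (eval_at (~~ b, x) (atom (b, y))) =
  width (b, y) ^+ d * expR (- (pi * width (b, y) ^+ 2 * dotp x x)).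
Proof.
have r0 := width_gt0 (b, y); set r := width _ in r0 *.
suff [t ->] : exists t, eval_at (~~ b, x) (atom (b, y)) =
    (r ^+ d * expR (- (pi * r ^+ 2 * dotp x x)))%:C * cis t.
  by rewrite normc_real_cis // mulr_ge0 ?expR_ge0 // exprn_ge0 // ltW.
rewrite /eval_at /=; case: b @r r0 => r r0 /=.
  rewrite fourier_atom /amplitude /rate /centre /frequency /= mul1r -/r.
  rewrite fourier_wave; last by rewrite divr_gt0 ?pi_gt0 // exprn_gt0.
  rewrite sub0r dotpNN.
  have [_ _ -> ->] := width_field (dotp x x) (gt_eqF (pi_gt0 R)) (gt_eqF r0).
  by rewrite sqrtr_sqr ger0_norm ?(ltW r0) //; eexists.
rewrite /atom /amplitude /rate /centre /frequency /= -/r wave_polar subr0 mulrA -rmorphM.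
by eexists.
Qed.

(** What is left of the matrix of the system after its diagonal, which consists
    of 1s, has been removed. *)
Definition coupling (n m : nat) : R[i] :=
  match item n, item m with
  | Some i, Some j => eval_at i (atom j) - (n == m)%:R
  | _, _ => 0
  end.

(** The weight of a number that is no code only has to make the sum of the
    inverse powers converge. *)
Definition weights (n : nat) : R := if item n is Some i then weight i else (n.+1)%:R.

Lemma weights_ge1 n : 1 <= weights n.
Proof. by rewrite /weights; case: (item n) => [i|]; [exact: weight_ge1|rewrite ler1n]. Qed.

Lemma item_inj n m i : item n = Some i -> item m = Some i -> n = m.
Proof. by move=> /itemP[_ <-] /itemP[_ <-]. Qed.

Lemma coupling_diag n : coupling n n = 0.
Proof.
rewrite /coupling; case E: (item n) => [[b x]|//]; rewrite eqxx eval_atom_same.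
rewrite [dotp _ _](_ : _ = 0); last by rewrite subrr dotp0l.
by rewrite mulr0 mul0r oppr0 expR0 subrr.
Qed.

Lemma normc_coupling_same n m b x y : item n = Some (b, x) -> item m = Some (b, y) -> n != m ->
  normc (coupling n m) = expR (- (pi * dotp (x - y) (x - y) / width (b, y) ^+ 2)).
Proof.
move=> En Em /negbTE nm; rewrite /coupling En Em nm subr0 eval_atom_same.
by rewrite -[_%:C]mulr1 -cis0 normc_real_cis // expR_ge0.
Qed.

Lemma normc_coupling_cross n m b x y : item n = Some (~~ b, x) -> item m = Some (b, y) ->
  normc (coupling n m) = width (b, y) ^+ d * expR (- (pi * width (b, y) ^+ 2 * dotp x x)).
Proof.
move=> En Em; rewrite /coupling En Em.
rewrite [n == m](_ : _ = false) ?subr0; first exact: normc_eval_atom_cross.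
by apply/eqP => nm; move: Em; rewrite -nm En => -[]; case: (b).
Qed.

Lemma normc_coupling_le1 n m : normc (coupling n m) <= 1.
Proof.
have [->|nm] := eqVneq n m; first by rewrite coupling_diag Normc.normc0.
case En: (item n) => [[b x]|]; last by rewrite /coupling En Normc.normc0.
case Em: (item m) => [[b' y]|]; last by rewrite /coupling En Em Normc.normc0.
have [bb|bb] := eqVneq b b'.
  rewrite -bb in Em; rewrite (normc_coupling_same En Em nm) -expR0 ler_expR oppr_le0.
  by rewrite divr_ge0 ?sqr_ge0 // mulr_ge0 ?dotp_ge0 // ltW // pi_gt0.
have e : b = ~~ b' by case: (b) (b') bb => [] [].
rewrite e in En; rewrite (normc_coupling_cross En Em) mulr_ile1 ?expR_ge0 //.
- by rewrite exprn_ge0 // ltW // width_gt0.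
- by rewrite exprn_ile1 ?width_le1 // ltW // width_gt0.
- rewrite -expR0 ler_expR oppr_le0 mulr_ge0 ?dotp_ge0 // mulr_ge0 ?sqr_ge0 //.
  exact: ltW (pi_gt0 R).
Qed.

Lemma normc_coupling_cross_le n m b b' x y : item n = Some (b', x) -> item m = Some (b, y) ->
  b' != b -> normc (coupling n m) <= eta ^+ d.
Proof.
move=> En Em bb; have e : b' = ~~ b by case: (b) (b') bb => [] [].
rewrite e in En; rewrite (normc_coupling_cross En Em) -[leRHS]mulr1.
have w0 := width_gt0 (b, y).
apply: ler_pM; rewrite ?expR_ge0 ?exprn_ge0 ?(ltW w0) //.
  by rewrite lerXn2r ?nnegrE ?(ltW w0) ?(ltW eta_gt0) // width_le_eta.
rewrite -expR0 ler_expR oppr_le0 mulr_ge0 ?dotp_ge0 // mulr_ge0 ?sqr_ge0 //.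
exact: ltW (pi_gt0 R).
Qed.

(** The parameters of the waves grow polynomially with the weight of the point,
    so that rapidly decreasing coefficients make all the series of derivatives
    converge. *)
Lemma wave_size_point : exists (C : R) (N : nat), 0 <= C /\ forall i,
  exists Q, wave_size (rate i) (centre i) (frequency i) Q /\ Q <= C * weight i ^+ N.
Proof.
have e0 := eta_gt0; have e1 : eta <= 1 by have /andP[] := eta01.
pose E := (Num.truncn (2 * (p1 + q1))).+1.
have hE b : 2 * expo b <= E%:R.
  apply: le_trans (ltW (truncnS_gt (2 * (p1 + q1)))); rewrite ler_wpM2l //.
  by case: b; rewrite /expo ?lerDl ?lerDr ltW.
pose k := (Num.truncn ((Num.sqrt p1)^-1 + (Num.sqrt q1)^-1)).+1.
have hk b : 1 <= Num.sqrt (expo b) * k%:R.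
  have s0 : 0 < Num.sqrt (expo b) by rewrite sqrtr_gt0 expo_gt0.
  rewrite mulrC -ler_pdivrMr // div1r.
  apply: le_trans (ltW (truncnS_gt ((Num.sqrt p1)^-1 + (Num.sqrt q1)^-1))).
  by case: b s0 => s0; rewrite /expo ?lerDl ?lerDr invr_ge0 sqrtr_ge0.
exists (2 * pi / eta ^+ 2), (k * (E + 2))%N; split.
  by rewrite divr_ge0 ?sqr_ge0 // mulr_ge0 // ltW // pi_gt0.
move=> i; set jb := jbracket i.2.
have j1 : 1 <= jb by exact: jbracket_ge1.
have j0 : 0 < jb by exact: jbracket_gt0.
exists (2 * pi / eta ^+ 2 * jb ^+ (E + 2)); split; last first.
  rewrite ler_wpM2l ?divr_ge0 ?sqr_ge0 ?mulr_ge0 ?(ltW (pi_gt0 R)) //.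
  rewrite exprM lerXn2r ?nnegrE ?exprn_ge0 ?powR_ge0 ?(ltW j0) //.
  by rewrite /weight powR_exprn -[leLHS]powRr1 ?(ltW j0) // jbracket_powR_le.
have pi1 := pi_ge1 R.
have ev1 : 1 <= (eta ^+ 2)^-1 by rewrite invf_ge1 ?exprn_gt0 // expr_le1 // ltW.
set r2 := width i ^+ 2.
have r20 : 0 < r2 by rewrite exprn_gt0 // width_gt0.
have r21 : r2 <= 1 by rewrite expr_le1 ?width_le1 // ltW // width_gt0.
have jE : jb ^+ 2 <= jb ^+ (E + 2) by rewrite ler_weXn2l // leq_addl.
have jE2 : jb ^+ E <= jb ^+ (E + 2) by rewrite ler_weXn2l // leq_addr.
have jE1 : 1 <= jb ^+ (E + 2) by rewrite exprn_ege1.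
have r2V : r2^-1 <= (eta ^+ 2)^-1 * jb ^+ E.
  rewrite /r2 /width exprMn invfM ler_wpM2l ?invr_ge0 ?sqr_ge0 //.
  rewrite powR_exprn -powRN mulNr opprK -powR_mulrn ?(ltW j0) //.
  by rewrite jbracket_powR_le // mulrC hE.
set a := (eta ^+ 2)^-1 in ev1 r2V *.
have r2V1 : 1 <= r2^-1 by rewrite invf_ge1.
have Qge : pi * (a * jb ^+ E) <= 2 * pi * a * jb ^+ (E + 2).
  have : a * jb ^+ E <= a * jb ^+ (E + 2) by rewrite ler_wpM2l // (le_trans ler01).
  have : 0 <= a * jb ^+ E by rewrite mulr_ge0 ?exprn_ge0 ?(ltW j0) // (le_trans ler01).
  nra.
have pr : pi * r2^-1 <= 2 * pi * a * jb ^+ (E + 2).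
  by apply: le_trans Qge; rewrite ler_wpM2l // (le_trans ler01).
have piV : pi^-1 <= 1 :> R by rewrite invf_le1 // pi_gt0.
have rpi : r2^-1 <= pi * r2^-1 by rewrite ler_peMl // (le_trans ler01).
have a2 : 1 <= 2 * pi * a by apply: mulr_ege1 => //; lra.
split; first split.
- exact: mulr_ege1.
- exact: rate_gt0.
- rewrite /rate -/r2; case: i.1; first exact: pr.
  by apply: le_trans pr; rewrite ler_wpM2l ?(le_trans r21) // (le_trans ler01).
- apply: le_trans pr; apply: le_trans rpi; rewrite /rate -/r2; case: i.1.
    by rewrite invf_div; apply: (@le_trans _ _ 1) => //; rewrite mulr_ile1 // ?invr_ge0 // ltW // pi_gt0.
  by rewrite invfM ler_piMl // (le_trans ler01).
split.
  apply: (@le_trans _ _ (jb ^+ 2)); last first.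
    by apply: le_trans jE _; rewrite ler_peMl // exprn_ge0 // ltW.
  rewrite /centre; case: i.1; first by [].
  by rewrite jbracket2 dotp0l addr0 exprn_ege1.
move=> k'; rewrite normrM ger0_norm; last by rewrite mulr_ge0 // ltW // pi_gt0.
apply: (@le_trans _ _ (2 * pi * jb ^+ (E + 2))); last first.
  by rewrite ler_wpM2r ?exprn_ge0 ?(ltW j0) // ler_peMr // mulr_ge0 // ltW // pi_gt0.
rewrite ler_wpM2l ?mulr_ge0 ?(ltW (pi_gt0 R)) //.
apply: (@le_trans _ _ (jb ^+ 2)) => //.
apply: (@le_trans _ _ jb); last by rewrite expr2 ler_peMl // ltW.
rewrite /frequency; case: i.1; last exact: coord_le_jbracket.
by rewrite mxE normr0 ltW.
Qed.

Variables (S : R) (s0 : nat).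
Hypothesis weights_sum : forall N, series (fun n => (weights n ^+ s0)^-1) N <= S.

Lemma synthesis (x : nat -> R[i]) : rapid_seq weights x ->
  exists f : V -> R[i]^o, schwartz f /\ forall n i y, item n = Some i ->
    has_sum (fun m => coupling n m * x m) y -> eval_at i f = x n + y.
Proof.
move=> xr; have [C [N [C0 hQ]]] := wave_size_point.
have /choice[q hq] : forall i, exists Q,
    wave_size (rate i) (centre i) (frequency i) Q /\ Q <= C * weight i ^+ N by exact: hQ.
pose ka n := if item n is Some i then x n * (amplitude i)%:C else 0.
pose al n := if item n is Some i then rate i else 1.
pose c n := if item n is Some i then centre i else 0.
pose om n := if item n is Some i then frequency i else 0.
pose Q n := if item n is Some i then q i else 1.
have sz n : wave_size (al n) (c n) (om n) (Q n).
  rewrite /al /c /om /Q; case: (item n) => [i|]; first by have [] := hq i.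
  split; first by split=> //; rewrite ?invr1.
  by split=> [|k]; rewrite ?jbracket2 ?dotp0l ?addr0 // mxE mulr0 normr0.
have kr k : exists B0 : R, forall M, series (fun n => normc (ka n) * Q n ^+ k) M <= B0.
  have [M0 hM0] := xr (N * k + s0)%N.
  have M00 : 0 <= M0.
    apply: le_trans (hM0 0); rewrite mulr_ge0 ?normc_ge0 // exprn_ge0 //.
    by rewrite (le_trans ler01) // weights_ge1.
  exists (M0 * C ^+ k * S) => M.
  apply: (@le_trans _ _ (M0 * C ^+ k * series (fun n => (weights n ^+ s0)^-1) M)); last first.
    by rewrite ler_wpM2l // mulr_ge0 // exprn_ge0.
  rewrite /series /= mulr_sumr; apply: ler_sum => n _.
  have wn0 : 0 < weights n by rewrite (lt_le_trans ltr01) // weights_ge1.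
  rewrite ler_pdivlMr ?exprn_gt0 //.
  apply: (@le_trans _ _ (normc (x n) * (C * weights n ^+ N) ^+ k * weights n ^+ s0)); last first.
    rewrite exprMn -exprM.
    rewrite [leLHS](_ : _ = C ^+ k * (normc (x n) * weights n ^+ (N * k + s0))); last by rewrite exprD; ring.
    by rewrite [leRHS]mulrC ler_wpM2l // exprn_ge0.
  rewrite ler_wpM2r ?exprn_ge0 ?(ltW wn0) //.
  rewrite /ka /Q /weights; case: (item n) => [i|]; last first.
    by rewrite Normc.normc0 mul0r mulr_ge0 ?normc_ge0 // exprn_ge0 // mulr_ge0 // exprn_ge0.
  have [[[Q1 _ _ _] _] qC] := hq i.
  rewrite Normc.normcM; have /andP[a0 a1] := amplitude_bounds i.
  apply: ler_pM; rewrite ?mulr_ge0 ?normc_ge0 ?exprn_ge0 ?(le_trans ler01 Q1) //.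
    rewrite ler_piMr ?normc_ge0 //= expr0n /= addr0 sqrtr_sqr ger0_norm //.
  rewrite lerXn2r ?nnegrE ?(le_trans ler01 Q1) // mulr_ge0 // exprn_ge0 //.
  by rewrite (le_trans ler01) // weight_ge1.
exists (wave_series ka al c om : V -> R[i]^o); split; first exact: (schwartz_wave_series sz kr).
move=> n i y En hy.
have term m j : item m = Some j ->
    (fun z => ka m * wave (al m) (c m) (om m) z) = fun z => x m * atom j z.
  by move=> Em; apply/funext => z; rewrite /ka /al /c /om Em /atom mulrA.
have term0 m : item m = None ->
    (fun z => ka m * wave (al m) (c m) (om m) z) = fun=> 0.
  by move=> Em; apply/funext => z; rewrite /ka Em mul0r.
have h1 : has_sum (fun m => eval_at i (fun z => ka m * wave (al m) (c m) (om m) z))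
    (eval_at i (wave_series ka al c om)).
  rewrite /eval_at; case: i.1.
    have := (has_sum_wave_series sz kr i.2). exact.
  exact: (has_sum_fourier_wave_series sz kr i.2).
apply: (has_sum_unique h1); rewrite addrC.
have hs : has_sum (fun m => (m == n)%:R * x m) (x n).
  have := @has_sum_single R (fun m => (m == n)%:R * x m) n.
  rewrite eqxx mul1r; apply=> m /negbTE ->; by rewrite mul0r.
have := has_sumD hy hs; congr has_sum; apply/funext => m.
rewrite /coupling En; case Em: (item m) => [j|]; last first.
  rewrite (term0 _ Em) mul0r add0r (_ : m == n = false) ?mul0r; last first.
    by apply/eqP => mn; rewrite mn En in Em.
  rewrite /eval_at; case: i.1 => //.
  rewrite (_ : (fun=> 0 : R[i]) = fun z : V => 0 * 0); last by apply/funext => z; rewrite mul0r.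
  by rewrite fourierZ ?mul0r //; exact: decayingC0.
rewrite (term _ _ Em) -mulrDl eq_sym subrK mulrC /eval_at; case: i.1 => //.
rewrite fourierZ //; apply/decayingCZ/schwartz_decayingC/schwartz_wave; exact: rate_gt0.
Qed.

End system.

(** * Constants that depend on the separation only *)

Section solvability.
Variables (R : realType) (d : nat).
Local Open Scope complex_scope.
Local Notation normc := Normc.normc.
Local Notation V := 'rV[R]_d.
Local Notation point := (point R d).
Implicit Types (A B : set V).

Lemma sum_points (g : nat -> option V) (A : set V) (f : V -> R) N :
  (forall n m x, g n = Some x -> g m = Some x -> n = m) ->
  (forall n x, g n = Some x -> A x) ->
  exists l : seq V, [/\ uniq l, forall a, a \in l -> A a,
    forall a, a \in l -> exists2 n, (n < N)%N & g n = Some a &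
    \sum_(0 <= n < N) (if g n is Some x then f x else 0) = \sum_(a <- l) f a].
Proof.
move=> g_inj gA; elim: N => [|N [l [ul lA lN ls]]].
  by exists [::]; split=> //; rewrite big_geq // big_nil.
rewrite big_nat_recr //= ls; case E: (g N) => [x|]; last first.
  exists l; split=> //; last by rewrite addr0.
  by move=> a /lN[n nN gn]; exists n => //; exact: leqW.
exists (x :: l); split.
- rewrite /= ul andbT; apply/negP => /lN[n nN gn].
  by move: nN; rewrite (g_inj _ _ _ gn E) ltnn.
- by move=> a; rewrite inE => /predU1P[->|/lA //]; exact: gA E.
- move=> a; rewrite inE => /predU1P[->|/lN[n nN gn]]; first by exists N.
  by exists n => //; exact: leqW.
- by rewrite big_cons addrC.
Qed.

(** The shell and the cell of a point form a code whose definition involves the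
    exponent and the separation, but not the set. *)
Lemma exists_code p de : 0 < de -> exists code : V -> nat, forall A a a',
  separated p de A -> A a -> A a' -> code a = code a' -> a = a'.
Proof.
move=> de0; exists (cell_code (Num.truncn p).+1 (Num.truncn (d%:R / de)).+1) => A a a'.
apply: (cell_code_inj de0); first by apply: ltW; exact: truncnS_gt.
exact: truncnS_gt.
Qed.

Lemma separated_count p de rho : 0 < de -> exists C : nat, forall A (l : seq V),
  separated p de A -> uniq l -> (forall a, a \in l -> A a /\ jbracket a < rho) ->
  (size l <= C)%N.
Proof.
move=> de0; have [s [S hS]] := @separated_sum R d p de de0.
exists (Num.truncn (S * `|rho| ^+ s)) => A l sA ul lA.
rewrite truncn_ge_nat; last first.
  rewrite mulr_ge0 ?exprn_ge0 //.
  by apply: le_trans (hS A [::] sA isT _) => //; rewrite big_nil.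
case E : l => [|a l'].
  rewrite mulr_ge0 ?exprn_ge0 //.
  by apply: le_trans (hS A [::] sA isT _) => //; rewrite big_nil.
rewrite -E; have rho0 : 0 < rho.
  by have [|_] := lA a; [rewrite E mem_head|apply: lt_trans; exact: jbracket_gt0].
rewrite -ler_pdivrMr ?exprn_gt0 ?normr_gt0 ?gt_eqF //.
apply: le_trans (hS A l sA ul _); last by move=> b /lA[].
rewrite -sum1_size natr_sum mulr_suml big_seq [leRHS]big_seq.
apply: ler_sum => b bl; have [_ jb] := lA b bl; have j0 := jbracket_gt0 b.
rewrite mul1r lef_pV2 ?posrE ?exprn_gt0 ?normr_gt0 ?gt_eqF // ger0_norm ?(ltW rho0) //.
by rewrite lerXn2r ?nnegrE ?(ltW j0) ?(ltW rho0) // ltW.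
Qed.

Lemma separated_unique p de rho A x y : 0 < p -> 2 * rho * rho `^ p < de ->
  separated p de A -> A x -> A y -> jbracket x <= rho -> jbracket y <= rho -> x = y.
Proof.
move=> p0 hde sA Ax Ay jx jy; apply/eqP; apply: contraT => xy.
have := sA x y Ax Ay xy; rewrite leNgt => /negP[].
have rho0 : 0 < rho by apply: lt_le_trans jx; exact: jbracket_gt0.
have h1 : enorm (y - x) <= 2 * rho.
  rewrite /enorm -[leRHS]ger0_norm; last by rewrite mulr_ge0 // ltW.
  rewrite -sqrtr_sqr ler_sqrt ?sqr_ge0 //.
  have jx2 : jbracket x ^+ 2 <= rho ^+ 2 by rewrite lerXn2r ?nnegrE ?(ltW rho0) ?(ltW (jbracket_gt0 _)).
  have jy2 : jbracket y ^+ 2 <= rho ^+ 2 by rewrite lerXn2r ?nnegrE ?(ltW rho0) ?(ltW (jbracket_gt0 _)).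
  rewrite !jbracket2 in jx2 jy2.
  have h : dotp (y - x) (y - x) <= 2 * dotp x x + 2 * dotp y y.
    rewrite /dotp !mulr_sumr -big_split /=; apply: ler_sum => i _; rewrite !mxE.
    by have := sqr_ge0 (x 0 i + y 0 i); rewrite !expr2; nra.
  rewrite exprMn; lra.
have de0 : 0 <= de by apply: ltW; apply: le_lt_trans hde; rewrite mulr_ge0 ?powR_ge0 // mulr_ge0 // ltW.
apply: le_lt_trans h1 _.
rewrite -(@ltr_pM2r _ (rho `^ p)) ?powR_gt0 //; apply: lt_le_trans hde _.
rewrite -mulrA ler_peMr // powRN mulrC ler_pdivlMr ?powR_gt0 ?jbracket_gt0 //.
by rewrite mul1r ge0_ler_powR ?nnegrE ?(ltW p0) ?(ltW rho0) // ltW // jbracket_gt0.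
Qed.

Section exponents.
Variables p q p1 q1 : R.
Hypotheses (p0 : 0 < p < p1) (q0 : 0 < q < q1) (pq1 : p1 * q1 < 1).

Let p1_gt0 : 0 < p1. Proof. by case/andP: p0; exact: lt_trans. Qed.
Let q1_gt0 : 0 < q1. Proof. by case/andP: q0; exact: lt_trans. Qed.

Definition coded (de : R) A B (codeA codeB : V -> nat) : Prop :=
  [/\ separated p de A, separated q de B,
    forall a a', A a -> A a' -> codeA a = codeA a' -> a = a' &
    forall b b', B b -> B b' -> codeB b = codeB b' -> b = b'].

(** This bound and the next one are uniform in the two sets, which is what makes
    the radius in [solve_high], and with it the dimension of the cokernel,
    bounded in terms of the separation. *)
Lemma weights_sum_uniform de : 0 < de -> exists (s0 : nat) (S : R),
  forall A B codeA codeB, coded de A B codeA codeB ->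
  forall N, series (fun n => (weights p1 q1 A B codeA codeB n ^+ s0)^-1) N <= S.
Proof.
move=> de0; have [sA [SA hA]] := @separated_sum R d p de de0.
have [sB [SB hB]] := @separated_sum R d q de de0.
pose s0 := ((Num.truncn (sA%:R / Num.sqrt p1)).+1 + (Num.truncn (sB%:R / Num.sqrt q1)).+1 + 2)%N.
have hsA : sA%:R <= Num.sqrt p1 * s0%:R.
  rewrite mulrC -ler_pdivrMr ?sqrtr_gt0 //; apply: le_trans (ltW (truncnS_gt _)) _.
  by rewrite ler_nat /s0 -addnA leq_addr.
have hsB : sB%:R <= Num.sqrt q1 * s0%:R.
  rewrite mulrC -ler_pdivrMr ?sqrtr_gt0 //; apply: le_trans (ltW (truncnS_gt _)) _.
  by rewrite ler_nat /s0 addnAC leq_addl.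
exists s0, (2 + SA + SB) => A B codeA codeB [sepA sepB iA iB] N.
pose it := item A B codeA codeB.
pose gA n := if it n is Some (true, x) then Some x else None.
pose gB n := if it n is Some (false, x) then Some x else None.
have it_inj := @item_inj R d A B codeA codeB.
have gAP n x : gA n = Some x -> it n = Some (true, x).
  by rewrite /gA; case: (it n) => [[[] y]|] // [->].
have gBP n x : gB n = Some x -> it n = Some (false, x).
  by rewrite /gB; case: (it n) => [[[] y]|] // [->].
have [lA [ulA lAA _ eA]] := @sum_points gA A (fun a => (jbracket a ^+ sA)^-1) N
  (fun n m x h1 h2 => it_inj _ _ _ (gAP _ _ h1) (gAP _ _ h2))
  (fun n x h => (itemP (gAP _ _ h)).1).
have [lB [ulB lBB _ eB]] := @sum_points gB B (fun a => (jbracket a ^+ sB)^-1) N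
  (fun n m x h1 h2 => it_inj _ _ _ (gBP _ _ h1) (gBP _ _ h2))
  (fun n x h => (itemP (gBP _ _ h)).1).
apply: (@le_trans _ _ (\sum_(0 <= n < N) (((n.+1)%:R ^+ 2)^-1 +
   (if gA n is Some x then (jbracket x ^+ sA)^-1 else 0) +
   (if gB n is Some x then (jbracket x ^+ sB)^-1 else 0)))); last first.
  rewrite !big_split /= eA eB; apply: lerD; last exact: hB ulB lBB.
  apply: lerD; last exact: hA ulA lAA.
  apply: le_trans (@sum_inv_sqr_le R N.+1).
  by rewrite big_nat_recl //= expr0n invr0 add0r.
apply: ler_sum => n _; rewrite /weights /gA /gB -/it.
have n0 : 0 <= ((n.+1)%:R ^+ 2)^-1 :> R by rewrite invr_ge0 exprn_ge0.
case: (it n) => [[[] x]|].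
- rewrite addr0 -[leLHS]add0r; apply: lerD => //.
  have j0 := jbracket_gt0 x.
  rewrite lef_pV2 ?posrE ?exprn_gt0 ?powR_gt0 // /weight /= powR_exprn -powR_mulrn ?(ltW j0) //.
  exact: jbracket_powR_le.
- rewrite addr0 -[leLHS]add0r; apply: lerD => //.
  have j0 := jbracket_gt0 x.
  rewrite lef_pV2 ?posrE ?exprn_gt0 ?powR_gt0 // /weight /= powR_exprn -powR_mulrn ?(ltW j0) //.
  exact: jbracket_powR_le.
rewrite !addr0 lef_pV2 ?posrE ?exprn_gt0 //.
by rewrite ler_weXn2l ?ler1n // /s0 leq_addl.
Qed.

Lemma smoothing_uniform (eta : R) (s0 J : nat) : 0 < eta <= 1 ->
  Num.sqrt (p1 * q1) * J.+1%:R + s0%:R <= J%:R ->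
  exists C : R, 0 <= C /\ forall de A B codeA codeB, eta <= de ->
    coded de A B codeA codeB ->
    let w := weights p1 q1 A B codeA codeB in
    forall n m, normc (coupling p1 q1 eta A B codeA codeB n m) * w n ^+ J.+1 * w m ^+ s0 <=
      C * w m ^+ J.
Proof.
move=> eta01 hJ.
have hJ' : Num.sqrt (q1 * p1) * J.+1%:R + s0%:R <= J%:R by rewrite [q1 * p1]mulrC.
have [C1 hC1] := @cross_entry_bound R d eta p1 q1 s0 J eta01 p1_gt0 q1_gt0 hJ.
have [C2 hC2] := @cross_entry_bound R d eta q1 p1 s0 J eta01 q1_gt0 p1_gt0 hJ'.
have [C3 hC3] := @same_entry_bound R d p1 p s0 J p0.
have [C4 hC4] := @same_entry_bound R d q1 q s0 J q0.
exists (`|C1| + `|C2| + `|C3| + `|C4|); split; first by rewrite !addr_ge0.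
move=> de A B codeA codeB etade [sepA sepB iA iB] w n m.
have w0 k : 0 < w k by rewrite (lt_le_trans ltr01) // weights_ge1.
have CC C' : C' <= `|C1| + `|C2| + `|C3| + `|C4| ->
    C' * w m ^+ J <= (`|C1| + `|C2| + `|C3| + `|C4|) * w m ^+ J.
  by move=> h; rewrite ler_wpM2r // exprn_ge0 // ltW.
have n1 := ler_norm C1; have n2 := ler_norm C2; have n3 := ler_norm C3; have n4 := ler_norm C4.
have m1 := normr_ge0 C1; have m2 := normr_ge0 C2; have m3 := normr_ge0 C3; have m4 := normr_ge0 C4.
have zero : normc (coupling p1 q1 eta A B codeA codeB n m) = 0 ->
    normc (coupling p1 q1 eta A B codeA codeB n m) * w n ^+ J.+1 * w m ^+ s0 <=
      (`|C1| + `|C2| + `|C3| + `|C4|) * w m ^+ J.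
  by move=> ->; rewrite !mul0r mulr_ge0 ?addr_ge0 // exprn_ge0 // ltW.
have [nm|nm] := eqVneq n m; first by apply: zero; rewrite nm coupling_diag ?Normc.normc0.
case En: (item A B codeA codeB n) => [[b x]|]; last first.
  by apply: zero; rewrite /coupling En Normc.normc0.
case Em: (item A B codeA codeB m) => [[b' y]|]; last first.
  by apply: zero; rewrite /coupling En Em Normc.normc0.
have wn : w n = jbracket x `^ Num.sqrt (expo p1 q1 b) by rewrite /w /weights En.
have wm : w m = jbracket y `^ Num.sqrt (expo p1 q1 b') by rewrite /w /weights Em.
have [bb|bb] := eqVneq b b'.
  rewrite -bb in Em wm.
  rewrite (normc_coupling_same _ _ eta01 En Em nm).
  have xy : y != x.
    by apply: contra nm => /eqP yx; rewrite (item_inj En (_ : item _ _ _ _ m = _)) // Em yx.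
  have [xI _] := itemP En; have [yI _] := itemP Em.
  move: CC; rewrite wn wm => CC.
  case: b {En bb} Em wn wm xI yI CC => Em wn wm xI yI CC.
    apply: le_trans (hC3 eta de y x _ eta01 etade erefl _) _; first exact: sepA.
    by apply: CC; lra.
  apply: le_trans (hC4 eta de y x _ eta01 etade erefl _) _; first exact: sepB.
  by apply: CC; lra.
have e : b = ~~ b' by case: (b) (b') bb => [] [].
rewrite e in En wn; rewrite (normc_coupling_cross _ _ eta01 En Em).
set r := width _ _ _ _; have r0 : 0 < r by exact: width_gt0.
have r1 : r <= 1 by exact: width_le1.
apply: (@le_trans _ _ (expR (- (pi * r ^+ 2 * dotp x x)) * w n ^+ J.+1 * w m ^+ s0)).
  rewrite !ler_wpM2r ?exprn_ge0 ?(ltW (w0 _)) //.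
  by rewrite ler_piMl ?expR_ge0 // exprn_ile1 // ltW.
move: CC; rewrite wn wm => CC.
case: b' {bb e} En Em wn wm @r r0 r1 CC => En Em wn wm r r0 r1 CC.
  by apply: le_trans (hC1 y x r erefl) _; apply: CC; lra.
by apply: le_trans (hC2 y x r erefl) _; apply: CC; lra.
Qed.

(** The gain of one power of the weight is a small factor for a row of large
    weight. *)
Lemma row_sum_high (K : nat -> R[i]) (w v : nat -> R) (C S W : R) (s0 J : nat) :
  0 <= C -> (forall m, 1 <= w m) -> (forall m, w m <= v m) -> 2 * C * S <= W -> 0 < W ->
  (forall m, normc (K m) * W ^+ J.+1 * w m ^+ s0 <= C * w m ^+ J) ->
  (forall N, series (fun n => (w n ^+ s0)^-1) N <= S) ->
  forall N, series (fun m => normc (K m) / v m ^+ J) N <= 1 / 2 / W ^+ J.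
Proof.
move=> C0 w1 wv CS W0 hK hS N.
have w0 m : 0 < w m by exact: lt_le_trans ltr01 (w1 m).
apply: (@le_trans _ _ (\sum_(0 <= m < N) C / W ^+ J.+1 * (w m ^+ s0)^-1)).
  apply: ler_sum => m _; apply: (@le_trans _ _ (normc (K m) / w m ^+ J)).
    rewrite ler_wpM2l ?normc_ge0 // lef_pV2 ?posrE ?exprn_gt0 ?(lt_le_trans (w0 m)) //.
    by rewrite lerXn2r ?nnegrE ?(ltW (w0 m)) ?(le_trans (ltW (w0 m))).
  rewrite ler_pdivrMr ?exprn_gt0 // mulrAC ler_pdivlMr ?exprn_gt0 //.
  rewrite mulrAC ler_pdivlMr ?exprn_gt0 // mulrAC; exact: hK.
rewrite -mulr_sumr; apply: (@le_trans _ _ (C / W ^+ J.+1 * S)).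
  by rewrite ler_wpM2l ?hS // divr_ge0 // exprn_ge0 // ltW.
have -> : C / W ^+ J.+1 * S = C * S / W / W ^+ J.
  by rewrite exprS invfM; ring.
apply: ler_wpM2r; first by rewrite invr_ge0 exprn_ge0 // ltW.
by rewrite ler_pdivrMr //; lra.
Qed.

(** The slope of the left-hand side in [J] is [sqrt (p1 * q1)], which is less
    than 1. *)
Lemma exists_order (s0 : nat) : exists J0 : nat, (s0 < J0)%N /\ forall J, (J0 <= J)%N ->
  Num.sqrt (p1 * q1) * J.+1%:R + s0%:R <= J%:R.
Proof.
set k := Num.sqrt (p1 * q1).
have k1 : k < 1 by rewrite -sqrtr1 ltr_sqrt.
have k0 : 0 <= k by exact: sqrtr_ge0.
have k10 : 0 < 1 - k by rewrite subr_gt0.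
exists ((Num.truncn ((k + s0%:R) / (1 - k))).+1 + s0.+1)%N; split; first by rewrite leq_addl.
move=> J hJ; have : (k + s0%:R) / (1 - k) <= J%:R.
  apply: le_trans (ltW (truncnS_gt _)) _; rewrite ler_nat.
  by apply: leq_trans hJ; rewrite leq_addr.
by rewrite ler_pdivrMr // -natr1; lra.
Qed.

End exponents.
End solvability.

(** * Functions with prescribed values *)

Section solve.
Variables (R : realType) (d : nat).
Local Open Scope complex_scope.
Local Notation normc := Normc.normc.
Local Notation V := 'rV[R]_d.
Local Notation point := (point R d).
Implicit Types (A B : set V).

Definition rapid_on A B (u : point -> R[i]) : Prop := forall j : nat, exists M : R,
  forall i, in_sets A B i -> normc (u i) * jbracket i.2 ^+ j <= M.

(** Bumps slightly narrower than the separation allows are needed, see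
    [same_entry_bound]. *)
Lemma exists_exponents (p q : R) : 0 < p -> 0 < q -> p * q < 1 ->
  exists p1 q1, [/\ 0 < p < p1, 0 < q < q1 & p1 * q1 < 1].
Proof.
move=> p0 q0 pq1; have pq0 : 0 < p * q by rewrite mulr_gt0.
(* [p] and [q] are enlarged by a common factor, chosen so that the new product
   is [2 p q / (1 + p q)] *)
pose l := Num.sqrt (2 / (1 + p * q)).
have l2 : l ^+ 2 = 2 / (1 + p * q) by rewrite sqr_sqrtr // divr_ge0 //; lra.
have l1 : 1 < l.
  rewrite -sqrtr1 ltr_sqrt ?ltr_pdivlMr; lra.
exists (p * l), (q * l); split.
- by rewrite p0 ltr_pMr.
- by rewrite q0 ltr_pMr.
have -> : p * l * (q * l) = p * q * l ^+ 2 by ring.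
rewrite l2 mulrA ltr_pdivrMr; lra.
Qed.

Section rows.
Variables (p q p1 q1 eta de : R) (A B : set V) (codeA codeB : V -> nat).
Hypotheses (p0 : 0 < p < p1) (q0 : 0 < q < q1) (eta01 : 0 < eta <= 1) (etade : eta <= de).
Hypothesis AB_coded : coded p q de A B codeA codeB.
Variables (s0 J0 : nat) (S : R).
Let w := weights p1 q1 A B codeA codeB.
Hypothesis w_sum : forall N, series (fun n => (w n ^+ s0)^-1) N <= S.
Hypothesis J0_large : forall J, (J0 <= J)%N ->
  Num.sqrt (p1 * q1) * J.+1%:R + s0%:R <= J%:R.

Let p1_gt0 : 0 < p1. Proof. by case/andP: p0; exact: lt_trans. Qed.
Let q1_gt0 : 0 < q1. Proof. by case/andP: q0; exact: lt_trans. Qed.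

Let extend (u : point -> R[i]) n : R[i] := if item A B codeA codeB n is Some i then u i else 0.

Let rapid_extend u : rapid_on A B u -> rapid_seq w (extend u).
Proof.
move=> ur j; pose k := (Num.truncn (Num.sqrt p1 + Num.sqrt q1)).+1.
have hk b : Num.sqrt (expo p1 q1 b) <= k%:R.
  apply: le_trans (ltW (truncnS_gt _)).
  by case: b; rewrite /expo ?lerDl ?lerDr sqrtr_ge0.
have [M hM] := ur (k * j)%N; exists `|M| => n; rewrite /extend /w /weights.
case E: (item _ _ _ _ n) => [i|]; last by rewrite Normc.normc0 mul0r.
have [iI _] := itemP E; apply: le_trans (le_trans (hM i iI) (ler_norm _)).
rewrite ler_wpM2l ?normc_ge0 // exprM; have j0 := jbracket_gt0 i.2.
rewrite lerXn2r ?nnegrE ?powR_ge0 ?exprn_ge0 ?(ltW j0) //.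
by rewrite -powR_mulrn ?(ltW j0) // jbracket_powR_le.
Qed.

Lemma solve_rows (v : nat -> R) (R1 : R) (H : pred nat) :
  (forall n, w n <= v n <= R1 * w n) ->
  (forall n N, H n -> series (fun m => normc (coupling p1 q1 eta A B codeA codeB n m) /
     v m ^+ J0) N <= 1 / 2 / v n ^+ J0) ->
  forall u, rapid_on A B u -> exists f : V -> R[i]^o, schwartz f /\
    forall i, in_sets A B i -> H (point_code codeA codeB i) -> eval_at i f = u i.
Proof.
move=> wv Ksmall u ur.
have w1 n : 1 <= w n by exact: weights_ge1.
have Ksm J : (J0 <= J)%N -> exists C, forall n m,
    normc (coupling p1 q1 eta A B codeA codeB n m) * w n ^+ J.+1 * w m ^+ s0 <= C * w m ^+ J.
  move=> /J0_large hJ; have [C [_ hC]] := @smoothing_uniform R d p q p1 q1 p0 q0 eta s0 J eta01 hJ.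
  by exists C; exact: hC etade AB_coded.
have [x [xr _ xE]] := neumann_solve w1 w_sum wv Ksm Ksmall (rapid_extend ur).
have [f [fs fE]] := synthesis p1_gt0 q1_gt0 eta01 w_sum xr.
exists f; split=> // i iI Hi.
have [_ _ iA iB] := AB_coded; have Ei := item_code iA iB iI.
have [y hy xy] := xE _ Hi.
by rewrite (fE _ _ _ Ei hy) xy /extend Ei.
Qed.

End rows.

(** The row sums are at most 1/2 for all points of large weight, that is, for all
    points outside a ball whose radius is uniform; the equations of the other
    points are given up. *)
Theorem solve_high (p q de : R) : 0 < p -> 0 < q -> p * q < 1 -> 0 < de ->
  exists rho : R, forall A B, separated p de A -> separated q de B ->
  forall u, rapid_on A B u -> exists f : V -> R[i]^o, schwartz f /\
    forall i, in_sets A B i -> rho <= jbracket i.2 -> eval_at i f = u i.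
Proof.
move=> p_gt0 q_gt0 pq1 de0.
have [p1 [q1 [p0 q0 pq11]]] := exists_exponents p_gt0 q_gt0 pq1.
have p1_gt0 : 0 < p1 by case/andP: p0; exact: lt_trans.
have q1_gt0 : 0 < q1 by case/andP: q0; exact: lt_trans.
have [codeA hA] := exists_code d p de0; have [codeB hB] := exists_code d q de0.
have [s0 [S hS]] := @weights_sum_uniform R d p q p1 q1 p0 q0 de de0.
have [J0 [_ hJ0]] := exists_order pq11 s0.
pose eta := Num.min 1 de.
have eta01 : 0 < eta <= 1 by rewrite lt_min ltr01 de0 ge_min lexx.
have etade : eta <= de by rewrite ge_min lexx orbT.
have [C [C0 hC]] := @smoothing_uniform R d p q p1 q1 p0 q0 eta s0 J0 eta01 (hJ0 _ (leqnn _)).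
pose W := 1 + `|2 * C * S|.
have W0 : 0 < W by rewrite ltr_wpDr.
exists (W `^ (Num.sqrt p1)^-1 + W `^ (Num.sqrt q1)^-1) => A B sA sB u ur.
set rho := _ + _.
have ABc : coded p q de A B codeA codeB by split=> // *; [exact: (hA A)|exact: (hB B)].
pose w := weights p1 q1 A B codeA codeB.
pose H n := if item A B codeA codeB n is Some i then rho <= jbracket i.2 else false.
have HW n : H n -> W <= w n.
  rewrite /H /w /weights; case: (item _ _ _ _ n) => [[b x]|//] /= hx.
  have s_gt0 : 0 < Num.sqrt (expo p1 q1 b) by rewrite sqrtr_gt0; case: (b).
  have hx2 : W `^ (Num.sqrt (expo p1 q1 b))^-1 <= jbracket x.
    by apply: le_trans hx; rewrite /rho; case: (b); rewrite /expo ?lerDl ?lerDr powR_ge0.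
  rewrite /weight /= -[leLHS]powRr1 ?(ltW W0) // -(mulVf (lt0r_neq0 s_gt0)) powRrM.
  by rewrite ge0_ler_powR ?(ltW s_gt0) // nnegrE ?powR_ge0 // ltW // jbracket_gt0.
have wv n : w n <= w n <= 1 * w n by rewrite mul1r lexx.
have w1 n : 1 <= w n by exact: weights_ge1.
have [n N Hn|f [fs fE]] := solve_rows p0 q0 eta01 etade ABc (hS _ _ _ _ ABc) hJ0 wv (H := H) _ ur.
  have wn0 : 0 < w n by exact: lt_le_trans ltr01 (w1 n).
  apply: (row_sum_high C0 w1 (fun m => lexx _) _ wn0 _ (hS _ _ _ _ ABc)).
    by apply: le_trans (HW n Hn); apply: le_trans (ler_norm _) _; rewrite /W lerDr.
  by move=> m; exact: hC etade ABc n m.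
exists f; split=> // i iI hi; apply: fE => //.
by rewrite /H (item_code _ _ iI) //; case: ABc.
Qed.

(** For a large separation there is at most one point of each set in a large
    ball, and the coupling of these two points is at most [eta ^+ d], which is
    small. Hence no equation has to be given up. To treat the points of the ball
    like those of weight [W], the contraction is measured in the weight
    [max w W]. *)
Theorem solve_all (p q : R) : (0 < d)%N -> 0 < p -> 0 < q -> p * q < 1 ->
  exists de0 : R, 0 < de0 /\ forall de, de0 <= de -> forall A B,
  separated p de A -> separated q de B ->
  forall u, rapid_on A B u -> exists f : V -> R[i]^o, schwartz f /\
    forall i, in_sets A B i -> eval_at i f = u i.
Proof.
move=> d_gt0 p_gt0 q_gt0 pq1.
have [p1 [q1 [p0 q0 pq11]]] := exists_exponents p_gt0 q_gt0 pq1.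
have p1_gt0 : 0 < p1 by case/andP: p0; exact: lt_trans.
have q1_gt0 : 0 < q1 by case/andP: q0; exact: lt_trans.
have [codeA hA] := exists_code d p (@ltr01 R); have [codeB hB] := exists_code d q (@ltr01 R).
have [s0 [S hS]] := @weights_sum_uniform R d p q p1 q1 p0 q0 1 ltr01.
have [J0 [s0J0 hJ0]] := exists_order pq11 s0.
pose eta : R := 1 / 8.
have eta01 : 0 < eta <= 1 by rewrite /eta; apply/andP; split; lra.
have eta1 : eta <= 1 by have /andP[] := eta01.
have [C [C0 hC]] := @smoothing_uniform R d p q p1 q1 p0 q0 eta s0 J0 eta01 (hJ0 _ (leqnn _)).
pose W := 1 + `|2 * C * S|.
have W1 : 1 <= W by rewrite lerDl.
have W0 : 0 < W by exact: lt_le_trans ltr01 W1.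
(* the points of weight at least [W2] contribute at most a quarter of
   [W ^- J0] to the weighted sum of a row of smaller weight than [W] *)
pose W2 := W + 4 * `|S| * W ^+ J0.
have W2W : W <= W2 by rewrite lerDl mulr_ge0 ?exprn_ge0 ?(ltW W0) // mulr_ge0.
have W20 : 0 < W2 by exact: lt_le_trans W2W.
have [rA rAE] : exists r, r = W2 `^ (Num.sqrt p1)^-1 by eexists.
have [rB rBE] : exists r, r = W2 `^ (Num.sqrt q1)^-1 by eexists.
have rA0 : 0 <= rA by rewrite rAE powR_ge0.
have rB0 : 0 <= rB by rewrite rBE powR_ge0.
have dA : 0 <= 2 * rA * rA `^ p by rewrite !mulr_ge0 ?powR_ge0.
have dB : 0 <= 2 * rB * rB `^ q by rewrite !mulr_ge0 ?powR_ge0.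
have [TA TAE] : exists t, t = 2 * rA * rA `^ p by eexists.
have [TB TBE] : exists t, t = 2 * rB * rB `^ q by eexists.
rewrite -TAE in dA; rewrite -TBE in dB.
exists (1 + TA + TB); split; first by rewrite -addrA ltr_pwDl // addr_ge0.
move=> de hde A B sA sB u ur.
have de1 : 1 <= de by apply: le_trans hde; rewrite -addrA lerDl addr_ge0.
have deA : TA < de by apply: lt_le_trans hde; rewrite addrAC ltrDr ltr_pwDl.
have deB : TB < de by apply: lt_le_trans hde; rewrite ltrDr ltr_pwDl.
have sA1 : separated p 1 A by exact: separated_le de1 sA.
have sB1 : separated q 1 B by exact: separated_le de1 sB.
have ABc : coded p q 1 A B codeA codeB by split=> // *; [exact: (hA A)|exact: (hB B)].
have [_ _ iA iB] := ABc.
pose w := weights p1 q1 A B codeA codeB.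
have w1 n : 1 <= w n by exact: weights_ge1.
have w0 n : 0 < w n by exact: lt_le_trans ltr01 (w1 n).
have sumS := hS _ _ _ _ ABc.
pose v n := Num.max (w n) W.
have wv1 n : w n <= v n by rewrite le_max lexx.
have vW n : W <= v n by rewrite le_max lexx orbT.
have v0 n : 0 < v n by exact: lt_le_trans W0 (vW n).
have wv n : w n <= v n <= W * w n.
  rewrite wv1 /= ge_max ler_peMl ?(ltW (w0 n)) //=.
  by rewrite ler_peMr // ltW.
have near_pt b x : weight p1 q1 (b, x) < W2 -> jbracket x <= if b then rA else rB.
  move=> hx; have s_gt0 : 0 < Num.sqrt (expo p1 q1 b) by rewrite sqrtr_gt0; case: (b).
  have -> : (if b then rA else rB) = W2 `^ (Num.sqrt (expo p1 q1 b))^-1 by rewrite rAE rBE; case: (b).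
  rewrite -[leLHS]powRr1 ?(ltW (jbracket_gt0 _)) // -[X in _ `^ X](mulfV (lt0r_neq0 s_gt0)) powRrM.
  by rewrite ge0_ler_powR ?invr_ge0 ?(ltW s_gt0) ?nnegrE ?powR_ge0 ?(ltW W20) // ltW.
have uniq_pt n m b x y : item A B codeA codeB n = Some (b, x) ->
    item A B codeA codeB m = Some (b, y) -> w n < W2 -> w m < W2 -> n = m.
  move=> En Em; rewrite /w /weights En Em => /near_pt hx /near_pt hy.
  have [xI _] := itemP En; have [yI _] := itemP Em.
  suff xy : x = y by apply: (item_inj (i := (b, x)) En); rewrite xy.
  case: b En Em hx hy xI yI => En Em hx hy xI yI.
    by apply: (separated_unique (rho := rA) p_gt0 _ sA) => //; rewrite -TAE.
  by apply: (separated_unique (rho := rB) q_gt0 _ sB) => //; rewrite -TBE.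
pose K := coupling p1 q1 eta A B codeA codeB.
have small n N : series (fun m => normc (K n m) / v m ^+ J0) N <= 1 / 2 / v n ^+ J0.
  have [hn|hn] := leP W (w n).
    have -> : v n = w n by rewrite /v (max_idPl hn).
    apply: (row_sum_high C0 w1 wv1 _ (w0 n) _ sumS).
      by apply: le_trans hn; apply: le_trans (ler_norm _) _; rewrite /W lerDr.
    by move=> m; exact: hC eta1 ABc n m.
  have -> : v n = W by rewrite /v (max_idPr (ltW hn)).
  pose P m := if item A B codeA codeB m is Some j then
    if item A B codeA codeB n is Some i then (j.1 != i.1) && (w m < W2) else false else false.
  have Puniq m m' : P m -> P m' -> m = m'.
    rewrite /P; case Em: (item _ _ _ _ m) => [[b x]|//]; case Em': (item _ _ _ _ m') => [[b' x']|//].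
    case: (item _ _ _ _ n) => [[b0 x0]|//] /= /andP[b1 h1] /andP[b2 h2].
    have e : b' = b by case: (b) (b') (b0) b1 b2 => [] [] [].
    by rewrite e in Em'; exact: uniq_pt Em Em' h1 h2.
  have WJ0 : 0 < W ^+ J0 by rewrite exprn_gt0.
  have bound m : normc (K n m) / v m ^+ J0 <=
      W2^-1 * (w m ^+ s0)^-1 + (if P m then eta / W ^+ J0 else 0).
    have K0 := normc_ge0 (K n m).
    have t0 : 0 <= W2^-1 * (w m ^+ s0)^-1.
      by rewrite mulr_ge0 ?invr_ge0 ?exprn_ge0 ?(ltW (w0 _)) // ltW.
    have t1 : 0 <= if P m then eta / W ^+ J0 else 0.
      by case: ifP => // _; rewrite divr_ge0 ?exprn_ge0 ?(ltW W0) // /eta; lra.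
    have zero : K n m = 0 -> normc (K n m) / v m ^+ J0 <=
      W2^-1 * (w m ^+ s0)^-1 + (if P m then eta / W ^+ J0 else 0).
      by move=> ->; rewrite Normc.normc0 mul0r addr_ge0.
    have [mn|mn] := eqVneq n m; first by apply: zero; rewrite mn /K coupling_diag.
    have [hm|hm] := leP W2 (w m).
      rewrite -[leLHS]addr0; apply: lerD => //.
      apply: (@le_trans _ _ ((v m ^+ J0)^-1)).
        by rewrite ler_piMl ?invr_ge0 ?exprn_ge0 ?(ltW (v0 _)) // normc_coupling_le1.
      rewrite -invfM lef_pV2 ?posrE ?mulr_gt0 ?exprn_gt0 //.
      apply: (@le_trans _ _ (w m ^+ s0.+1)); first by rewrite exprS ler_wpM2r // exprn_ge0 // ltW.
      apply: (@le_trans _ _ (w m ^+ J0)); first by rewrite ler_weXn2l.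
      by rewrite lerXn2r ?nnegrE ?(ltW (w0 _)) ?(ltW (v0 _)).
    case En: (item A B codeA codeB n) => [[b x]|]; last by apply: zero; rewrite /K /coupling En.
    case Em: (item A B codeA codeB m) => [[b' y]|]; last by apply: zero; rewrite /K /coupling En Em.
    have [bb|bb] := eqVneq b b'.
      rewrite -bb in Em; have := uniq_pt _ _ _ _ _ En Em (lt_le_trans hn W2W) hm.
      by move/eqP; rewrite (negbTE mn).
    have -> : P m = true by rewrite /P Em En /= eq_sym bb hm.
    rewrite -[leLHS]add0r; apply: lerD => //; apply: ler_pM; rewrite ?invr_ge0 ?exprn_ge0 ?(ltW (v0 _)) //.
      apply: le_trans (normc_coupling_cross_le p1_gt0 q1_gt0 eta01 En Em bb) _.
      by case: (d) d_gt0 => // d' _; rewrite exprS ler_piMr ?exprn_ile1 // /eta; lra.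
    by rewrite lef_pV2 ?posrE ?exprn_gt0 // lerXn2r ?nnegrE ?(ltW W0) ?(ltW (v0 _)).
  apply: (@le_trans _ _ (\sum_(0 <= m < N) (W2^-1 * (w m ^+ s0)^-1 + (if P m then eta / W ^+ J0 else 0)))).
    by apply: ler_sum => m _.
  rewrite big_split /= -mulr_sumr.
  have e0 : 0 <= eta / W ^+ J0 by rewrite divr_ge0 ?(ltW WJ0) // /eta; lra.
  have h1 : \sum_(0 <= m < N) (if P m then eta / W ^+ J0 else 0) <= eta / W ^+ J0.
    elim: N => [|N ih]; first by rewrite big_geq.
    rewrite big_nat_recr //=; case: ifP => PN; last by rewrite addr0.
    rewrite big_nat big1 ?add0r // => m /andP[_ mN]; case: ifP => // Pm.
    by move: mN; rewrite (Puniq _ _ Pm PN) ltnn.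
  have h2 : W2^-1 * (\sum_(0 <= m < N) (w m ^+ s0)^-1) <= 1 / 4 / W ^+ J0.
    apply: (@le_trans _ _ (W2^-1 * `|S|)).
      by rewrite ler_wpM2l ?invr_ge0 ?(ltW W20) //; apply: le_trans (sumS N) (ler_norm _).
    rewrite mulrC ler_pdivrMr // mulrAC ler_pdivlMr // /W2.
    have : 0 < W by []. nra.
  apply: le_trans (lerD h2 h1) _; rewrite -mulrDl ler_wpM2r ?invr_ge0 ?(ltW WJ0) //.
  by rewrite /eta; lra.
have [f [fs fE]] := solve_rows p0 q0 eta01 eta1 ABc sumS hJ0 wv (H := predT) (fun n N _ => small n N) ur.
by exists f; split=> // i iI; exact: fE.
Qed.

End solve.

(** * Adding points to a separated set *)

Section extra_points.
Variables (R : realType) (d : nat).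
Local Notation V := 'rV[R]_d.
Implicit Types (A : set V) (x y a : V).

Lemma enormN x : enorm (- x) = enorm x.
Proof.
by rewrite /enorm /dotp; congr Num.sqrt; apply: eq_bigr => i _; rewrite !mxE mulrNN.
Qed.

Lemma enormBC x y : enorm (x - y) = enorm (y - x).
Proof. by rewrite -enormN opprB. Qed.

Lemma coord_le_enorm x i : `|x 0 i| <= enorm x.
Proof. by rewrite -sqrtr_sqr ler_sqrt ?dotp_ge0 // coord_sqr_le. Qed.

Lemma jbracket_near x y : enorm (x - y) < 1 / 4 -> jbracket x <= 2 * jbracket y.
Proof.
move=> h; have jy := jbracket_gt0 y; have jx := jbracket_gt0 x.
rewrite -(@ler_pXn2r _ 2) ?nnegrE ?(ltW jx) ?mulr_ge0 ?(ltW jy) //.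
apply: le_trans (jbracket_shift x y) _.
have e : dotp (x - y) (x - y) = enorm (x - y) ^+ 2 by rewrite /enorm sqr_sqrtr ?dotp_ge0.
have : dotp (x - y) (x - y) <= 1.
  rewrite e expr_le1 ?sqrtr_ge0 //; lra.
have : 0 <= jbracket y ^+ 2 by rewrite sqr_ge0.
rewrite exprMn; nra.
Qed.

Lemma jbracket_near_powR (p : R) x y : 0 < p -> enorm (x - y) < 1 / 4 ->
  jbracket y `^ (- p) <= 2 `^ p * jbracket x `^ (- p).
Proof.
move=> p0 h; have jy := jbracket_gt0 y; have jx := jbracket_gt0 x.
rewrite !powRN ler_pdivlMr ?powR_gt0 // mulrC ler_pdivrMr ?powR_gt0 //.
rewrite -powRM ?(ltW jy) // ge0_ler_powR ?(ltW p0) ?nnegrE ?mulr_ge0 ?(ltW jy) ?(ltW jx) //.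
exact: jbracket_near.
Qed.

Lemma near_diff (a t b s r : R) :
  `|a - t| <= r -> `|b - s| <= r -> `|s - t| <= 3 * r -> `|b - a| <= 5 * r.
Proof. by rewrite !ler_norml => /andP[? ?] /andP[? ?] /andP[? ?]; apply/andP; split; lra. Qed.

Variable (i0 : 'I_d).
Let axis (t : R) : V := t *: delta_mx 0 i0.

Let axisE t : axis t 0 i0 = t. Proof. by rewrite !mxE !eqxx mulr1. Qed.

Let axisB t s k : `|axis t 0 k - axis s 0 k| <= `|t - s|.
Proof.
rewrite /axis !mxE eqxx /= -mulrBl normrM ler_piMr //.
by case: (k == i0); rewrite ?normr1 // normr0.
Qed.

(** Of the two points at [t] and [t + 3 r] on the axis, where [r] bounds the
    distance at which a point of [A] can be an obstruction, one is admissible: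
    otherwise the obstructions to them are distinct, and closer to each other
    than the separation of [A] allows. *)
Lemma separated_room (p de : R) : 0 < p -> 0 < de ->
  exists de1 : R, [/\ 0 < de1, de1 <= 1, de1 <= de & forall A, separated p de A ->
   forall t, 0 <= t -> exists s, t <= s <= t + 1 /\ forall a, A a ->
     de1 * jbracket (axis s) `^ (- p) <= enorm (a - axis s) /\
     de1 * jbracket a `^ (- p) <= enorm (a - axis s)].
Proof.
move=> p0 de0; have [c cE] : exists c : R, c = 2 `^ p by eexists.
have c1 : 1 <= c by rewrite cE -[leLHS](powRr0 2); apply: ler_powR; rewrite ?ler1n // (ltW p0).
have dd1 : 1 <= d%:R :> R by rewrite ler1n; case: (d) i0 => // -[].
(* [c] bounds the change of [jbracket _ `^ (- p)] within a distance of 1/4; the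
   two obstructions differ by at most [5 r] in each coordinate *)
pose de1 := Num.min (1 / (4 * c)) (de / (5 * d%:R * c ^+ 2 + 1)).
have D0 : 0 < 5 * d%:R * c ^+ 2 + 1.
  by rewrite ltr_wpDl // mulr_ge0 ?sqr_ge0 // mulr_ge0.
have c40 : 0 < 4 * c by lra.
have de1_gt0 : 0 < de1 by rewrite lt_min !divr_gt0.
have de1c : de1 * c <= 1 / 4.
  have : de1 <= 1 / (4 * c) by rewrite ge_min lexx.
  rewrite ler_pdivlMr //; lra.
have de14 : de1 <= 1 / 4 by nra.
have de1D : 5 * d%:R * c ^+ 2 * de1 < de.
  have : de1 <= de / (5 * d%:R * c ^+ 2 + 1) by rewrite ge_min lexx orbT.
  rewrite ler_pdivlMr //; nra.
exists de1; split => //.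
- lra.
- have : 1 <= c ^+ 2 by rewrite exprn_ege1.
  have : 1 <= d%:R * c ^+ 2 by rewrite mulr_ege1 // exprn_ege1.
  move=> h1 h2; have : de1 <= 5 * d%:R * c ^+ 2 * de1 by rewrite ler_peMl ?(ltW de1_gt0) // -mulrA; lra.
  lra.
move=> A sA t t0; clearbody de1.
pose bad s a := A a /\ (enorm (a - axis s) < de1 * jbracket (axis s) `^ (- p) \/
  enorm (a - axis s) < de1 * jbracket a `^ (- p)).
have jle1 (x : V) : jbracket x `^ (- p) <= 1.
  by rewrite -(powRr0 (jbracket x)) jbracket_powR_le // oppr_le0 ltW.
have close s a : bad s a -> enorm (a - axis s) < 1 / 4.
  move=> [_ h]; apply: lt_le_trans de14.
  case: h => h; apply: lt_le_trans h _; by rewrite ler_piMr ?(ltW de1_gt0).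
have badP s a : bad s a -> enorm (a - axis s) < c * de1 * jbracket (axis s) `^ (- p).
  move=> b; have h4 := close _ _ b; case: b => _ [h|h]; apply: lt_le_trans h _.
    by rewrite ler_wpM2r ?powR_ge0 // ler_peMl // ltW.
  rewrite mulrAC [leRHS]mulrC ler_wpM2l ?(ltW de1_gt0) // cE.
  by apply: jbracket_near_powR => //; rewrite enormBC.
have good s : (forall a, ~ bad s a) -> forall a, A a ->
    de1 * jbracket (axis s) `^ (- p) <= enorm (a - axis s) /\
    de1 * jbracket a `^ (- p) <= enorm (a - axis s).
  move=> nb a Aa; split; rewrite leNgt; apply/negP => h; apply: (nb a); split=> //.
    by left.
  by right.
have [r rE] : exists r, r = c * de1 * jbracket (axis t) `^ (- p) by eexists.
have r0 : 0 < r by rewrite rE mulr_gt0 ?powR_gt0 ?jbracket_gt0 // mulr_gt0 // (lt_le_trans ltr01).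
have r4 : r <= 1 / 4.
  by apply: le_trans de1c; rewrite rE [c * _]mulrC ler_piMr // mulr_ge0 // ltW // (lt_le_trans ltr01).
have tr : t <= t + 3 * r by rewrite lerDl mulr_ge0 // ltW.
have [[a ba]|nb] := pselect (exists a, bad t a); last first.
  exists t; split; first by rewrite lexx lerDl ler01.
  by apply: good => a ba; apply: nb; exists a.
have [[a' ba']|nb] := pselect (exists a, bad (t + 3 * r) a); last first.
  exists (t + 3 * r); split; first by apply/andP; split; lra.
  by apply: good => a' ba'; apply: nb; exists a'.
exfalso.
have h1 := badP _ _ ba; have h2 := badP _ _ ba'; rewrite -rE in h1.
have jt : jbracket (axis t) <= jbracket (axis (t + 3 * r)).
  rewrite ler_sqrt ?addr_ge0 ?sqr_ge0 // lerD2l lerXn2r ?nnegrE ?sqrtr_ge0 //.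
  rewrite ler_sqrt ?dotp_ge0 //; apply: ler_sum => k _; rewrite -!expr2.
  by rewrite !mxE !exprMn ler_wpM2r ?sqr_ge0 // lerXn2r ?nnegrE // (le_trans t0).
have h2' : enorm (a' - axis (t + 3 * r)) < r.
  apply: lt_le_trans h2 _; apply: (@le_trans _ _ (c * de1 * jbracket (axis t) `^ (- p))); last by rewrite -rE.
  rewrite ler_wpM2l ?mulr_ge0 ?(ltW de1_gt0) //.
    exact: le_trans ler01 c1.
  rewrite !powRN lef_pV2 ?posrE ?powR_gt0 ?jbracket_gt0 //.
  by apply: ge0_ler_powR; rewrite ?nnegrE ?(ltW p0) // ltW ?jbracket_gt0.
have k1 k : `|a 0 k - axis t 0 k| <= r.
  by have := coord_le_enorm (a - axis t) k; rewrite !mxE => h; apply: le_trans h (ltW h1).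
have k2 k : `|a' 0 k - axis (t + 3 * r) 0 k| <= r.
  by have := coord_le_enorm (a' - axis (t + 3 * r)) k; rewrite !mxE => h; apply: le_trans h (ltW h2').
have aa' : a != a'.
  apply/eqP => e; have := k2 i0; have := k1 i0; rewrite -e !axisE !ler_norml.
  move=> /andP[? ?] /andP[? ?]; lra.
have := sA a a' ba.1 ba'.1 aa'; rewrite leNgt => /negP[].
apply: (@le_lt_trans _ _ (d%:R * (5 * r))).
  apply: enorm_le_coord => [|k]; first by rewrite mulr_ge0 // ltW.
  rewrite [X in `|X|](_ : _ = a' 0 k - a 0 k); last by rewrite !mxE.
  apply: (near_diff (k1 k) (k2 k)); apply: le_trans (axisB _ _ _) _.
  by rewrite addrC addKr ger0_norm // mulr_ge0 // ltW.
have ja : jbracket (axis t) `^ (- p) <= c * jbracket a `^ (- p).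
  by rewrite cE; apply: jbracket_near_powR => //; exact: close ba.
have ja0 : 0 < jbracket a `^ (- p) by rewrite powR_gt0 // jbracket_gt0.
apply: (@le_lt_trans _ _ (5 * d%:R * c ^+ 2 * de1 * jbracket a `^ (- p))).
  rewrite rE [leLHS](_ : _ = 5 * d%:R * c * de1 * jbracket (axis t) `^ (- p)); last by ring.
  rewrite [leRHS](_ : _ = 5 * d%:R * c * de1 * (c * jbracket a `^ (- p))); last by ring.
  rewrite ler_wpM2l // !mulr_ge0 ?(ltW de1_gt0) //; exact: le_trans ler01 c1.
by rewrite ltr_pM2r.
Qed.

(** The new points are taken on a half-axis, one in each of the intervals
    of length 1 that start at the points |rho| + 3 k: this keeps them at a distance of at least 1
    from one another. The new separation depends neither on their number nor on
    [rho]. *)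
Lemma separated_extension (p de : R) : 0 < p -> 0 < de ->
  exists de1 : R, [/\ 0 < de1, de1 <= de & forall A, separated p de A ->
   forall rho (N : nat), exists x : 'I_N -> V,
    [/\ injective x, forall k, ~ A (x k), forall k, rho <= jbracket (x k) &
        separated p de1 (A `|` range x)]].
Proof.
move=> p0 de0; have [de1 [de1_gt0 de1_le1 de1_le room]] := separated_room p0 de0.
exists de1; split=> // A sA rho N.
have /choice[s hs] : forall k : 'I_N, exists s, `|rho| + 3 * k%:R <= s <= `|rho| + 3 * k%:R + 1 /\
    forall a, A a ->
     de1 * jbracket (axis s) `^ (- p) <= enorm (a - axis s) /\
     de1 * jbracket a `^ (- p) <= enorm (a - axis s).
  by move=> k; apply: room => //; rewrite addr_ge0 // mulr_ge0.
have far (k l : 'I_N) : (k < l)%N -> 1 <= s l - s k.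
  move=> kl; have [/andP[_ h1] _] := hs k; have [/andP[h2 _] _] := hs l.
  have : k%:R + 1 <= l%:R :> R by rewrite natr1 ler_nat.
  lra.
have far' (k l : 'I_N) : k != l -> 1 <= enorm (axis (s l) - axis (s k)).
  move=> kl; have := coord_le_enorm (axis (s l) - axis (s k)) i0.
  rewrite !mxE !eqxx !mulr1; apply: le_trans.
  move: kl; rewrite neq_ltn => /orP[/far h|/far h].
    by apply: le_trans h (ler_norm _).
  by rewrite distrC; apply: le_trans h (ler_norm _).
have jle1 (x : V) : jbracket x `^ (- p) <= 1.
  by rewrite -(powRr0 (jbracket x)) jbracket_powR_le // oppr_le0 ltW.
exists (fun k => axis (s k)); split.
- move=> k l e; apply/eqP; apply: contraT => /far'.
  by rewrite e subrr enorm0 ler10.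
- move=> k Ax; have [_ /(_ _ Ax)[]] := hs k; rewrite subrr enorm0.
  by rewrite leNgt mulr_gt0 // powR_gt0 // jbracket_gt0.
- move=> k; have [/andP[h _] _] := hs k.
  apply: le_trans (coord_le_jbracket (axis (s k)) i0); rewrite axisE.
  apply: le_trans (ler_norm _); apply: le_trans h.
  by apply: le_trans (ler_norm _) _; rewrite lerDl mulr_ge0.
move=> a a' [Aa|[k _ <-]] [Aa'|[l _ <-]] aa'.
- by apply: le_trans (sA a a' Aa Aa' aa'); rewrite ler_wpM2r // powR_ge0.
- by have [_ /(_ a Aa)[_ h]] := hs l; rewrite enormBC.
- by have [_ /(_ a' Aa')[h _]] := hs k.
have kl : k != l by apply: contra aa' => /eqP ->.
apply: le_trans (far' _ _ kl); rewrite -[leRHS]mulr1.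
by apply: ler_pM; rewrite ?powR_ge0 // ltW.
Qed.

End extra_points.

(** * Dimensions of quotients *)

Section linear_algebra.
Variables (K : fieldType) (V : lmodType K).

(** A vector with a nonzero coefficient in a relation modulo [W] can be removed
    from the family. *)
Lemma quot_dim_of_span (U W : set V) m (e : 'I_m -> V) :
  (forall c u v, W u -> W v -> W (c *: u + v)) ->
  (forall i, U (e i)) ->
  (forall u, U u -> exists c : 'I_m -> K, W (u - \sum_(i < m) c i *: e i)) ->
  exists n, (n <= m)%N /\ quot_dim U W n.
Proof.
move=> Wlin; elim: m e => [|m ih] e Ue span.
  by exists 0%N; split=> //; exists e; split=> // c _ [].
have [indep|/existsNP[c /not_implyP[Wc /existsNP[k /eqP ck]]]] :=
    pselect (forall c : 'I_m.+1 -> K, W (\sum_(i < m.+1) c i *: e i) -> forall i, c i = 0).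
  by exists m.+1; split=> //; exists e; split.
have span' u : U u -> exists c' : 'I_m -> K, W (u - \sum_(i < m) c' i *: e (lift k i)).
  move=> /span[c' Wc']; pose t := c' k / c k.
  exists (fun i => c' (lift k i) - t * c (lift k i)).
  have -> : u - \sum_(i < m) (c' (lift k i) - t * c (lift k i)) *: e (lift k i) =
      t *: (\sum_(i < m.+1) c i *: e i) + (u - \sum_(i < m.+1) c' i *: e i).
    rewrite !(bigD1_ord k) //= scalerDr scalerA mulfVK // scaler_sumr.
    under eq_bigr do rewrite scalerBl -scalerA.
    rewrite sumrB; set x := c' k *: _; set y := \sum_(i < m) _; set z := \sum_(i < m) _.
    by rewrite opprB opprD [RHS]addrCA [in RHS]addrACA subrr add0r.
  exact: Wlin.
have [n [nm Qn]] := ih _ (fun i => Ue (lift k i)) span'.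
by exists n; split=> //; exact: leqW.
Qed.

End linear_algebra.

(** * The points in a ball *)

Section finite_predicates.

Lemma finite_list (T : eqType) (P : T -> Prop) C :
  (forall l : seq T, uniq l -> (forall x, x \in l -> P x) -> (size l <= C)%N) ->
  exists l : seq T, uniq l /\ forall x, x \in l <-> P x.
Proof.
move=> bnd; apply: contrapT => nl.
suff [l [ul lP sl]] : exists l : seq T, [/\ uniq l, forall x, x \in l -> P x & size l = C.+1].
  by have := bnd l ul lP; rewrite sl ltnn.
elim: C.+1 => [|n [l [ul lP sl]]]; first by exists [::].
have [x [xP xl]] : exists x, P x /\ x \notin l.
  apply: contrapT => h; apply: nl; exists l; split=> // x; split; first exact: lP.
  by move=> xP; apply: contrapT => /negP xl; apply: h; exists x.
exists (x :: l); split; [by rewrite /= xl| |by rewrite /= sl].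
by move=> y; rewrite inE => /orP[/eqP ->//|]; exact: lP.
Qed.

Variables (R : realType) (d : nat).
Local Notation V := 'rV[R]_d.

Lemma low_points (p q de rho : R) : 0 < de -> exists C : nat, forall A B : set V,
  separated p de A -> separated q de B -> exists L : seq (bool * V),
  [/\ uniq L, (size L <= C)%N & forall i, i \in L <-> in_sets A B i /\ jbracket i.2 < rho].
Proof.
move=> de0; have [CA hA] := @separated_count R d p de rho de0.
have [CB hB] := @separated_count R d q de rho de0.
exists (CA + CB)%N => A B sA sB.
have bnd (l : seq (bool * V)) : uniq l ->
    (forall i, i \in l -> in_sets A B i /\ jbracket i.2 < rho) -> (size l <= CA + CB)%N.
  move=> ul lP; rewrite -(count_predC fst l) -!size_filter.
  have us (P : pred (bool * V)) b : (forall i, P i -> i.1 = b) ->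
      uniq [seq i.2 | i <- [seq i <- l | P i]].
    move=> Pb; rewrite map_inj_in_uniq ?filter_uniq // => -[b1 x] [b2 y].
    by rewrite !mem_filter => /andP[/Pb /= -> _] /andP[/Pb /= -> _] ->.
  apply: leq_add; rewrite -(size_map snd).
    apply: (hA A _ sA (us _ true _)) => // a /mapP[[b x]].
    by rewrite mem_filter /= => /andP[bt /lP]; rewrite bt /in_sets /= => h ->.
  apply: (hB B _ sB (us _ false _)) => [[[] ?]//|a /mapP[[b x]]].
  by rewrite mem_filter /= => /andP[/negbTE bt /lP]; rewrite bt /in_sets /= => h ->.
have [L [uL LP]] := finite_list bnd.
by exists L; split=> //; apply: bnd uL _ => i /LP.
Qed.

End finite_predicates.

(** * The cokernel and the kernel *)

Section conclusion.
Variables (R : realType) (d : nat).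
Local Open Scope complex_scope.
Local Notation normc := Normc.normc.
Local Notation V := 'rV[R]_d.
Implicit Types (A B : set V) (f g : V -> R[i]^o) (i : bool * V).

Lemma eval_lin i f g (c : R[i]) : schwartz f -> schwartz g ->
  eval_at i (c *: f + g) = c * eval_at i f + eval_at i g.
Proof.
move=> fs gs; rewrite /eval_at; case: i.1 => //.
have df := schwartz_decayingC fs; have dg := schwartz_decayingC gs.
by rewrite -fourierZ // -fourierD //; exact: decayingCZ.
Qed.

Lemma schwartz0 : schwartz (0 : V -> R[i]^o).
Proof. by have := schwartzZ 0 (@schwartz_wave R d 1 0 0 ltr01); rewrite scale0r. Qed.

Lemma eval_sum i (I : Type) (r : seq I) (c : I -> R[i]) (f : I -> V -> R[i]^o) :
  (forall k, schwartz (f k)) -> schwartz (\sum_(k <- r) c k *: f k) /\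
  eval_at i (\sum_(k <- r) c k *: f k) = \sum_(k <- r) c k * eval_at i (f k).
Proof.
move=> fs; elim: r => [|k r [ih1 ih2]].
  rewrite !big_nil; split; first exact: schwartz0.
  have := eval_lin i (-1) schwartz0 schwartz0.
  by rewrite scaler0 addr0 mulN1r addNr.
rewrite !big_cons; split; first by apply: schwartzD => //; exact: schwartzZ.
by rewrite eval_lin // ih2.
Qed.

Section restriction.
Variables (A B : set V).

Definition restrict (u : bool * V -> R[i]) : (A -> R[i]^o) * (B -> R[i]^o) :=
  (fun a => u (true, val a), fun b => u (false, val b)).

Lemma restrict_ext u v : (forall i, in_sets A B i -> u i = v i) -> restrict u = restrict v.
Proof.
move=> uv; rewrite /restrict; congr pair; apply/funext => a; apply: uv; exact: set_valP.
Qed.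

Lemma restrict_sum (I : Type) (r : seq I) (c : I -> R[i]) (v : I -> bool * V -> R[i]) :
  \sum_(k <- r) c k *: restrict (v k) = restrict (fun i => \sum_(k <- r) c k * v k i).
Proof.
elim: r => [|k r ih].
  by rewrite big_nil (@restrict_ext _ (fun=> 0)) // => i _; rewrite big_nil.
rewrite big_cons ih; apply: (@restrict_ext (fun i => c k * v k i + \sum_(l <- r) c l * v l i)) => i _.
by rewrite big_cons.
Qed.

Lemma FAB_restrict f : FAB A B f = restrict (fun i => eval_at i f).
Proof. by []. Qed.

Lemma restrict_onto s : exists u, restrict u = s.
Proof.
exists (fun i => if i.1
  then if pselect (exists a : A, val a = i.2) is left h then s.1 (projT1 (cid h)) else 0
  else if pselect (exists b : B, val b = i.2) is left h then s.2 (projT1 (cid h)) else 0).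
case: s => sA sB; rewrite /restrict /=; congr pair; apply/funext => a.
  case: pselect => [h|[]]; last by exists a.
  by case: (cid h) => a' /= /val_inj ->.
case: pselect => [h|[]]; last by exists a.
by case: (cid h) => a' /= /val_inj ->.
Qed.

Lemma rapid_restrict u : @rapid_pairs R d A B (restrict u) <-> rapid_on A B u.
Proof.
split=> [[uA uB] j|ur].
  have [MA hA] := uA j; have [MB hB] := uB j.
  exists (`|MA| + `|MB|) => -[[] x] xI /=.
    apply: (@le_trans _ _ MA); first exact: (hA (SigSub (mem_set (xI : A x)))).
    by rewrite (le_trans (ler_norm _)) // lerDl.
  apply: (@le_trans _ _ MB); first exact: (hB (SigSub (mem_set (xI : B x)))).
  by rewrite (le_trans (ler_norm _)) // lerDr.
by split=> j; have [M hM] := ur j; exists M => a; apply: (hM (_, _)); exact: set_valP.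
Qed.

Lemma rapid_on_delta i0 : rapid_on A B (fun i => (i == i0)%:R : R[i]).
Proof.
move=> j; exists (jbracket i0.2 ^+ j) => i _; have [->|_] := eqVneq i i0.
  by rewrite Normc.normc1 mul1r.
by rewrite Normc.normc0 mul0r exprn_ge0 // ltW // jbracket_gt0.
Qed.

Lemma image_FAB_lin (c : R[i]) u v : (FAB A B @` @schwartz R d) u ->
  (FAB A B @` @schwartz R d) v -> (FAB A B @` @schwartz R d) (c *: u + v).
Proof.
move=> [f fs <-] [g gs <-]; exists (c *: f + g).
  by apply: schwartzD => //; exact: schwartzZ.
rewrite FAB_restrict.
rewrite (restrict_ext (v := fun i => c * eval_at i f + eval_at i g)) // => i _.
exact: eval_lin.
Qed.

End restriction.

(** Modulo the image every pair of sequences is supported on the points of a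
    fixed ball, by [solve_high], and the number of these points is bounded. *)
Theorem coker_bounded (p q de : R) : 0 < p -> 0 < q -> p * q < 1 -> 0 < de ->
  exists C : nat, forall A B, separated p de A -> separated q de B ->
  exists n, (n <= C)%N /\ Coker_FAB_dim A B n.
Proof.
move=> p0 q0 pq1 de0; have [rho hrho] := @solve_high R d _ _ _ p0 q0 pq1 de0.
have [C hC] := @low_points R d p q de rho de0.
exists C => A B sA sB; have [L [uL sL LP]] := hC A B sA sB.
pose pt (k : 'I_(size L)) := tnth (in_tuple L) k.
pose e k := restrict A B (fun i => (i == pt k)%:R).
have [|k|s sr|n [nL hn]] := @quot_dim_of_span _ _ (@rapid_pairs R d A B) (FAB A B @` @schwartz R d) _ e.
- exact: image_FAB_lin.
- by apply/rapid_restrict; exact: rapid_on_delta.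
- have [u uE] := restrict_onto s; have ur : rapid_on A B u.
    by apply/rapid_restrict; rewrite uE.
  have [f [fs fE]] := hrho A B sA sB u ur.
  exists (fun k => u (pt k) - eval_at (pt k) f), f => //.
  rewrite restrict_sum -uE FAB_restrict.
  apply: (@restrict_ext A B _ (fun i => u i - \sum_k (u (pt k) - eval_at (pt k) f) * (i == pt k)%:R)).
  move=> i iI; have [hi|hi] := leP rho (jbracket i.2).
    rewrite big1 ?subr0 ?fE // => k _; have [ik|_] := eqVneq; last by rewrite mulr0.
    have /LP[_] : i \in L by rewrite ik mem_tnth.
    by rewrite ltNge hi.
  have /tnthP[k ik] : i \in in_tuple L by apply/LP.
  rewrite (bigD1 k) //= ik eqxx mulr1 big1 ?addr0 ?subKr // => l lk.
  by rewrite (inj_eq (tuple_uniqP (in_tuple L) uL)) eq_sym (negbTE lk) mulr0.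
by exists n; split=> //; exact: leq_trans sL.
Qed.

(** Let [N = l + n + 1] far points be added to [A], where [l] is the number of
    points of [A] and [B] in a ball. There are functions with the value 1 at one
    of the new points, 0 at the others, and 0 at the points of [A] and [B]
    outside the ball. The [l] remaining equations cut out a space of
    combinations of dimension at least [n + 1], on which the evaluation at the
    new points is injective; the kernel thus has no basis of [n] elements. *)
Theorem kernel_infinite (p q de : R) : (0 < d)%N -> 0 < p -> 0 < q -> p * q < 1 -> 0 < de ->
  forall A B, separated p de A -> separated q de B -> infinite_dim (Ker_FAB A B).
Proof.
move=> d0 p0 q0 pq1 de0 A B sA sB [n [e [_ span _]]].
have [de1 [de1_gt0 de1_le ext]] := @separated_extension R d (Ordinal d0) p de p0 de0.
have [rho hrho] := @solve_high R d _ _ _ p0 q0 pq1 de1_gt0.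
have [_ /(_ A B sA sB)[L [_ _ LP]]] := @low_points R d p q de rho de0.
pose l := size L; pose N := (l + n.+1)%N.
have [x [x_inj xA x_high sx]] := ext A sA rho N.
have xI k : in_sets (A `|` range x) B (true, x k) by right; exists k.
have /choice[f hf] : forall k, exists f : V -> R[i]^o, schwartz f /\
    forall i, in_sets (A `|` range x) B i -> rho <= jbracket i.2 ->
      eval_at i f = (i == (true, x k))%:R.
  move=> k; apply: hrho => //; [exact: separated_le de1_le sB|exact: rapid_on_delta].
have fs k : schwartz (f k) by have [] := hf k.
pose M : 'M[R[i]]_(N, l) := \matrix_(k, j) eval_at (tnth (in_tuple L) j) (f k).
pose F r := \sum_k kermx M r k *: f k.
have Fs r : schwartz (F r) by have [] := eval_sum (true, 0) (index_enum 'I_N) (kermx M r) fs.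
have FE r i : eval_at i (F r) = \sum_k kermx M r k * eval_at i (f k).
  by have [] := eval_sum i (index_enum 'I_N) (kermx M r) fs.
have Fker r : Ker_FAB A B (F r).
  split=> //; rewrite FAB_restrict (@restrict_ext A B _ (fun=> 0)) // => i iI.
  rewrite FE; have [hi|hi] := leP rho (jbracket i.2).
    rewrite big1 // => k _; have [_ ->//] := hf k.
      have [ix|_] := eqVneq; last by rewrite mulr0.
      by case: (xA k); move: iI; rewrite ix.
    by move: iI; rewrite /in_sets; case: i.1 => //; left.
  have /tnthP[j ->] : i \in in_tuple L by apply/LP.
  have /matrixP/(_ r j) := mulmx_ker M; rewrite [LHS]mxE [RHS]mxE => h0; rewrite -[RHS]h0.
  by apply: eq_bigr => k _; rewrite [M _ _]mxE.
have /choice[c hc] : forall r, exists c : 'I_n -> R[i], F r = \sum_(j < n) c j *: e j.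
  by move=> r; have [c /eqP] := span _ (Fker r); rewrite subr_eq0 => /eqP ->; exists c.
have KE : kermx M = (\matrix_(r < N, j < n) c r j) *m (\matrix_(j < n, k < N) (e j (x k) : R[i])).
  apply/matrixP => r k; rewrite [RHS]mxE.
  have := FE r (true, x k); rewrite (bigD1 k) //= big1 => [|k' kk'].
    have [_ ->//] := hf k; rewrite ?eqxx ?mulr1 ?addr0 //; last exact: x_high.
    move=> <-; rewrite /eval_at /= hc fct_sumE; apply: eq_bigr => j _.
    by rewrite !mxE.
  have [_ ->//] := hf k'; last exact: x_high.
  by rewrite xpair_eqE /= (inj_eq x_inj) eq_sym (negbTE kk') mulr0.
have : (\rank (kermx M) <= n)%N.
  by rewrite KE (leq_trans (mxrankM_maxl _ _)) // rank_leq_col.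
rewrite mxrank_ker leqNgt => /negP[]; apply: (@leq_trans (N - l)).
  by rewrite /N addKn.
by apply: leq_sub2l; exact: rank_leq_col.
Qed.

Theorem all_surjective (p q : R) : (0 < d)%N -> 0 < p -> 0 < q -> p * q < 1 ->
  exists de0 : R, 0 < de0 /\ forall de, de0 <= de -> forall A B,
  separated p de A -> separated q de B -> FAB_surjective A B.
Proof.
move=> d0 p0 q0 pq1; have [de0 [de0_gt0 h]] := solve_all d0 p0 q0 pq1.
exists de0; split=> // de dede A B sA sB s sr.
have [u uE] := restrict_onto s.
have ur : rapid_on A B u by apply/rapid_restrict; rewrite uE.
have [f [fs fE]] := h de dede A B sA sB u ur.
exists f => //; rewrite -uE FAB_restrict; exact: (@restrict_ext A B (fun i => eval_at i f)).
Qed.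

End conclusion.

Theorem theorem1p3 (R : realType) (d : nat) (p q : R)
    (hd : (1 <= d)%N) (hp : 0 < p) (hq : 0 < q) (hpq : p * q < 1) :
  (forall delta : R, 0 < delta ->
     exists C : nat, forall A B : set 'rV[R]_d,
       ball_separated p delta A -> ball_separated q delta B ->
       (exists n : nat, (n <= C)%N /\ Coker_FAB_dim A B n)
       /\ infinite_dim (Ker_FAB A B))
  /\
  (exists delta0 : R, 0 < delta0 /\
     forall delta : R, delta0 <= delta ->
       forall A B : set 'rV[R]_d,
         ball_separated p delta A -> ball_separated q delta B ->
         FAB_surjective A B).
Proof.
split=> [de de0|].
  have [C hC] := @coker_bounded R d p q de hp hq hpq de0.
  exists C => A B /(ball_separatedP de0) sA /(ball_separatedP de0) sB.
  by split; [exact: hC|exact: kernel_infinite sA sB].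
have [de0 [de0_gt0 h]] := @all_surjective R d p q hd hp hq hpq.
exists de0; split=> // de dede A B; have de_gt0 := lt_le_trans de0_gt0 dede.
by move=> /(ball_separatedP de_gt0) sA /(ball_separatedP de_gt0) sB; exact: h sA sB.
Qed.
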